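(* Let $f,g$ be holomorphic on the open unit disc $\mathbb{D}$, and let $C_1,C_2$ be two distinct circles contained in $\mathbb{D}$, bounding open discs $D_1$ and $D_2$ respectively, such that $|f|=|g|$ on $C_1\cup C_2$. Suppose (possibly after swapping the roles of $C_1$ and $C_2$) that one of the following holds: (1) $C_1$ and $C_2$ are disjoint with $C_2\subset D_1$; (2) $C_1$ and $C_2$ are disjoint with $C_2\subset\mathbb{D}\setminus\overline{D_1}$; (3) $C_1$ and $C_2$ are tangent with $C_2\subset\overline{D_1}$; (4) $C_1$ and $C_2$ are tangent with $C_2\subset\mathbb{D}\setminus D_1$; (5) $C_1$ and $C_2$ intersect in two points, at which they make an angle $\theta\in(0,\pi/2]$. Then in cases (1)–(4), $f=cg$ for some $c$ with $|c|=1$; in case (5) the same conclusion holds if $\theta$ is an irrational multiple of $\pi$. Moreover, if $\theta$ is a rational multiple of $\pi$ the conclusion need not hold in case (5): there exist circles $C_1,C_2\subset\mathbb{D}$ as in (5) with such an angle and holomorphic $f,g$ on $\mathbb{D}$ with $|f|=|g|$ on $C_1\cup C_2$ but $f\neq cg$ for every $c$ with $|c|=1$. *)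

(* Defs.v *)
From Stdlib Require Import Reals QArith.
From Coquelicot Require Import Coquelicot.
Open Scope R_scope.

Definition unit_disc (z : C) : Prop := Cmod z < 1.

Definition holo_on_disc (f : C -> C) : Prop :=
  forall z : C, unit_disc z -> @ex_derive C_AbsRing C_NormedModule f z.

Definition circle (a : C) (r : R) (z : C) : Prop := Cmod (z - a)%C = r.
Definition odisc (a : C) (r : R) (z : C) : Prop := Cmod (z - a)%C < r.
Definition cdisc (a : C) (r : R) (z : C) : Prop := Cmod (z - a)%C <= r.

Definition circle_in_D (a : C) (r : R) : Prop :=
  0 < r /\ forall z, circle a r z -> unit_disc z.

Definition inter (a1 : C) (r1 : R) (a2 : C) (r2 : R) (z : C) : Prop :=
  circle a1 r1 z /\ circle a2 r2 z.

Definition disjoint_circles a1 r1 a2 r2 : Prop := forall z, ~ inter a1 r1 a2 r2 z.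

Definition tangent_circles a1 r1 a2 r2 : Prop :=
  exists p, inter a1 r1 a2 r2 p /\ forall z, inter a1 r1 a2 r2 z -> z = p.

Definition two_point_circles a1 r1 a2 r2 : Prop :=
  exists p q, p <> q /\ inter a1 r1 a2 r2 p /\ inter a1 r1 a2 r2 q /\
    forall z, inter a1 r1 a2 r2 z -> z = p \/ z = q.

Definition case1 a1 r1 a2 r2 : Prop :=
  disjoint_circles a1 r1 a2 r2 /\ forall z, circle a2 r2 z -> odisc a1 r1 z.
Definition case2 a1 r1 a2 r2 : Prop :=
  disjoint_circles a1 r1 a2 r2 /\
  forall z, circle a2 r2 z -> unit_disc z /\ ~ cdisc a1 r1 z.
Definition case3 a1 r1 a2 r2 : Prop :=
  tangent_circles a1 r1 a2 r2 /\ forall z, circle a2 r2 z -> cdisc a1 r1 z.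
Definition case4 a1 r1 a2 r2 : Prop :=
  tangent_circles a1 r1 a2 r2 /\
  forall z, circle a2 r2 z -> unit_disc z /\ ~ odisc a1 r1 z.

Definition cases1to4 a1 r1 a2 r2 : Prop :=
  case1 a1 r1 a2 r2 \/ case2 a1 r1 a2 r2 \/ case3 a1 r1 a2 r2 \/ case4 a1 r1 a2 r2.

Definition tangent_dir (a p : C) : C := (Ci * (p - a))%C.

(* (unoriented) angle in [0, pi/2] between the lines spanned by nonzero w1, w2 *)
Definition line_angle (w1 w2 : C) : R :=
  acos (Rabs (Re (w1 * Cconj w2)%C) / (Cmod w1 * Cmod w2)).

Definition circle_angle (a1 a2 p : C) : R :=
  line_angle (tangent_dir a1 p) (tangent_dir a2 p).

Definition case5 a1 r1 a2 r2 (theta : R) : Prop :=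
  two_point_circles a1 r1 a2 r2 /\ 0 < theta <= PI / 2 /\
  forall p, inter a1 r1 a2 r2 p -> circle_angle a1 a2 p = theta.

Definition rational_multiple_of_pi (theta : R) : Prop :=
  exists q : Q, theta = Q2R q * PI.

Definition eq_mod_on_circles (f g : C -> C) a1 r1 a2 r2 : Prop :=
  forall z, circle a1 r1 z \/ circle a2 r2 z -> Cmod (f z) = Cmod (g z).

Definition unimodular_multiple (f g : C -> C) : Prop :=
  exists c : C, Cmod c = 1 /\ forall z, unit_disc z -> f z = (c * g z)%C.

(* Main.v *)
(** On the disc of [C1] the zero-free part of [f / g] is constant by the maximum principle, so [f / g] is there a quotient of finite Blaschke products. Hence [f / g] is rational, and the reflection in each of the two circles exchanges its zeros and its poles. The composition [T] of the two reflections is a Moebius map permuting the finite set of zeros; in all cases considered no point off the fixed points of [T] has finite orbit, and at most one fixed point lies in the disc of [C1]. So [f / g] is a power of a single Blaschke factor, which has modulus one only on [C1], and the exponent must be zero.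

The complex analysis rests on Goursat's bisection argument, used only for the mean value inequality at the centre of a disc. It gives the maximum principle by composing with disc automorphisms, and the maximum principle gives the identity theorem and the removability of singularities. *)
Require Import Defs.
From Stdlib Require Import Reals QArith Qreals Lra Lia List FinFun Classical ClassicalEpsilon.
From Coquelicot Require Import Coquelicot.
Open Scope R_scope.
Arguments Cmod x%_C_scope.

(** * Complex differentiability *)

(** A centre reflects to infinity, and zeros have multiplicities, so zeros and poles are kept as
    lists of nonzero vectors in homogeneous coordinates, compared by a determinant. On a circle
    conjugation can be replaced by reflection; equality of moduli then becomes a polynomial
    identity, and unique factorisation matches zeros with reflected poles.

    In these coordinates [T] is linear with determinant one and real trace [tau = (r1^2 + r2^2 - |a2
    - a1|^2) / (r1 r2)]. By Cayley-Hamilton [T^n] is a combination of [T] and the identity, in which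
    [T] has as coefficient a Chebyshev value at [tau / 2]; a point that is not fixed returns after
    [n] steps only if this value is zero. That is impossible for [|tau| >= 2], which holds for
    circles with at most one common point. Circles meeting at angle [theta] have
    [|tau| = 2 cos theta], and a zero value would make [theta] a rational multiple of [pi]. For
    different centres the fixed points solve a quadratic whose roots, measured from the centre of
    [C1], have product of modulus [r1^2], so they cannot both lie inside. *)

Definition cderiv (f : C -> C) (z l : C) : Prop :=
  forall eps, 0 < eps -> exists d, 0 < d /\
    forall w, Cmod (w - z) < d ->
      Cmod (f w - f z - l * (w - z)) <= eps * Cmod (w - z).

Definition cdiff (f : C -> C) (z : C) : Prop := exists l, cderiv f z l.

Definition ccont (f : C -> C) (z : C) : Prop :=
  forall eps, 0 < eps -> exists d, 0 < d /\
    forall w, Cmod (w - z) < d -> Cmod (f w - f z) < eps.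

Lemma Cmod_sub_comm (x y : C) : Cmod (x - y) = Cmod (y - x).
Proof. rewrite <- Cmod_opp. f_equal. ring. Qed.

Lemma Cmod_sub_le (x y : C) : Cmod (x - y) <= Cmod x + Cmod y.
Proof. unfold Cminus. rewrite <- (Cmod_opp y). apply Cmod_triangle. Qed.

Lemma Cmod_sub_ge (x y : C) : Cmod x - Cmod y <= Cmod (x - y).
Proof.
  pose proof (Cmod_triangle (x - y) y) as H.
  replace (x - y + y)%C with x in H by ring. lra.
Qed.

Lemma Cmod_sub_triangle (x y z : C) : Cmod (x - z) <= Cmod (x - y) + Cmod (y - z).
Proof. replace (x - z)%C with ((x - y) + (y - z))%C by ring. apply Cmod_triangle. Qed.

Lemma Cmod_sub_self (x : C) : Cmod (x - x) = 0.
Proof. replace (x - x)%C with (RtoC 0) by ring. apply Cmod_0. Qed.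

Lemma Csub_0_eq (x y : C) : (x - y)%C = 0 -> x = y.
Proof. intros H. replace x with (x - y + y)%C by ring. rewrite H. ring. Qed.

Lemma Csub_neq_0 (x y : C) : x <> y -> (x - y)%C <> 0.
Proof. intros H E. apply H, Csub_0_eq, E. Qed.

Lemma Cmod_sub_pos (x y : C) : x <> y -> 0 < Cmod (x - y).
Proof. intros H. apply Cmod_gt_0, Csub_neq_0, H. Qed.

Lemma Cinv_0 : (/ 0)%C = 0.
Proof. apply injective_projections; simpl; unfold Rdiv; rewrite ?Ropp_0; ring. Qed.

(** Division by zero gives zero on both sides, so the rule can be rewritten without a side
    condition. *)
Lemma Cmod_div' (x y : C) : Cmod (x / y) = Cmod x / Cmod y.
Proof.
  destruct (Ceq_dec y 0) as [->|H].
  - unfold Cdiv. rewrite Cinv_0, Cmod_mult, Cmod_0. unfold Rdiv. rewrite Rinv_0. reflexivity.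
  - apply Cmod_div, H.
Qed.

Lemma cdiff_of_ex_derive (f : C -> C) (z : C) :
  @ex_derive C_AbsRing C_NormedModule f z -> cdiff f z.
Proof.
  intros [l [_ H]]. exists l. intros eps He.
  destruct (H z (fun P HP => HP) (mkposreal eps He)) as [d Hd].
  exists d; split; [apply cond_pos|].
  intros w Hw. specialize (Hd w Hw). simpl in Hd.
  change (Cmod (f w - f z - (w - z) * l) <= eps * Cmod (w - z)) in Hd.
  now rewrite (Cmult_comm l).
Qed.

Lemma ex_derive_of_cdiff (f : C -> C) (z : C) :
  cdiff f z -> @ex_derive C_AbsRing C_NormedModule f z.
Proof.
  intros [l H]. exists l. split; [apply is_linear_scal_l|].
  intros x Hx eps.
  assert (x = z) as -> by (symmetry; now apply is_filter_lim_locally_unique).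
  destruct (H eps (cond_pos eps)) as [d [Hd0 Hd]].
  exists (mkposreal d Hd0). intros w Hw. specialize (Hd w Hw).
  change (Cmod (f w - f z - (w - z) * l) <= eps * Cmod (w - z)).
  now rewrite (Cmult_comm _ l).
Qed.

Lemma cdiff_cont (f : C -> C) (z : C) : cdiff f z -> ccont f z.
Proof.
  intros [l H] eps He.
  destruct (H 1 Rlt_0_1) as [d [Hd Hf]].
  pose proof (Cmod_ge_0 l) as Hl.
  exists (Rmin d (eps / (Cmod l + 2))). split.
  - apply Rmin_pos; [assumption|]. apply Rdiv_lt_0_compat; lra.
  - intros w Hw.
    assert (Hw1 : Cmod (w - z) < d) by (eapply Rlt_le_trans; [exact Hw|apply Rmin_l]).
    assert (Hw2 : Cmod (w - z) < eps / (Cmod l + 2)) by (eapply Rlt_le_trans; [exact Hw|apply Rmin_r]).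
    specialize (Hf w Hw1).
    pose proof (Cmod_triangle (f w - f z - l * (w - z)) (l * (w - z))) as T.
    replace (f w - f z - l * (w - z) + l * (w - z))%C with (f w - f z)%C in T by ring.
    rewrite Cmod_mult in T.
    apply Rmult_lt_compat_r with (r := Cmod l + 2) in Hw2; [|lra].
    unfold Rdiv in Hw2. rewrite Rmult_assoc, Rinv_l, Rmult_1_r in Hw2 by lra.
    pose proof (Cmod_ge_0 (w - z)). nra.
Qed.

(** Caratheodory's form of differentiability, in which the product, chain and quotient rules are statements about continuity. *)
Lemma cdiff_cara (f : C -> C) (z : C) :
  cdiff f z <-> exists (phi : C -> C) d, 0 < d /\ ccont phi z /\
    forall w, Cmod (w - z) < d -> (f w - f z = phi w * (w - z))%C.
Proof.
  split.
  - intros [l H].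
    exists (fun w => if Ceq_dec w z then l else ((f w - f z) / (w - z))%C), 1.
    split; [lra|]. split.
    + intros eps He. destruct (H (eps / 2) ltac:(lra)) as [d [Hd Hf]].
      exists d; split; [assumption|]. intros w Hw.
      destruct (Ceq_dec z z) as [_|]; [|congruence].
      destruct (Ceq_dec w z) as [->|Hn].
      * rewrite Cmod_sub_self. assumption.
      * specialize (Hf w Hw).
        pose proof (Cmod_sub_pos _ _ Hn) as Hp.
        replace ((f w - f z) / (w - z) - l)%C with ((f w - f z - l * (w - z)) / (w - z))%C
          by (field; now apply Csub_neq_0).
        rewrite Cmod_div'.
        apply Rle_lt_trans with (eps / 2); [|lra].
        apply Rmult_le_reg_r with (Cmod (w - z)); [assumption|].
        unfold Rdiv at 1. rewrite Rmult_assoc, Rinv_l, Rmult_1_r by lra. assumption.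
    + intros w _. destruct (Ceq_dec w z) as [->|Hn]; [ring|].
      field. now apply Csub_neq_0.
  - intros (phi & d & Hd & Hc & Hf).
    exists (phi z). intros eps He. destruct (Hc eps He) as [d' [Hd' Hp]].
    exists (Rmin d d'); split; [now apply Rmin_pos|].
    intros w Hw.
    rewrite Hf by (eapply Rlt_le_trans; [exact Hw|apply Rmin_l]).
    replace (phi w * (w - z) - phi z * (w - z))%C with ((phi w - phi z) * (w - z))%C by ring.
    rewrite Cmod_mult. apply Rmult_le_compat_r; [apply Cmod_ge_0|].
    left. apply Hp. eapply Rlt_le_trans; [exact Hw|apply Rmin_r].
Qed.

Lemma ccont_const (c z : C) : ccont (fun _ => c) z.
Proof. intros eps He. exists 1; split; [lra|]. intros. now rewrite Cmod_sub_self. Qed.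

Lemma ccont_plus (f g : C -> C) (z : C) :
  ccont f z -> ccont g z -> ccont (fun w => f w + g w)%C z.
Proof.
  intros Hf Hg eps He.
  destruct (Hf (eps / 2) ltac:(lra)) as [d [Hd Hf']].
  destruct (Hg (eps / 2) ltac:(lra)) as [d' [Hd' Hg']].
  exists (Rmin d d'); split; [now apply Rmin_pos|]. intros w Hw.
  specialize (Hf' w ltac:(eapply Rlt_le_trans; [exact Hw|apply Rmin_l])).
  specialize (Hg' w ltac:(eapply Rlt_le_trans; [exact Hw|apply Rmin_r])).
  replace (f w + g w - (f z + g z))%C with ((f w - f z) + (g w - g z))%C by ring.
  eapply Rle_lt_trans; [apply Cmod_triangle|]. lra.
Qed.

Lemma ccont_mult (f g : C -> C) (z : C) :
  ccont f z -> ccont g z -> ccont (fun w => f w * g w)%C z.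
Proof.
  intros Hf Hg eps He.
  set (K := Cmod (f z) + Cmod (g z) + 1).
  pose proof (Cmod_ge_0 (f z)). pose proof (Cmod_ge_0 (g z)).
  assert (HK : 0 < K) by (unfold K; lra).
  set (e := Rmin 1 (eps / (2 * K))).
  assert (He' : 0 < e) by (apply Rmin_pos; [lra|apply Rdiv_lt_0_compat; lra]).
  assert (He1 : e <= 1) by apply Rmin_l.
  assert (He2 : e * K <= eps / 2).
  { apply Rle_trans with (eps / (2 * K) * K).
    - apply Rmult_le_compat_r; [lra|apply Rmin_r].
    - right. field. lra. }
  destruct (Hf e He') as [d [Hd Hf']].
  destruct (Hg e He') as [d' [Hd' Hg']].
  exists (Rmin d d'); split; [now apply Rmin_pos|]. intros w Hw.
  specialize (Hf' w ltac:(eapply Rlt_le_trans; [exact Hw|apply Rmin_l])).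
  specialize (Hg' w ltac:(eapply Rlt_le_trans; [exact Hw|apply Rmin_r])).
  replace (f w * g w - f z * g z)%C
    with ((f w - f z) * (g w - g z) + ((f w - f z) * g z + f z * (g w - g z)))%C by ring.
  eapply Rle_lt_trans; [apply Cmod_triangle|].
  eapply Rle_lt_trans; [apply Rplus_le_compat_l, Cmod_triangle|].
  rewrite !Cmod_mult.
  pose proof (Cmod_ge_0 (f w - f z)). pose proof (Cmod_ge_0 (g w - g z)).
  assert (Cmod (f w - f z) * Cmod (g w - g z) <= e * 1) by (apply Rmult_le_compat; lra).
  assert (Cmod (f w - f z) * Cmod (g z) <= e * Cmod (g z)) by (apply Rmult_le_compat_r; lra).
  assert (Cmod (f z) * Cmod (g w - g z) <= Cmod (f z) * e) by (apply Rmult_le_compat_l; lra).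
  unfold K in He2. nra.
Qed.

Lemma ccont_comp (f g : C -> C) (z : C) :
  ccont f z -> ccont g (f z) -> ccont (fun w => g (f w)) z.
Proof.
  intros Hf Hg eps He.
  destruct (Hg eps He) as [d [Hd Hg']].
  destruct (Hf d Hd) as [d' [Hd' Hf']].
  exists d'; split; [assumption|]. intros w Hw. apply Hg', Hf', Hw.
Qed.

Lemma ccont_id (z : C) : ccont (fun w => w) z.
Proof. intros eps He. exists eps. auto. Qed.

Lemma ccont_inv (z : C) : z <> 0 -> ccont Cinv z.
Proof.
  intros Hz eps He.
  assert (Hp : 0 < Cmod z) by now apply Cmod_gt_0.
  exists (Rmin (Cmod z / 2) (eps * (Cmod z * Cmod z) / 2)). split.
  { apply Rmin_pos; [lra|]. apply Rdiv_lt_0_compat; [|lra]. repeat apply Rmult_lt_0_compat; lra. }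
  intros w Hw.
  assert (Hw1 : Cmod (w - z) < Cmod z / 2) by (eapply Rlt_le_trans; [exact Hw|apply Rmin_l]).
  assert (Hw2 : Cmod (w - z) < eps * (Cmod z * Cmod z) / 2) by (eapply Rlt_le_trans; [exact Hw|apply Rmin_r]).
  assert (Hwp : Cmod z / 2 < Cmod w).
  { pose proof (Cmod_sub_ge z w) as T. rewrite Cmod_sub_comm in T. lra. }
  assert (w <> 0) by (apply Cmod_gt_0; lra).
  replace (/ w - / z)%C with ((z - w) / (w * z))%C by (field; auto).
  rewrite Cmod_div', Cmod_mult, Cmod_sub_comm.
  apply Rmult_lt_reg_r with (Cmod w * Cmod z); [nra|].
  unfold Rdiv. rewrite Rmult_assoc, Rinv_l, Rmult_1_r by nra.
  eapply Rlt_le_trans; [exact Hw2|].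
  assert (eps * (Cmod z * Cmod z) / 2 = eps * (Cmod z / 2 * Cmod z)) as -> by field.
  apply Rmult_le_compat_l; [lra|]. apply Rmult_le_compat_r; lra.
Qed.

Lemma cdiff_local (f g : C -> C) (z : C) d :
  0 < d -> (forall w, Cmod (w - z) < d -> f w = g w) -> cdiff f z -> cdiff g z.
Proof.
  intros Hd E [l H]. exists l. intros eps He. destruct (H eps He) as [d' [Hd' Hf]].
  exists (Rmin d d'); split; [now apply Rmin_pos|]. intros w Hw.
  rewrite <- !E; [|rewrite Cmod_sub_self; assumption|].
  - apply Hf. eapply Rlt_le_trans; [exact Hw|apply Rmin_r].
  - eapply Rlt_le_trans; [exact Hw|apply Rmin_l].
Qed.

Lemma cdiff_ext (f g : C -> C) (z : C) : (forall w, f w = g w) -> cdiff f z -> cdiff g z.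
Proof. intros E. apply (cdiff_local f g z 1); auto. lra. Qed.

Lemma cdiff_const (c z : C) : cdiff (fun _ => c) z.
Proof.
  apply cdiff_cara. exists (fun _ => RtoC 0), 1. repeat split; [lra|apply ccont_const|].
  intros. ring.
Qed.

Lemma cdiff_id (z : C) : cdiff (fun w => w) z.
Proof.
  apply cdiff_cara. exists (fun _ => RtoC 1), 1. repeat split; [lra|apply ccont_const|].
  intros. ring.
Qed.

Lemma cdiff_plus (f g : C -> C) (z : C) :
  cdiff f z -> cdiff g z -> cdiff (fun w => f w + g w)%C z.
Proof.
  intros (p & d & Hd & Hp & Ef)%cdiff_cara (q & d' & Hd' & Hq & Eg)%cdiff_cara.
  apply cdiff_cara. exists (fun w => p w + q w)%C, (Rmin d d').
  repeat split; [now apply Rmin_pos|now apply ccont_plus|].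
  intros w Hw.
  specialize (Ef w ltac:(eapply Rlt_le_trans; [exact Hw|apply Rmin_l])).
  specialize (Eg w ltac:(eapply Rlt_le_trans; [exact Hw|apply Rmin_r])).
  replace (f w + g w - (f z + g z))%C with ((f w - f z) + (g w - g z))%C by ring.
  rewrite Ef, Eg. ring.
Qed.

Lemma cdiff_mult (f g : C -> C) (z : C) :
  cdiff f z -> cdiff g z -> cdiff (fun w => f w * g w)%C z.
Proof.
  intros Hf Hg. pose proof (cdiff_cont _ _ Hg) as Cg.
  apply cdiff_cara in Hf as (p & d & Hd & Hp & Ef).
  apply cdiff_cara in Hg as (q & d' & Hd' & Hq & Eg).
  apply cdiff_cara. exists (fun w => p w * g w + f z * q w)%C, (Rmin d d').
  repeat split; [now apply Rmin_pos| |].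
  { apply ccont_plus; apply ccont_mult; auto. apply ccont_const. }
  intros w Hw.
  specialize (Ef w ltac:(eapply Rlt_le_trans; [exact Hw|apply Rmin_l])).
  specialize (Eg w ltac:(eapply Rlt_le_trans; [exact Hw|apply Rmin_r])).
  replace (f w * g w - f z * g z)%C with ((f w - f z) * g w + f z * (g w - g z))%C by ring.
  rewrite Ef, Eg. ring.
Qed.

Lemma cdiff_comp (f g : C -> C) (z : C) :
  cdiff f z -> cdiff g (f z) -> cdiff (fun w => g (f w)) z.
Proof.
  intros Hf Hg. pose proof (cdiff_cont _ _ Hf) as Cf.
  apply cdiff_cara in Hf as (p & d & Hd & Hp & Ef).
  apply cdiff_cara in Hg as (q & d' & Hd' & Hq & Eg).
  destruct (Cf d' Hd') as [d1 [Hd1 Hf1]].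
  apply cdiff_cara. exists (fun w => q (f w) * p w)%C, (Rmin d d1).
  repeat split; [now apply Rmin_pos| |].
  { apply ccont_mult; auto. now apply ccont_comp. }
  intros w Hw.
  rewrite Eg by (apply Hf1; eapply Rlt_le_trans; [exact Hw|apply Rmin_r]).
  rewrite Ef by (eapply Rlt_le_trans; [exact Hw|apply Rmin_l]). ring.
Qed.

Lemma cdiff_Cinv (z : C) : z <> 0 -> cdiff Cinv z.
Proof.
  intros Hz. assert (Hp : 0 < Cmod z) by now apply Cmod_gt_0.
  apply cdiff_cara. exists (fun w => - / z * / w)%C, (Cmod z).
  repeat split; [assumption| |].
  - apply ccont_mult; [apply ccont_const|now apply ccont_inv].
  - intros w Hw. assert (w <> 0).
    { apply Cmod_gt_0. pose proof (Cmod_sub_ge z w) as T. rewrite Cmod_sub_comm in T. lra. }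
    field. auto.
Qed.

Lemma cdiff_inv (f : C -> C) (z : C) : cdiff f z -> f z <> 0 -> cdiff (fun w => / f w)%C z.
Proof. intros Hf H0. apply (cdiff_comp f Cinv); auto. now apply cdiff_Cinv. Qed.

Lemma cdiff_opp (f : C -> C) (z : C) : cdiff f z -> cdiff (fun w => - f w)%C z.
Proof.
  intros Hf. apply cdiff_ext with (fun w => RtoC (-1) * f w)%C.
  - intros. apply injective_projections; simpl; ring.
  - apply cdiff_mult; auto. apply cdiff_const.
Qed.

Lemma cdiff_minus (f g : C -> C) (z : C) :
  cdiff f z -> cdiff g z -> cdiff (fun w => f w - g w)%C z.
Proof. intros Hf Hg. apply cdiff_plus; auto. now apply cdiff_opp. Qed.

Lemma cdiff_div (f g : C -> C) (z : C) :
  cdiff f z -> cdiff g z -> g z <> 0 -> cdiff (fun w => f w / g w)%C z.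
Proof. intros Hf Hg H0. apply cdiff_mult; auto. now apply cdiff_inv. Qed.

Lemma cdiff_pow (f : C -> C) n (z : C) : cdiff f z -> cdiff (fun w => f w ^ n)%C z.
Proof.
  intros Hf. induction n; simpl; [apply cdiff_const|]. now apply cdiff_mult.
Qed.

Ltac cdiff_auto :=
  repeat (assumption || apply cdiff_id || apply cdiff_const ||
          apply cdiff_plus || apply cdiff_minus || apply cdiff_mult ||
          apply cdiff_div || apply cdiff_inv || apply cdiff_pow || apply cdiff_opp).

(** * Goursat's theorem for rectangles *)

(** Serves for the nested rectangles of the bisection and, much later, for a backward orbit inside a
    finite set of zeros. *)
Lemma dependent_choice {A : Type} (P : nat -> A -> Prop) (Q : nat -> A -> A -> Prop) (a : A) :
  P 0%nat a -> (forall n x, P n x -> exists y, P (S n) y /\ Q n x y) ->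
  exists s : nat -> A, forall n, P n (s n) /\ Q n (s n) (s (S n)).
Proof.
  intros H0 HS.
  pose (s := nat_rect (fun _ => A) a
    (fun n x => epsilon (inhabits a) (fun y => P (S n) y /\ Q n x y))).
  assert (E : forall n, P n (s n) -> P (S n) (s (S n)) /\ Q n (s n) (s (S n))).
  { intros n Hn. apply (epsilon_spec (inhabits a) (fun y => P (S n) y /\ Q n (s n) y)).
    now apply HS. }
  assert (HP : forall n, P n (s n)) by (induction n; [exact H0|now apply E]).
  exists s. intros n. split; [apply HP|now apply E].
Qed.

Lemma nested_intervals (a b : nat -> R) :
  (forall n, a n <= a (S n)) -> (forall n, b (S n) <= b n) -> (forall n, a n <= b n) ->
  exists x, forall n, a n <= x <= b n.
Proof.
  intros Ha Hb Hab.
  assert (Ma : forall n m, (n <= m)%nat -> a n <= a m).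
  { intros n m H; induction H; [lra|]. specialize (Ha m). lra. }
  assert (Mb : forall n m, (n <= m)%nat -> b m <= b n).
  { intros n m H; induction H; [lra|]. specialize (Hb m). lra. }
  assert (M : forall n m, a n <= b m).
  { intros n m. destruct (Nat.le_ge_cases n m) as [H|H].
    - eapply Rle_trans; [apply Ma, H|apply Hab].
    - eapply Rle_trans; [apply Hab|apply Mb, H]. }
  destruct (completeness (fun x => exists n, x = a n)) as [x [Hx1 Hx2]].
  - exists (b 0%nat). intros x [n ->]. apply M.
  - exists (a 0%nat), 0%nat. reflexivity.
  - exists x. intros n. split.
    + apply Hx1. now exists n.
    + apply Hx2. intros y [m ->]. apply M.
Qed.

Lemma half_pow_pos n : 0 < (1/2) ^ n.
Proof. apply pow_lt. lra. Qed.

Lemma half_pow_small e : 0 < e -> exists n, (1/2) ^ n < e.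
Proof.
  intros He. destruct (pow_lt_1_zero (1/2) ltac:(rewrite Rabs_pos_eq; lra) e He) as [n Hn].
  exists n. specialize (Hn n (le_n n)). rewrite Rabs_pos_eq in Hn; [exact Hn|].
  left. apply half_pow_pos.
Qed.

Lemma Cmod_le_Rabs (a b : R) : Cmod (a, b) <= Rabs a + Rabs b.
Proof.
  replace ((a, b) : C) with (RtoC a + Ci * RtoC b)%C by (apply injective_projections; simpl; ring).
  eapply Rle_trans; [apply Cmod_triangle|].
  rewrite Cmod_mult, Cmod_Ci, !Cmod_R. lra.
Qed.

Lemma Cmod_pair_sub_le (a b c d : R) : Cmod ((a, b) - (c, d)) <= Rabs (a - c) + Rabs (b - d).
Proof. apply (Cmod_le_Rabs (a - c) (b - d)). Qed.

Lemma im_le_Cmod (c : C) : Rabs (Im c) <= Cmod c.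
Proof.
  eapply Rle_trans; [|apply Rmax_Cmod]. apply Rmax_r.
Qed.

Lemma continuous_R_eps (g : R -> R) (t : R) :
  (forall eps, 0 < eps -> exists d, 0 < d /\ forall s, Rabs (s - t) < d -> Rabs (g s - g t) < eps) ->
  continuous g t.
Proof.
  intros H P [e He]. destruct (H e (cond_pos e)) as [d [Hd Hg]].
  exists (mkposreal d Hd). intros s Hs. apply He. apply Hg. exact Hs.
Qed.

Lemma continuous_Re_curve (F : C -> C) (p : R -> C) (t : R) :
  ccont F (p t) -> (forall s, Cmod (p s - p t) <= Rabs (s - t)) ->
  continuous (fun s => Re (F (p s))) t.
Proof.
  intros Hc Hp. apply continuous_R_eps. intros eps He.
  destruct (Hc eps He) as [d [Hd Hf]]. exists d; split; [assumption|]. intros s Hs.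
  eapply Rle_lt_trans; [|apply (Hf (p s)); eapply Rle_lt_trans; [apply Hp|exact Hs]].
  apply (re_le_Cmod (F (p s) - F (p t))).
Qed.

Lemma continuous_Im_curve (F : C -> C) (p : R -> C) (t : R) :
  ccont F (p t) -> (forall s, Cmod (p s - p t) <= Rabs (s - t)) ->
  continuous (fun s => Im (F (p s))) t.
Proof.
  intros Hc Hp. apply continuous_R_eps. intros eps He.
  destruct (Hc eps He) as [d [Hd Hf]]. exists d; split; [assumption|]. intros s Hs.
  eapply Rle_lt_trans; [|apply (Hf (p s)); eapply Rle_lt_trans; [apply Hp|exact Hs]].
  apply (im_le_Cmod (F (p s) - F (p t))).
Qed.

Definition rect_diff (F : C -> C) (x y h k : R) : Prop :=
  forall u v, x <= u <= x + h -> y <= v <= y + k -> cdiff F (u, v).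

Definition vint (F : C -> C) (u y y' : R) : R := RInt (fun t => Re (F (u, t))) y y'.
Definition hint (F : C -> C) (v x x' : R) : R := RInt (fun t => Im (F (t, v))) x x'.

(** The imaginary part of the integral of [F] along the boundary of a rectangle; this half of Cauchy's theorem suffices for the maximum principle. *)
Definition rect_int (F : C -> C) (x y h k : R) : R :=
  vint F (x + h) y (y + k) - vint F x y (y + k)
  - (hint F (y + k) x (x + h) - hint F y x (x + h)).

Lemma ex_vint (F : C -> C) (u y y' : R) :
  y <= y' -> (forall t, y <= t <= y' -> cdiff F (u, t)) ->
  ex_RInt (fun t => Re (F (u, t))) y y'.
Proof.
  intros Hy H. apply (ex_RInt_continuous (V := R_CompleteNormedModule)). intros t Ht.
  rewrite Rmin_left, Rmax_right in Ht by lra.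
  apply (continuous_Re_curve F (fun t => (u, t))).
  - now apply cdiff_cont, H.
  - intros s. eapply Rle_trans; [apply Cmod_pair_sub_le|]. rewrite Rminus_diag, Rabs_R0. lra.
Qed.

Lemma ex_hint (F : C -> C) (v x x' : R) :
  x <= x' -> (forall t, x <= t <= x' -> cdiff F (t, v)) ->
  ex_RInt (fun t => Im (F (t, v))) x x'.
Proof.
  intros Hy H. apply (ex_RInt_continuous (V := R_CompleteNormedModule)). intros t Ht.
  rewrite Rmin_left, Rmax_right in Ht by lra.
  apply (continuous_Im_curve F (fun t => (t, v))).
  - now apply cdiff_cont, H.
  - intros s. eapply Rle_trans; [apply Cmod_pair_sub_le|]. rewrite Rminus_diag, Rabs_R0. lra.
Qed.

Lemma vint_split (F : C -> C) (u y k : R) :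
  0 <= k -> (forall t, y <= t <= y + k + k -> cdiff F (u, t)) ->
  vint F u y (y + k + k) = vint F u y (y + k) + vint F u (y + k) (y + k + k).
Proof.
  intros Hk H. symmetry. apply (RInt_Chasles (fun t => Re (F (u, t))) y (y + k)).
  - apply ex_vint; [lra|]. intros; apply H; lra.
  - apply ex_vint; [lra|]. intros; apply H; lra.
Qed.

Lemma hint_split (F : C -> C) (v x h : R) :
  0 <= h -> (forall t, x <= t <= x + h + h -> cdiff F (t, v)) ->
  hint F v x (x + h + h) = hint F v x (x + h) + hint F v (x + h) (x + h + h).
Proof.
  intros Hk H. symmetry. apply (RInt_Chasles (fun t => Im (F (t, v))) x (x + h)).
  - apply ex_hint; [lra|]. intros; apply H; lra.
  - apply ex_hint; [lra|]. intros; apply H; lra.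
Qed.

(** The inner edges cancel in pairs. Sides are written [h + h] rather than [2 * h] so that the
    subdivision points match syntactically. *)
Lemma rect_int_quarters (F : C -> C) (x y h k : R) :
  0 <= h -> 0 <= k -> rect_diff F x y (h + h) (k + k) ->
  rect_int F x y (h + h) (k + k) =
  rect_int F x y h k + rect_int F (x + h) y h k
  + (rect_int F x (y + k) h k + rect_int F (x + h) (y + k) h k).
Proof.
  intros Hh Hk H. unfold rect_int. rewrite <- !Rplus_assoc.
  rewrite !(vint_split F) by (try lra; intros; apply H; lra).
  rewrite !(hint_split F) by (try lra; intros; apply H; lra).
  ring.
Qed.

(** For the affine approximation of [F] both differences of opposite sides equal [Re l * h * k] and
    cancel. What remains is an error of at most [2 * eps * (h + k)] per unit of length, on sides of
    lengths [k] and [h]. *)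
Lemma rect_int_small (F : C -> C) (p l : C) (eps d x y h k : R) :
  0 < h -> 0 < k -> rect_diff F x y h k ->
  x <= fst p <= x + h -> y <= snd p <= y + k -> 0 <= eps -> h + k < d ->
  (forall w, Cmod (w - p) < d -> Cmod (F w - F p - l * (w - p)) <= eps * Cmod (w - p)) ->
  Rabs (rect_int F x y h k) <= 2 * eps * ((h + k) * (h + k)).
Proof.
  intros Hh Hk HF Hx Hy He Hd HE.
  assert (B : forall u v, x <= u <= x + h -> y <= v <= y + k ->
    Cmod (F (u, v) - F p - l * ((u, v) - p)) <= eps * (h + k)).
  { intros u v Hu Hv. destruct p as [p1 p2]; simpl in Hx, Hy.
    pose proof (Cmod_pair_sub_le u v p1 p2) as T.
    assert (Rabs (u - p1) <= h) by (apply Rabs_le; lra).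
    assert (Rabs (v - p2) <= k) by (apply Rabs_le; lra).
    eapply Rle_trans; [apply HE; lra|]. apply Rmult_le_compat_l; lra. }
  assert (V : Rabs (vint F (x + h) y (y + k) - vint F x y (y + k) - Re l * h * k)
              <= k * (2 * eps * (h + k))).
  { unfold vint.
    assert (E1 : ex_RInt (fun t => Re (F (x + h, t))) y (y + k))
      by (apply ex_vint; [lra|intros; apply HF; lra]).
    assert (E2 : ex_RInt (fun t => Re (F (x, t))) y (y + k))
      by (apply ex_vint; [lra|intros; apply HF; lra]).
    assert (E3 : ex_RInt (fun _ : R => Re l * h) y (y + k)) by apply ex_RInt_const.
    assert (E12 : ex_RInt (fun t => minus (Re (F (x + h, t))) (Re (F (x, t)))) y (y + k))
      by (apply (ex_RInt_minus (V := R_NormedModule)); assumption).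
    replace (RInt (fun t => Re (F (x + h, t))) y (y + k) - RInt (fun t => Re (F (x, t))) y (y + k)
             - Re l * h * k)
      with (RInt (fun t => minus (minus (Re (F (x + h, t))) (Re (F (x, t)))) (Re l * h)) y (y + k)).
    2:{ rewrite (RInt_minus (V := R_CompleteNormedModule)), (RInt_minus (V := R_CompleteNormedModule)),
          RInt_const by assumption.
        unfold scal, minus, plus, opp; simpl; unfold mult; simpl. ring. }
    replace k with (y + k - y) at 2 by ring.
    apply abs_RInt_le_const; [lra|apply (ex_RInt_minus (V := R_NormedModule)); assumption|].
    intros t Ht.
    pose proof (B (x + h) t ltac:(lra) ltac:(lra)) as B1.
    pose proof (B x t ltac:(lra) ltac:(lra)) as B2.
    pose proof (re_le_Cmod (F (x + h, t) - F p - l * ((x + h, t) - p))) as R1.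
    pose proof (re_le_Cmod (F (x, t) - F p - l * ((x, t) - p))) as R2.
    apply (Rle_trans _ _ _ R1), Rabs_le_between in B1.
    apply (Rle_trans _ _ _ R2), Rabs_le_between in B2.
    clear R1 R2. unfold Re, minus, plus, opp in *; simpl in *. apply Rabs_le. lra. }
  assert (W : Rabs (hint F (y + k) x (x + h) - hint F y x (x + h) - Re l * k * h)
              <= h * (2 * eps * (h + k))).
  { unfold hint.
    assert (E1 : ex_RInt (fun t => Im (F (t, y + k))) x (x + h))
      by (apply ex_hint; [lra|intros; apply HF; lra]).
    assert (E2 : ex_RInt (fun t => Im (F (t, y))) x (x + h))
      by (apply ex_hint; [lra|intros; apply HF; lra]).
    assert (E3 : ex_RInt (fun _ : R => Re l * k) x (x + h)) by apply ex_RInt_const.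
    assert (E12 : ex_RInt (fun t => minus (Im (F (t, y + k))) (Im (F (t, y)))) x (x + h))
      by (apply (ex_RInt_minus (V := R_NormedModule)); assumption).
    replace (RInt (fun t => Im (F (t, y + k))) x (x + h) - RInt (fun t => Im (F (t, y))) x (x + h)
             - Re l * k * h)
      with (RInt (fun t => minus (minus (Im (F (t, y + k))) (Im (F (t, y)))) (Re l * k)) x (x + h)).
    2:{ rewrite (RInt_minus (V := R_CompleteNormedModule)), (RInt_minus (V := R_CompleteNormedModule)),
          RInt_const by assumption.
        unfold scal, minus, plus, opp; simpl; unfold mult; simpl. ring. }
    replace h with (x + h - x) at 2 by ring.
    apply abs_RInt_le_const; [lra|apply (ex_RInt_minus (V := R_NormedModule)); assumption|].
    intros t Ht.
    pose proof (B t (y + k) ltac:(lra) ltac:(lra)) as B1.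
    pose proof (B t y ltac:(lra) ltac:(lra)) as B2.
    pose proof (im_le_Cmod (F (t, y + k) - F p - l * ((t, y + k) - p))) as R1.
    pose proof (im_le_Cmod (F (t, y) - F p - l * ((t, y) - p))) as R2.
    apply (Rle_trans _ _ _ R1), Rabs_le_between in B1.
    apply (Rle_trans _ _ _ R2), Rabs_le_between in B2.
    clear R1 R2. unfold Re, Im, minus, plus, opp in *; simpl in *. apply Rabs_le. lra. }
  unfold rect_int.
  apply Rabs_le_between in V. apply Rabs_le_between in W. apply Rabs_le.
  set (a := vint F (x + h) y (y + k) - vint F x y (y + k)) in *.
  set (b := hint F (y + k) x (x + h) - hint F y x (x + h)) in *. nra.
Qed.

Lemma goursat (F : C -> C) (x y h k : R) :
  0 < h -> 0 < k -> rect_diff F x y h k -> rect_int F x y h k = 0.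
Proof.
  intros Hh Hk HF.
  destruct (Req_dec (rect_int F x y h k) 0) as [E|E]; [exact E|exfalso].
  set (c := Rabs (rect_int F x y h k)).
  assert (Hc : 0 < c) by now apply Rabs_pos_lt.
  pose (q := fun n : nat => (1/2) ^ n).
  assert (Hq : forall n, 0 < q n) by apply half_pow_pos.
  assert (HqS : forall n, q n = q (S n) + q (S n)) by (intros n; unfold q; simpl; field).
  (* [s n] is the lower left corner of the [n]-th rectangle, of sides [h * q n] and [k * q n], whose
     integral keeps at least the share [q n * q n] of the original absolute value. *)
  destruct (dependent_choice
    (fun n p => x <= fst p /\ fst p + h * q n <= x + h /\ y <= snd p /\ snd p + k * q n <= y + k /\
                c * (q n * q n) <= Rabs (rect_int F (fst p) (snd p) (h * q n) (k * q n)))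
    (fun n p p' => fst p <= fst p' /\ fst p' + h * q (S n) <= fst p + h * q n /\
                   snd p <= snd p' /\ snd p' + k * q (S n) <= snd p + k * q n) (x, y))
    as [s Hs].
  { simpl. unfold q, c; simpl. rewrite !Rmult_1_r. repeat split; lra. }
  { intros n [u v]; simpl fst; simpl snd. intros (H1 & H2 & H3 & H4 & H5).
    specialize (Hq (S n)). rewrite (HqS n) in *. set (r := q (S n)) in *.
    assert (0 < h * r) by (apply Rmult_lt_0_compat; lra).
    assert (0 < k * r) by (apply Rmult_lt_0_compat; lra).
    rewrite (Rmult_plus_distr_l h r r) in *. rewrite (Rmult_plus_distr_l k r r) in *.
    rewrite rect_int_quarters in H5; [|lra|lra|intros u' v' Hu Hv; apply HF; lra].
    set (P1 := rect_int F u v (h * r) (k * r)) in *.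
    set (P2 := rect_int F (u + h * r) v (h * r) (k * r)) in *.
    set (P3 := rect_int F u (v + k * r) (h * r) (k * r)) in *.
    set (P4 := rect_int F (u + h * r) (v + k * r) (h * r) (k * r)) in *.
    assert (T : Rabs (P1 + P2 + (P3 + P4)) <= Rabs P1 + Rabs P2 + (Rabs P3 + Rabs P4)).
    { eapply Rle_trans; [apply Rabs_triang|]. apply Rplus_le_compat; apply Rabs_triang. }
    destruct (Rle_dec (c * (r * r)) (Rabs P1)) as [D1|D1].
    { exists (u, v); simpl. repeat split; (lra || assumption). }
    destruct (Rle_dec (c * (r * r)) (Rabs P2)) as [D2|D2].
    { exists (u + h * r, v); simpl. repeat split; (lra || assumption). }
    destruct (Rle_dec (c * (r * r)) (Rabs P3)) as [D3|D3].
    { exists (u, v + k * r); simpl. repeat split; (lra || assumption). }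
    (* Three quarters fall below the share and the parent carries four times the share, so the last
       quarter must reach it. *)
    exists (u + h * r, v + k * r); simpl. repeat split; try lra. fold P4.
    replace ((r + r) * (r + r)) with (4 * (r * r)) in H5 by ring. lra. }
  destruct (nested_intervals (fun n => fst (s n)) (fun n => fst (s n) + h * q n)) as [u Hu].
  { intros n. apply (Hs n). }
  { intros n. apply (Hs n). }
  { intros n. specialize (Hq n). nra. }
  destruct (nested_intervals (fun n => snd (s n)) (fun n => snd (s n) + k * q n)) as [v Hv].
  { intros n. apply (Hs n). }
  { intros n. apply (Hs n). }
  { intros n. specialize (Hq n). nra. }
  destruct (Hs 0%nat) as [(S1 & S2 & S3 & S4 & _) _].
  destruct (HF u v) as [l Hl].
  { specialize (Hu 0%nat). simpl in Hu. lra. }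
  { specialize (Hv 0%nat). simpl in Hv. lra. }
  set (A := (h + k) * (h + k)).
  assert (HA : 0 < A) by (unfold A; nra).
  (* With this tolerance the upper bound at level [n] is [c * (q n * q n) / 2], half the lower bound
     kept by the bisection. *)
  destruct (Hl (c / (4 * A))) as [d [Hd HE]].
  { apply Rdiv_lt_0_compat; lra. }
  destruct (half_pow_small (d / (h + k))) as [n Hn].
  { apply Rdiv_lt_0_compat; lra. }
  fold (q n) in Hn. destruct (Hs n) as [(T1 & T2 & T3 & T4 & T5) _].
  specialize (Hu n). specialize (Hv n). specialize (Hq n). simpl in Hu, Hv.
  assert (0 < h * q n) by (apply Rmult_lt_0_compat; lra).
  assert (0 < k * q n) by (apply Rmult_lt_0_compat; lra).
  assert (B : Rabs (rect_int F (fst (s n)) (snd (s n)) (h * q n) (k * q n)) <=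
     2 * (c / (4 * A)) * ((h * q n + k * q n) * (h * q n + k * q n))).
  { apply rect_int_small with (p := (u, v)) (l := l) (d := d); simpl; try lra; try assumption.
    - intros u' v' Hu' Hv'. apply HF; lra.
    - left. apply Rdiv_lt_0_compat; lra.
    - apply Rmult_lt_compat_r with (r := h + k) in Hn; [|lra].
      unfold Rdiv in Hn. rewrite Rmult_assoc, Rinv_l, Rmult_1_r in Hn by lra. lra. }
  replace (2 * (c / (4 * A)) * ((h * q n + k * q n) * (h * q n + k * q n)))
    with (c * (q n * q n) / 2) in B by (unfold A; field; lra).
  assert (0 < c * (q n * q n)) by (repeat apply Rmult_lt_0_compat; lra).
  lra.
Qed.

(** * The maximum principle *)

Definition cexp (z : C) : C := (exp (fst z) * cos (snd z), exp (fst z) * sin (snd z)).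

Lemma cexp_plus (z w : C) : cexp (z + w) = (cexp z * cexp w)%C.
Proof.
  destruct z as [a b], w as [c d]; unfold cexp; simpl.
  rewrite exp_plus, cos_plus, sin_plus.
  apply injective_projections; simpl; ring.
Qed.

Lemma Cmod_sqr (z : C) : Cmod z * Cmod z = fst z * fst z + snd z * snd z.
Proof. pose proof (Cmod2_alt z) as H. unfold Re, Im in H. simpl in H. lra. Qed.

Lemma Cmod_eq_sqr (z : C) x : 0 <= x -> fst z * fst z + snd z * snd z = x * x -> Cmod z = x.
Proof.
  intros Hx H. rewrite <- Cmod_sqr in H. pose proof (Cmod_ge_0 z). nra.
Qed.

Lemma Cmod_cexp (z : C) : Cmod (cexp z) = exp (fst z).
Proof.
  apply Cmod_eq_sqr; [left; apply exp_pos|]. destruct z as [a b]; simpl.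
  pose proof (sin2_cos2 b) as H. unfold Rsqr in H.
  replace (exp a * cos b * (exp a * cos b) + exp a * sin b * (exp a * sin b))
    with (exp a * exp a * (sin b * sin b + cos b * cos b)) by ring.
  rewrite H. ring.
Qed.

Lemma derivable_pt_lim_0_small (f : R -> R) l eps :
  derivable_pt_lim f 0 l -> 0 < eps ->
  exists d, 0 < d /\ forall h, Rabs h < d -> Rabs (f h - f 0 - l * h) <= eps * Rabs h.
Proof.
  intros H He. destruct (H eps He) as [d Hd].
  exists d; split; [apply cond_pos|]. intros h Hh.
  destruct (Req_dec h 0) as [->|Hn].
  - replace (f 0 - f 0 - l * 0) with 0 by ring. rewrite Rabs_R0. lra.
  - specialize (Hd h Hn Hh). rewrite Rplus_0_l in Hd.
    replace (f h - f 0 - l * h) with (((f h - f 0) / h - l) * h) by (field; assumption).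
    rewrite Rabs_mult. apply Rmult_le_compat_r; [apply Rabs_pos|lra].
Qed.

Lemma cexp_small eps : 0 < eps ->
  exists d, 0 < d /\ forall h, Cmod h < d -> Cmod (cexp h - 1 - h) <= eps * Cmod h.
Proof.
  (* The four error terms contribute [1 + 3 + 3 + 2 = 9] multiples of [e * m]; the threes come from
     [exp x <= 3], valid since [|x| < e <= 1]. *)
  intros He. set (e := Rmin 1 (eps / 9)).
  assert (He0 : 0 < e) by (apply Rmin_pos; lra).
  assert (He1 : e <= 1) by apply Rmin_l.
  assert (He2 : e <= eps / 9) by apply Rmin_r.
  destruct (derivable_pt_lim_0_small exp 1 e derivable_pt_lim_exp_0 He0) as [d1 [Hd1 E1]].
  destruct (derivable_pt_lim_0_small cos (- sin 0) e (derivable_pt_lim_cos 0) He0) as [d2 [Hd2 E2]].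
  destruct (derivable_pt_lim_0_small sin 1 e derivable_pt_lim_sin_0 He0) as [d3 [Hd3 E3]].
  exists (Rmin e (Rmin d1 (Rmin d2 d3))). split; [repeat (assumption || apply Rmin_pos)|].
  intros [x y] Hh.
  pose proof (Rmax_Cmod (x, y)) as HM; simpl in HM.
  pose proof (Rmax_l (Rabs x) (Rabs y)) as Hx. pose proof (Rmax_r (Rabs x) (Rabs y)) as Hy.
  set (m := Cmod (x, y)) in *.
  pose proof (Rmin_l e (Rmin d1 (Rmin d2 d3))). pose proof (Rmin_r e (Rmin d1 (Rmin d2 d3))).
  pose proof (Rmin_l d1 (Rmin d2 d3)). pose proof (Rmin_r d1 (Rmin d2 d3)).
  pose proof (Rmin_l d2 d3). pose proof (Rmin_r d2 d3).
  specialize (E1 x ltac:(lra)). specialize (E2 y ltac:(lra)). specialize (E3 y ltac:(lra)).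
  rewrite exp_0 in E1. rewrite cos_0, sin_0 in E2. rewrite sin_0 in E3.
  replace (cos y - 1 - - 0 * y) with (cos y - 1) in E2 by ring.
  replace (sin y - 0 - 1 * y) with (sin y - y) in E3 by ring.
  assert (Hexp : exp x <= 3).
  { destruct (Rle_lt_dec x 1) as [H5|H5].
    - eapply Rle_trans; [|apply exp_le_3]. destruct H5 as [H5| ->]; [left; now apply exp_increasing|lra].
    - pose proof (Rle_abs x). lra. }
  pose proof (exp_pos x) as Hpos.
  pose proof (Rabs_pos x) as Px. pose proof (Rabs_pos y) as Py.
  eapply Rle_trans; [apply Cmod_le_Rabs|]. simpl.
  replace (exp x * cos y + - (1) + - x) with ((exp x - 1 - 1 * x) + exp x * (cos y - 1)) by ring.
  replace (exp x * sin y + - 0 + - y) with (exp x * (sin y - y) + (((exp x - 1 - 1 * x) + x) * y)) by ring.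
  assert (A1 : Rabs (exp x * (cos y - 1)) <= 3 * (e * Rabs y)).
  { rewrite Rabs_mult, (Rabs_pos_eq (exp x)) by lra. apply Rmult_le_compat; try lra. apply Rabs_pos. }
  assert (A2 : Rabs (exp x * (sin y - y)) <= 3 * (e * Rabs y)).
  { rewrite Rabs_mult, (Rabs_pos_eq (exp x)) by lra. apply Rmult_le_compat; try lra. apply Rabs_pos. }
  assert (A3 : Rabs (((exp x - 1 - 1 * x) + x) * y) <= 2 * e * Rabs y).
  { rewrite Rabs_mult. apply Rmult_le_compat_r; [lra|].
    eapply Rle_trans; [apply Rabs_triang|]. nra. }
  eapply Rle_trans; [apply Rplus_le_compat; apply Rabs_triang|].
  assert (e * Rabs x <= e * m) by (apply Rmult_le_compat_l; lra).
  assert (e * Rabs y <= e * m) by (apply Rmult_le_compat_l; lra).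
  assert (e * m <= eps / 9 * m) by (apply Rmult_le_compat_r; lra).
  lra.
Qed.

Lemma cdiff_cexp (z : C) : cdiff cexp z.
Proof.
  exists (cexp z). intros eps He.
  pose proof (exp_pos (fst z)) as Hp.
  destruct (cexp_small (eps / exp (fst z))) as [d [Hd H]]; [now apply Rdiv_lt_0_compat|].
  exists d; split; [assumption|]. intros w Hw.
  replace (cexp w) with (cexp z * cexp (w - z))%C by (rewrite <- cexp_plus; f_equal; ring).
  replace (cexp z * cexp (w - z) - cexp z - cexp z * (w - z))%C
    with (cexp z * (cexp (w - z) - 1 - (w - z)))%C by ring.
  rewrite Cmod_mult, Cmod_cexp. specialize (H _ Hw).
  apply Rmult_le_compat_l with (r := exp (fst z)) in H; [|lra].
  eapply Rle_trans; [exact H|]. right. field. lra.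
Qed.

(** The exponential carries the rectangle [[ln e, ln r] x [0, 2 PI]] onto an annulus. Its horizontal
    sides cancel by periodicity, so Goursat's theorem makes the angular integral of [Re f] equal on
    both circles; on the small one continuity keeps it near [2 PI * Re (f 0)]. *)
Lemma mean_value_Re_le (f : C -> C) r M :
  0 < r -> (forall z, Cmod z <= r -> cdiff f z) ->
  (forall z, Cmod z = r -> Re (f z) <= M) -> Re (f 0) <= M.
Proof.
  intros Hr Hf HM. apply Rnot_lt_le. intros Hlt.
  set (eta := (Re (f 0) - M) / 2).
  assert (Heta : 0 < eta) by (unfold eta; lra).
  destruct (cdiff_cont f 0 ltac:(apply Hf; rewrite Cmod_0; lra) eta Heta) as [d [Hd Hc]].
  set (e := Rmin d r / 2).
  assert (He : 0 < e) by (unfold e; pose proof (Rmin_pos _ _ Hd Hr); lra).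
  assert (Hed : e < d) by (unfold e in *; pose proof (Rmin_l d r); lra).
  assert (Her : e < r) by (unfold e in *; pose proof (Rmin_r d r); lra).
  pose proof (ln_increasing e r He Her) as Hln.
  pose proof Rgt_2PI_0 as H2pi.
  set (F := fun z => f (cexp z)).
  assert (Hcd : forall u v, u <= ln r -> cdiff F (u, v)).
  { intros u v Hu. apply (cdiff_comp cexp f); [apply cdiff_cexp|]. apply Hf.
    rewrite Cmod_cexp; simpl. rewrite <- (exp_ln r Hr).
    destruct Hu as [Hu| ->]; [left; now apply exp_increasing|lra]. }
  assert (HG : rect_int F (ln e) 0 (ln r - ln e) (2 * PI) = 0).
  { apply goursat; [lra|lra|]. intros u v Hu Hv. apply Hcd. lra. }
  unfold rect_int in HG. rewrite Rplus_0_l in HG.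
  replace (ln e + (ln r - ln e)) with (ln r) in HG by ring.
  assert (Hper : hint F (2 * PI) (ln e) (ln r) = hint F 0 (ln e) (ln r)).
  { apply RInt_ext. intros t _. unfold F, cexp; simpl.
    rewrite cos_2PI, sin_2PI, cos_0, sin_0. reflexivity. }
  rewrite Hper in HG.
  assert (Hup : vint F (ln r) 0 (2 * PI) <= 2 * PI * M).
  { replace (2 * PI * M) with (RInt (fun _ : R => M) 0 (2 * PI))
      by (rewrite RInt_const; unfold scal; simpl; unfold mult; simpl; ring).
    apply RInt_le; [lra| |apply ex_RInt_const|].
    - apply ex_vint; [lra|]. intros; apply Hcd; lra.
    - intros t _. apply HM. rewrite Cmod_cexp; simpl. now apply exp_ln. }
  assert (Hlow : 2 * PI * (Re (f 0) - eta) <= vint F (ln e) 0 (2 * PI)).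
  { replace (2 * PI * (Re (f 0) - eta)) with (RInt (fun _ : R => Re (f 0) - eta) 0 (2 * PI))
      by (rewrite RInt_const; unfold scal; simpl; unfold mult; simpl; ring).
    apply RInt_le; [lra|apply ex_RInt_const| |].
    - apply ex_vint; [lra|]. intros; apply Hcd; lra.
    - intros t _. unfold F.
      specialize (Hc (cexp (ln e, t))).
      replace (cexp (ln e, t) - 0)%C with (cexp (ln e, t)) in Hc by ring.
      rewrite Cmod_cexp in Hc; simpl in Hc. rewrite exp_ln in Hc by assumption.
      specialize (Hc Hed).
      pose proof (re_le_Cmod (f (cexp (ln e, t)) - f 0)) as T.
      apply (Rle_trans _ _ eta) in T; [|lra]. apply Rabs_le_between in T.
      unfold Re in *; simpl in *. lra. }
  assert (2 * PI * (Re (f 0) - eta) <= 2 * PI * M) by lra.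
  apply Rmult_le_reg_l in H; [|lra]. unfold eta in H. lra.
Qed.

(** When [f 0] is nonzero, the unimodular constant [c] turns it into the positive number
    [Cmod (f 0)], and the bound on real parts applies to [c * f]. *)
Lemma mean_value_le (f : C -> C) r M :
  0 < r -> (forall z, Cmod z <= r -> cdiff f z) ->
  (forall z, Cmod z = r -> Cmod (f z) <= M) -> Cmod (f 0) <= M.
Proof.
  intros Hr Hf HM.
  destruct (Ceq_dec (f 0) 0) as [E|E].
  { rewrite E, Cmod_0. eapply Rle_trans; [|apply (HM (RtoC r))]; [apply Cmod_ge_0|].
    rewrite Cmod_R. apply Rabs_pos_eq. lra. }
  assert (Hp : 0 < Cmod (f 0)) by now apply Cmod_gt_0.
  set (c := (Cconj (f 0) / RtoC (Cmod (f 0)))%C).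
  assert (Hnz : RtoC (Cmod (f 0)) <> 0) by (intros H; apply RtoC_inj in H; lra).
  assert (Hc : Cmod c = 1).
  { unfold c. rewrite Cmod_div', Cmod_conj, Cmod_R, Rabs_pos_eq by lra. field. lra. }
  assert (H : Re (c * f 0)%C <= M).
  { apply (mean_value_Re_le (fun z => (c * f z)%C) r); [assumption| |].
    - intros z Hz. specialize (Hf z Hz). cdiff_auto.
    - intros z Hz. eapply Rle_trans; [apply Rle_abs|]. eapply Rle_trans; [apply re_le_Cmod|].
      rewrite Cmod_mult, Hc, Rmult_1_l. now apply HM. }
  replace (c * f 0)%C with (RtoC (Cmod (f 0))) in H; [exact H|].
  unfold c. replace (Cconj (f 0) / Cmod (f 0) * f 0)%C with ((f 0 * Cconj (f 0)) / RtoC (Cmod (f 0)))%C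
    by (field; assumption).
  rewrite <- Cmod2_conj. rewrite RtoC_pow. field. assumption.
Qed.

(** * Blaschke factors and the maximum principle on discs *)

Lemma Cmod_sqr_le (z w : C) :
  fst z * fst z + snd z * snd z <= fst w * fst w + snd w * snd w -> Cmod z <= Cmod w.
Proof.
  rewrite <- !Cmod_sqr. pose proof (Cmod_ge_0 z). pose proof (Cmod_ge_0 w). nra.
Qed.

Lemma Cmod_sqr_eq (z w : C) :
  fst z * fst z + snd z * snd z = fst w * fst w + snd w * snd w -> Cmod z = Cmod w.
Proof. intros H. apply Rle_antisym; apply Cmod_sqr_le; lra. Qed.

(** Denominator of the Blaschke factor [r (z - b) / (r^2 - conj b z)] of the disc of centre [0] and radius [r]. *)
Definition bden (r : R) (b z : C) : C := (RtoC (r * r) - Cconj b * z)%C.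

(** Compares the modulus of the Blaschke factor with one: for [b] inside the disc the sign is that
    of [r * r - Cmod z * Cmod z]. *)
Lemma bden_identity (r : R) (b z : C) :
  Cmod (bden r b z) * Cmod (bden r b z) - r * r * (Cmod (z - b) * Cmod (z - b)) =
  (r * r - Cmod b * Cmod b) * (r * r - Cmod z * Cmod z).
Proof. rewrite !Cmod_sqr. destruct b, z; unfold bden; simpl; ring. Qed.

Lemma bden_circle (r : R) (b z : C) : 0 <= r -> Cmod z = r -> Cmod (bden r b z) = r * Cmod (z - b).
Proof.
  intros Hr Hz. pose proof (bden_identity r b z) as H. rewrite Hz in H.
  pose proof (Cmod_ge_0 (bden r b z)). pose proof (Cmod_ge_0 (z - b)%C).
  assert (0 <= r * Cmod (z - b)) by (apply Rmult_le_pos; lra). nra.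
Qed.

Lemma bden_ge (r : R) (b z : C) :
  0 <= r -> Cmod b <= r -> Cmod z <= r -> r * Cmod (z - b) <= Cmod (bden r b z).
Proof.
  intros Hr Hb Hz. pose proof (bden_identity r b z) as H.
  pose proof (Cmod_ge_0 (bden r b z)). pose proof (Cmod_ge_0 (z - b)%C).
  pose proof (Cmod_ge_0 b). pose proof (Cmod_ge_0 z).
  assert (0 <= r * Cmod (z - b)) by (apply Rmult_le_pos; lra).
  assert (0 <= (r * r - Cmod b * Cmod b) * (r * r - Cmod z * Cmod z))
    by (apply Rmult_le_pos; nra). nra.
Qed.

Lemma bden_neq_0 (r : R) (b z : C) : Cmod b < r -> Cmod z <= r -> bden r b z <> 0.
Proof.
  intros Hb Hz. apply Cmod_gt_0. unfold bden.
  pose proof (Cmod_ge_0 b). pose proof (Cmod_ge_0 z).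
  eapply Rlt_le_trans; [|apply Cmod_sub_ge].
  rewrite Cmod_mult, Cmod_conj, Cmod_R, Rabs_pos_eq by nra. nra.
Qed.

Lemma max_mod (f : C -> C) (a : C) r M :
  0 < r -> (forall z, Cmod (z - a) <= r -> cdiff f z) ->
  (forall z, Cmod (z - a) = r -> Cmod (f z) <= M) ->
  forall w, Cmod (w - a) <= r -> Cmod (f w) <= M.
Proof.
  intros Hr Hf HM w [Hw|Hw]; [|now apply HM].
  set (om := (w - a)%C) in *.
  (* [phi] maps the disc of radius [r] about [0] to the one about [a], circle to circle, and sends
     [0] to [w]; the mean value inequality at [0] thus becomes a bound at [w]. *)
  set (phi := fun z => (a + RtoC (r * r) * (z + om) / bden r (- om) z)%C).
  assert (Hom : Cmod (- om) < r) by now rewrite Cmod_opp.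
  assert (Hrr : RtoC (r * r) <> 0) by (intros H; apply RtoC_inj in H; nra).
  assert (Hphi : forall z, Cmod z <= r -> Cmod (phi z - a) * Cmod (bden r (- om) z) = r * (r * Cmod (z - - om))).
  { intros z Hz. rewrite <- Cmod_mult. unfold phi.
    replace ((a + RtoC (r * r) * (z + om) / bden r (- om) z - a) * bden r (- om) z)%C
      with (RtoC (r * r) * (z - - om))%C by (field; now apply bden_neq_0).
    rewrite Cmod_mult, Cmod_R, Rabs_pos_eq by nra. ring. }
  assert (Hbp : forall z, Cmod z <= r -> 0 < Cmod (bden r (- om) z)).
  { intros z Hz. apply Cmod_gt_0. now apply bden_neq_0. }
  replace w with (phi 0).
  2:{ unfold phi, bden, om. field. intros E. apply Hrr. rewrite <- E. ring. }
  apply (mean_value_le (fun z => f (phi z)) r); [assumption| |].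
  - intros z Hz. apply (cdiff_comp phi f).
    + unfold phi, bden. cdiff_auto. now apply bden_neq_0.
    + apply Hf. pose proof (bden_ge r (- om) z ltac:(lra) ltac:(lra) Hz).
      apply Rmult_le_reg_r with (Cmod (bden r (- om) z)); [auto|].
      rewrite Hphi by assumption. apply Rmult_le_compat_l; lra.
  - intros z Hz. apply HM.
    apply Rmult_eq_reg_r with (Cmod (bden r (- om) z)); [|apply Rgt_not_eq, Hbp; lra].
    rewrite Hphi by lra. f_equal. symmetry. apply bden_circle; lra.
Qed.

(** * Isolated singularities and the identity theorem *)

(** If [x] exceeded [M], the ratio of the powers would grow geometrically and outweigh any constant
    factor. *)
Lemma pow_ratio_le (x M p K : R) :
  0 <= x -> 0 <= M -> 0 < p -> (forall n, x ^ n * p <= M ^ n * K) -> x <= M.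
Proof.
  intros Hx HM Hp H. apply Rnot_lt_le. intros Hlt.
  assert (Hx0 : 0 < x) by lra.
  assert (Hq : 0 <= M / x < 1).
  { split; [apply Rdiv_le_0_compat; lra|]. apply Rlt_div_l; lra. }
  pose proof (H 0%nat) as H0. simpl in H0. assert (HK : 0 < K) by lra.
  destruct (pow_lt_1_zero (M / x) ltac:(rewrite Rabs_pos_eq; lra) (p / K)) as [n Hn].
  { now apply Rdiv_lt_0_compat. }
  specialize (Hn n (le_n n)). rewrite Rabs_pos_eq in Hn by (apply pow_le; lra).
  specialize (H n). pose proof (pow_lt x n Hx0) as Hxn.
  replace (M ^ n) with ((M / x) ^ n * x ^ n) in H by (rewrite <- Rpow_mult_distr; f_equal; field; lra).
  apply Rmult_lt_compat_r with (r := K) in Hn; [|assumption].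
  unfold Rdiv in Hn at 2. rewrite Rmult_assoc, Rinv_l, Rmult_1_r in Hn by lra.
  nra.
Qed.

Definition cprod (l : list C) : C := fold_right Cmult (RtoC 1) l.

Lemma cprod_app (l m : list C) : cprod (l ++ m) = (cprod l * cprod m)%C.
Proof. induction l as [|x l IH]; simpl; [ring|]. rewrite IH. ring. Qed.

Lemma cprod_eq_0 (l : list C) : cprod l = 0 -> In (RtoC 0) l.
Proof.
  induction l as [|x l IH]; simpl.
  - intros H. apply RtoC_inj in H. lra.
  - intros H. destruct (Ceq_dec x 0) as [->|Hx]; [now left|right]. apply IH.
    destruct (Ceq_dec (cprod l) 0) as [E|E]; [exact E|]. now destruct (Cmult_neq_0 _ _ Hx E).
Qed.

Lemma cprod_neq_0 {A} (F : A -> C) (l : list A) :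
  (forall e, In e l -> F e <> 0) -> cprod (map F l) <> 0.
Proof.
  intros H E. apply cprod_eq_0, in_map_iff in E as [e [E He]]. now apply (H e).
Qed.

Lemma cprod_in_0 (l : list C) : In (RtoC 0) l -> cprod l = 0.
Proof.
  induction l as [|x l IH]; simpl; [tauto|]. intros [->|H]; [ring|]. rewrite IH by assumption. ring.
Qed.

Lemma cdiff_cprod {A} (F : A -> C -> C) (l : list A) (z : C) :
  (forall e, In e l -> cdiff (F e) z) -> cdiff (fun w => cprod (map (fun e => F e w) l)) z.
Proof.
  induction l as [|x l IH]; intros H; simpl; [apply cdiff_const|].
  apply cdiff_mult; [apply H; now left|]. apply IH. intros e He. apply H. now right.
Qed.

Lemma Cmod_cprod_eq {A} (F G : A -> C) (l : list A) :
  (forall e, In e l -> Cmod (F e) = Cmod (G e)) -> Cmod (cprod (map F l)) = Cmod (cprod (map G l)).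
Proof.
  induction l as [|x l IH]; intros H; simpl; [reflexivity|]. rewrite !Cmod_mult.
  rewrite H by now left. f_equal. apply IH. intros e He. apply H. now right.
Qed.

Lemma cprod_roots_bound (E : list C) (a : C) r :
  0 <= r -> exists K, 0 <= K /\
    forall z, Cmod (z - a) <= r -> Cmod (cprod (map (fun e => z - e)%C E)) <= K.
Proof.
  intros Hr. induction E as [|e E [K [HK H]]]; simpl.
  - exists 1; split; [lra|]. intros. rewrite Cmod_1. lra.
  - pose proof (Cmod_ge_0 (a - e)). exists ((r + Cmod (a - e)) * K).
    split; [apply Rmult_le_pos; lra|].
    intros z Hz. rewrite Cmod_mult. apply Rmult_le_compat; try apply Cmod_ge_0; auto.
    eapply Rle_trans; [apply (Cmod_sub_triangle z a e)|]. lra.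
Qed.

Lemma ccont_bounded_mult_0 (f g : C -> C) (z : C) d K :
  0 < d -> 0 <= K -> ccont f z -> f z = 0 -> (forall w, Cmod (w - z) < d -> Cmod (g w) <= K) ->
  ccont (fun w => f w * g w)%C z.
Proof.
  intros Hd HK Hf H0 Hg eps He.
  destruct (Hf (eps / (K + 1))) as [d' [Hd' Hf']]; [apply Rdiv_lt_0_compat; lra|].
  exists (Rmin d d'). split; [now apply Rmin_pos|]. intros w Hw.
  specialize (Hg w ltac:(eapply Rlt_le_trans; [exact Hw|apply Rmin_l])).
  specialize (Hf' w ltac:(eapply Rlt_le_trans; [exact Hw|apply Rmin_r])).
  rewrite H0 in *. replace (f w * g w - 0 * g z)%C with ((f w - 0) * g w)%C by ring.
  rewrite Cmod_mult.
  apply Rle_lt_trans with (Cmod (f w - 0) * K).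
  { apply Rmult_le_compat_l; [apply Cmod_ge_0|assumption]. }
  pose proof (Cmod_ge_0 (f w - 0)).
  apply Rmult_lt_compat_r with (r := K + 1) in Hf'; [|lra].
  unfold Rdiv in Hf'. rewrite Rmult_assoc, Rinv_l, Rmult_1_r in Hf' by lra. lra.
Qed.

(** Bounded isolated singularities do not affect the maximum principle: apply it to [G^n] times a fixed polynomial killing the singularities, and let [n] grow. *)
Lemma max_mod_except (G : C -> C) (E : list C) (a : C) r M K :
  0 < r -> 0 <= K ->
  (forall e, In e E -> Cmod (e - a) < r) ->
  (forall z, Cmod (z - a) <= r -> Cmod (G z) <= K) ->
  (forall z, Cmod (z - a) <= r -> ~ In z E -> cdiff G z) ->
  (forall z, Cmod (z - a) = r -> Cmod (G z) <= M) ->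
  forall w, Cmod (w - a) <= r -> ~ In w E -> Cmod (G w) <= M.
Proof.
  intros Hr HK HE HB HG HM w Hw HwE.
  pose (P := fun (l : list C) z => cprod (map (fun e => (z - e)%C) l)).
  assert (HP : forall l z, cdiff (P l) z).
  { intros l z. apply (cdiff_cprod (fun e z => (z - e)%C)). intros. cdiff_auto. }
  destruct (cprod_roots_bound E a r ltac:(lra)) as [B [HB0 HB1]].
  assert (HM0 : 0 <= M).
  { eapply Rle_trans; [|apply (HM (a + RtoC r)%C)]; [apply Cmod_ge_0|].
    replace (a + r - a)%C with (RtoC r) by ring. rewrite Cmod_R, Rabs_pos_eq; lra. }
  assert (Hpw : 0 < Cmod (P E w) ^ 2).
  { apply pow_lt. apply Cmod_gt_0. apply cprod_neq_0. intros e He Hz.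
    apply Csub_0_eq in Hz. now subst. }
  apply (pow_ratio_le (Cmod (G w)) M (Cmod (P E w) ^ 2) (B ^ 2)); auto using Cmod_ge_0.
  intros n. rewrite <- !Cmod_pow, <- Cmod_mult.
  (* The square leaves a factor [x - z] in the difference quotient at a singularity [z], which tends
     to zero against the merely bounded [G x ^ n]. *)
  apply (max_mod (fun z => G z ^ n * P E z ^ 2)%C a r); auto.
  - intros z Hz. destruct (in_dec Ceq_dec z E) as [Hin|Hout].
    + destruct (in_split _ _ Hin) as (l1 & l2 & Hl).
      assert (HPz : forall x, P E x = ((x - z) * P (l1 ++ l2) x)%C).
      { intros x. unfold P. rewrite Hl, !map_app, !cprod_app. simpl. ring. }
      apply cdiff_cara.
      exists (fun x => ((x - z) * P (l1 ++ l2) x ^ 2) * G x ^ n)%C, 1.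
      split; [lra|]. split.
      * specialize (HE z Hin).
        apply (ccont_bounded_mult_0 _ _ z (r - Cmod (z - a)) (K ^ n)); [lra|now apply pow_le| | |].
        -- apply cdiff_cont. specialize (HP (l1 ++ l2) z). cdiff_auto.
        -- ring.
        -- intros x Hx. rewrite Cmod_pow. apply pow_incr. split; [apply Cmod_ge_0|].
           apply HB. pose proof (Cmod_sub_triangle x z a). lra.
      * intros x _. rewrite !HPz. ring.
    + specialize (HG z Hz Hout). specialize (HP E z). cdiff_auto.
  - intros z Hz. rewrite Cmod_mult, !Cmod_pow.
    apply Rmult_le_compat; try (apply pow_le, Cmod_ge_0);
      apply pow_incr; split; try apply Cmod_ge_0; auto.
    apply HB1. lra.
Qed.

Lemma unit_circle_param (x y : R) : x * x + y * y = 1 ->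
  exists t, - PI <= t <= PI /\ x = cos t /\ y = sin t.
Proof.
  intros H. assert (Hx : -1 <= x <= 1) by (split; nra).
  pose proof (acos_bound x) as Hb. pose proof PI_RGT_0.
  destruct (Rle_lt_dec 0 y) as [Hy|Hy].
  - exists (acos x). repeat split; try lra; [symmetry; now apply cos_acos|].
    rewrite sin_acos by assumption. symmetry. apply sqrt_lem_1; unfold Rsqr; nra.
  - exists (- acos x). repeat split; try lra; [rewrite cos_neg; symmetry; now apply cos_acos|].
    rewrite sin_neg, sin_acos by assumption.
    replace (1 - x²) with ((- y) * (- y)) by (unfold Rsqr; lra).
    rewrite sqrt_square; lra.
Qed.

(** Compactness of the circle is taken from that of [[-PI, PI]] through the parametrisation by the
    angle. *)
Lemma circle_bound (f : C -> C) (a : C) r :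
  0 < r -> (forall z, Cmod (z - a) = r -> ccont f z) ->
  exists M, 0 <= M /\ forall z, Cmod (z - a) = r -> Cmod (f z) <= M.
Proof.
  intros Hr Hf. pose proof PI_RGT_0 as Hpi.
  set (p := fun t : R => (a + ((r * cos t)%R, (r * sin t)%R))%C).
  assert (Hp : forall t, Cmod (p t - a) = r).
  { intros t. apply Cmod_eq_sqr; [lra|]. unfold p; simpl.
    pose proof (sin2_cos2 t) as T. unfold Rsqr in T.
    replace (_ + _) with (r * r * (sin t * sin t + cos t * cos t)) by ring.
    rewrite T. ring. }
  destruct (continuity_ab_maj (fun t => Cmod (f (p t))) (- PI) PI ltac:(lra)) as [tM [HM _]].
  { intros t _. apply continuity_pt_filterlim. apply continuous_R_eps. intros eps He.
    destruct (Hf (p t) (Hp t) eps He) as [d [Hd Hc]].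
    destruct (derivable_continuous_pt cos t (derivable_pt_cos t) (d / (2 * r))) as [d1 [Hd1 C1]];
      [apply Rdiv_lt_0_compat; lra|].
    destruct (derivable_continuous_pt sin t (derivable_pt_sin t) (d / (2 * r))) as [d2 [Hd2 C2]];
      [apply Rdiv_lt_0_compat; lra|].
    exists (Rmin d1 d2). split; [now apply Rmin_pos|]. intros s Hs.
    assert (Hsd : Cmod (p s - p t) < d).
    { destruct (Req_dec s t) as [->|Hn]; [now rewrite Cmod_sub_self|].
      assert (Q1 : Rabs (cos s - cos t) < d / (2 * r)).
      { apply C1. split; [split; [exact I|now apply not_eq_sym]|].
        eapply Rlt_le_trans; [exact Hs|apply Rmin_l]. }
      assert (Q2 : Rabs (sin s - sin t) < d / (2 * r)).
      { apply C2. split; [split; [exact I|now apply not_eq_sym]|].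
        eapply Rlt_le_trans; [exact Hs|apply Rmin_r]. }
      replace (p s - p t)%C with ((r * (cos s - cos t), r * (sin s - sin t)) : C)
        by (unfold p; apply injective_projections; simpl; ring).
      eapply Rle_lt_trans; [apply Cmod_le_Rabs|]. rewrite !Rabs_mult, (Rabs_pos_eq r) by lra.
      replace d with (r * (d / (2 * r)) + r * (d / (2 * r))) by (field; lra).
      apply Rplus_lt_compat; apply Rmult_lt_compat_l; assumption. }
    specialize (Hc _ Hsd).
    pose proof (Cmod_sub_ge (f (p s)) (f (p t))). pose proof (Cmod_sub_ge (f (p t)) (f (p s))) as T.
    rewrite Cmod_sub_comm in T. apply Rabs_lt_between. lra. }
  exists (Cmod (f (p tM))). split; [apply Cmod_ge_0|]. intros z Hz.
  destruct (unit_circle_param (fst (z - a)%C / r) (snd (z - a)%C / r)) as (t & Ht & E1 & E2).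
  { pose proof (Cmod_sqr (z - a)) as T. rewrite Hz in T.
    set (u := fst (z - a)%C) in *. set (v := snd (z - a)%C) in *.
    replace (u / r * (u / r) + v / r * (v / r)) with ((u * u + v * v) / (r * r)) by (field; lra).
    rewrite <- T. field. lra. }
  replace z with (p t); [now apply HM|].
  unfold p. rewrite <- E1, <- E2. apply injective_projections; simpl; field; lra.
Qed.

(** As [f] is zero near [b], it stays differentiable after multiplication by any power of
    [B z / (z - b)], which has modulus [r] on the circle. The maximum principle for all powers gives
    [|B w| <= r * |w - b|] if [f w] is nonzero, against the strict opposite inequality inside the
    disc. *)
Lemma identity_theorem (f : C -> C) (c b : C) R0 eps :
  (forall z, Cmod (z - c) < R0 -> cdiff f z) -> Cmod (b - c) < R0 -> 0 < eps ->
  (forall z, Cmod (z - b) < eps -> f z = 0) ->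
  forall w, Cmod (w - c) < R0 -> f w = 0.
Proof.
  intros Hf Hb Heps H0 w Hw.
  destruct (Ceq_dec w b) as [->|Hwb]; [apply H0; now rewrite Cmod_sub_self|].
  destruct (Ceq_dec (f w) 0) as [E|Hfw]; [exact E|exfalso].
  pose proof (Cmod_ge_0 (b - c)) as Pb.
  set (m := Rmax (Cmod (w - c)) (Cmod (b - c))).
  assert (Hm1 : Cmod (w - c) <= m) by apply Rmax_l.
  assert (Hm2 : Cmod (b - c) <= m) by apply Rmax_r.
  assert (HmR : m < R0) by (apply Rmax_lub_lt; assumption).
  set (r := (m + R0) / 2).
  assert (Hmr : m < r) by (unfold r; lra). assert (HrR : r < R0) by (unfold r; lra).
  assert (Hr : 0 < r) by lra.
  destruct (circle_bound f c r Hr) as [M [HM0 HM]].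
  { intros z Hz. apply cdiff_cont, Hf. lra. }
  set (B := fun z => bden r (b - c) (z - c)).
  assert (HBN : forall N, Cmod (f w * (B w / (w - b)) ^ N) <= M * r ^ N).
  { intros N. apply (max_mod (fun z => f z * (B z / (z - b)) ^ N)%C c r); [assumption| | |lra].
    - intros z Hz. destruct (Ceq_dec z b) as [->|Hzb].
      + apply (cdiff_local (fun _ => RtoC 0) _ b eps Heps); [|apply cdiff_const].
        intros x Hx. rewrite H0 by assumption. ring.
      + assert (cdiff f z) by (apply Hf; lra).
        unfold B, bden. cdiff_auto. now apply Csub_neq_0.
    - intros z Hz. rewrite Cmod_mult, Cmod_pow, Cmod_div'. unfold B.
      rewrite bden_circle by lra.
      replace (z - c - (b - c))%C with (z - b)%C by ring.
      assert (0 < Cmod (z - b)).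
      { apply Cmod_sub_pos. intros ->. lra. }
      apply Rmult_le_compat; [apply Cmod_ge_0|apply pow_le; apply Rdiv_le_0_compat; [apply Rmult_le_pos; lra|lra]|now apply HM|].
      right. f_equal. field. lra. }
  assert (Hwp : 0 < Cmod (w - b)) by now apply Cmod_sub_pos.
  assert (Hle : Cmod (B w) <= r * Cmod (w - b)).
  { apply (pow_ratio_le _ _ (Cmod (f w)) M); [apply Cmod_ge_0|apply Rmult_le_pos; lra|now apply Cmod_gt_0|].
    intros N. specialize (HBN N). rewrite Cmod_mult, Cmod_pow, Cmod_div' in HBN.
    unfold Rdiv in HBN. rewrite Rpow_mult_distr, pow_inv in HBN.
    pose proof (pow_lt _ N Hwp) as Hpn.
    apply Rmult_le_compat_r with (r := Cmod (w - b) ^ N) in HBN; [|lra].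
    rewrite Rpow_mult_distr.
    replace (Cmod (B w) ^ N * Cmod (f w))
      with (Cmod (f w) * (Cmod (B w) ^ N * / Cmod (w - b) ^ N) * Cmod (w - b) ^ N) by (field; lra).
    eapply Rle_trans; [exact HBN|]. right. ring. }
  pose proof (bden_identity r (b - c) (w - c)) as I. fold (B w) in I.
  replace (w - c - (b - c))%C with (w - b)%C in I by ring.
  pose proof (Cmod_ge_0 (w - c)). pose proof (Cmod_ge_0 (B w)).
  assert (0 < (r * r - Cmod (b - c) * Cmod (b - c)) * (r * r - Cmod (w - c) * Cmod (w - c)))
    by (apply Rmult_lt_0_compat; nra).
  assert (0 <= r * Cmod (w - b)) by (apply Rmult_le_pos; lra). nra.
Qed.

(** * Removable singularities *)

Lemma ccont_bound_limit (f : C -> C) (a : C) d B :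
  0 < d -> ccont f a -> (forall z, z <> a -> Cmod (z - a) < d -> Cmod (f z) <= B) -> Cmod (f a) <= B.
Proof.
  intros Hd Hc H. apply Rnot_lt_le. intros Hlt.
  destruct (Hc (Cmod (f a) - B) ltac:(lra)) as [d' [Hd' Hf]].
  set (s := Rmin d d' / 2).
  pose proof (Rmin_pos _ _ Hd Hd'). pose proof (Rmin_l d d'). pose proof (Rmin_r d d').
  assert (Hs : Cmod (a + RtoC s - a) = s).
  { replace (a + s - a)%C with (RtoC s) by ring. rewrite Cmod_R, Rabs_pos_eq; unfold s; lra. }
  assert (Hn : (a + RtoC s)%C <> a).
  { intros E. rewrite E, Cmod_sub_self in Hs. unfold s in Hs. lra. }
  specialize (H _ Hn ltac:(rewrite Hs; unfold s; lra)).
  specialize (Hf (a + RtoC s)%C ltac:(rewrite Hs; unfold s; lra)).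
  pose proof (Cmod_sub_ge (f a) (f (a + RtoC s)%C)) as T. rewrite Cmod_sub_comm in T. lra.
Qed.

(** Each [t w - L * |w - a|] lies below every [t w' + L * |w' - a|], so the supremum of the former
    values serves as the limit. *)
Lemma lipschitz_limit_R (t : C -> R) (a : C) d L :
  0 < d -> 0 <= L ->
  (forall w w', 0 < Cmod (w - a) < d -> 0 < Cmod (w' - a) < d -> Rabs (t w - t w') <= L * Cmod (w - w')) ->
  exists T, forall w, 0 < Cmod (w - a) < d -> Rabs (t w - T) <= L * Cmod (w - a).
Proof.
  intros Hd HL H.
  assert (H' : forall w w', 0 < Cmod (w - a) < d -> 0 < Cmod (w' - a) < d ->
     t w - L * Cmod (w - a) <= t w' + L * Cmod (w' - a)).
  { intros w w' Hw Hw'. specialize (H w w' Hw Hw'). apply Rabs_le_between in H.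
    pose proof (Cmod_sub_triangle w a w') as T. rewrite (Cmod_sub_comm a w') in T.
    apply Rmult_le_compat_l with (r := L) in T; [|assumption]. lra. }
  assert (Hw0 : Cmod (a + RtoC (d / 2) - a) = d / 2).
  { replace (a + RtoC (d / 2) - a)%C with (RtoC (d / 2)) by ring. rewrite Cmod_R, Rabs_pos_eq; lra. }
  destruct (completeness (fun x => exists w, 0 < Cmod (w - a) < d /\ x = t w - L * Cmod (w - a)))
    as [T [HT1 HT2]].
  - exists (t (a + RtoC (d / 2))%C + L * Cmod (a + RtoC (d / 2) - a)).
    intros x (w & Hw & ->). apply H'; [assumption|lra].
  - eexists. exists (a + RtoC (d / 2))%C. split; [lra|reflexivity].
  - exists T. intros w Hw. apply Rabs_le.
    assert (t w - L * Cmod (w - a) <= T) by (apply HT1; now exists w).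
    assert (T <= t w + L * Cmod (w - a)).
    { apply HT2. intros x (w' & Hw' & ->). now apply H'. }
    lra.
Qed.

Lemma lipschitz_limit (t : C -> C) (a : C) d L :
  0 < d -> 0 <= L ->
  (forall w w', 0 < Cmod (w - a) < d -> 0 < Cmod (w' - a) < d -> Cmod (t w - t w') <= L * Cmod (w - w')) ->
  exists T, forall w, 0 < Cmod (w - a) < d -> Cmod (t w - T) <= 2 * L * Cmod (w - a).
Proof.
  intros Hd HL H.
  destruct (lipschitz_limit_R (fun w => Re (t w)) a d L Hd HL) as [T1 H1].
  { intros w w' Hw Hw'. eapply Rle_trans; [|now apply H]. apply (re_le_Cmod (t w - t w')). }
  destruct (lipschitz_limit_R (fun w => Im (t w)) a d L Hd HL) as [T2 H2].
  { intros w w' Hw Hw'. eapply Rle_trans; [|now apply H]. apply (im_le_Cmod (t w - t w')). }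
  exists (T1, T2). intros w Hw. specialize (H1 w Hw). specialize (H2 w Hw).
  destruct (t w) as [x y]. eapply Rle_trans; [apply Cmod_pair_sub_le|]. simpl in *. lra.
Qed.

(** The constant depends on [w]; it provides the a priori bound under which [max_mod_except] applies
    to the slope. The derivative controls points near [w], and [2 * K / d] the others. *)
Lemma slope_bound (q : C -> C) (a w : C) r K :
  0 < r -> 0 <= K -> Cmod (w - a) <= r ->
  (forall z, Cmod (z - a) <= r -> Cmod (q z) <= K) -> cdiff q w ->
  exists B, 0 <= B /\ forall z, Cmod (z - a) <= r -> Cmod (q z - q w) <= B * Cmod (z - w).
Proof.
  intros Hr HK Hw Hq [l Hl].
  destruct (Hl 1 Rlt_0_1) as [d [Hd Hd']].
  pose proof (Cmod_ge_0 l).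
  assert (Hkd : 0 <= 2 * K / d) by (apply Rdiv_le_0_compat; lra).
  exists (Cmod l + 1 + 2 * K / d). split; [lra|]. intros z Hz.
  pose proof (Cmod_ge_0 (z - w)) as Hzw.
  destruct (Rlt_le_dec (Cmod (z - w)) d) as [Hn|Hf].
  - specialize (Hd' z Hn).
    pose proof (Cmod_triangle (q z - q w - l * (z - w)) (l * (z - w))) as T.
    replace (q z - q w - l * (z - w) + l * (z - w))%C with (q z - q w)%C in T by ring.
    rewrite Cmod_mult in T. nra.
  - pose proof (Cmod_sub_le (q z) (q w)) as T.
    pose proof (Hq z Hz). pose proof (Hq w Hw).
    assert (2 * K = 2 * K / d * d) by (field; lra).
    assert (2 * K / d * d <= 2 * K / d * Cmod (z - w)) by (apply Rmult_le_compat_l; lra).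
    nra.
Qed.

(** The slope from [w] is bounded, with possible singularities at [a] and [w]. On the circle the
    distance to [w] is at least [r / 2] and the numerator at most [2 * K], whence the constant. *)
Lemma lipschitz_off_center (q : C -> C) (a : C) r K :
  0 < r -> 0 <= K ->
  (forall z, Cmod (z - a) <= r -> Cmod (q z) <= K) ->
  (forall z, Cmod (z - a) <= r -> z <> a -> cdiff q z) ->
  forall w z, w <> a -> z <> a -> Cmod (w - a) < r / 2 -> Cmod (z - a) <= r ->
    Cmod (q z - q w) <= 4 * K / r * Cmod (z - w).
Proof.
  intros Hr HK HB Hq w z Hwa Hza Hw Hz.
  destruct (Ceq_dec z w) as [->|Hzw].
  { rewrite !Cmod_sub_self. lra. }
  destruct (slope_bound q a w r K Hr HK ltac:(lra) HB (Hq w ltac:(lra) Hwa)) as [B [HB0 HB1]].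
  set (G := fun x => ((q x - q w) / (x - w))%C).
  assert (HG : forall x, Cmod (x - a) <= r -> Cmod (G x) <= B).
  { intros x Hx. unfold G. destruct (Ceq_dec x w) as [->|Hxw].
    - replace ((q w - q w) / (w - w))%C with (RtoC 0) by (unfold Cdiv; ring).
      rewrite Cmod_0; lra.
    - rewrite Cmod_div'. pose proof (Cmod_sub_pos _ _ Hxw). apply Rle_div_l; auto. }
  assert (Hmain : Cmod (G z) <= 4 * K / r).
  { apply (max_mod_except G (a :: w :: nil) a r (4 * K / r) B); auto.
    - intros e [<-|[<-|[]]]; [rewrite Cmod_sub_self; lra|lra].
    - intros x Hx Hin. simpl in Hin. unfold G.
      assert (cdiff q x) by (apply Hq; auto).
      cdiff_auto. apply Csub_neq_0. intuition.
    - intros x Hx. unfold G. rewrite Cmod_div'.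
      pose proof (Cmod_sub_triangle x w a).
      apply Rle_div_l; [lra|].
      apply Rle_trans with (2 * K).
      + pose proof (Cmod_sub_le (q x) (q w)). pose proof (HB x ltac:(lra)). pose proof (HB w ltac:(lra)). lra.
      + replace (2 * K) with (4 * K / r * (r / 2)) by (field; lra).
        apply Rmult_le_compat_l; [apply Rdiv_le_0_compat; lra|lra].
    - simpl. intuition. }
  unfold G in Hmain. rewrite Cmod_div' in Hmain.
  apply (Rle_div_l _ _ _ (Cmod_sub_pos _ _ Hzw)) in Hmain. exact Hmain.
Qed.

(** Riemann's theorem without integrals: by the maximum principle first and second divided differences of [q] are bounded, so [(q w - q a) / (w - a)] is Lipschitz in [w] and has a limit. *)
Lemma removable_singularity (q : C -> C) (a : C) r K :
  0 < r -> 0 <= K ->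
  (forall z, Cmod (z - a) <= r -> Cmod (q z) <= K) ->
  (forall z, Cmod (z - a) <= r -> z <> a -> cdiff q z) -> ccont q a -> cdiff q a.
Proof.
  intros Hr HK HB Hq Hca.
  pose proof (lipschitz_off_center q a r K Hr HK HB Hq) as HL.
  set (L := 4 * K / r) in *.
  assert (HL0 : 0 <= L) by (apply Rdiv_le_0_compat; lra).
  set (D := fun w z : C => ((q z - q w) / (z - w))%C).
  (* The terms bound the two summands of [D w x - D w' x] on the circle, where both distances are at
     least [r / 2]: [2 * K / (r / 2)^2] and [L / (r / 2)], each times [|w - w'|]. *)
  set (L2 := 8 * K / (r * r) + 2 * L / r).
  assert (HL2 : 0 <= L2).
  { apply Rplus_le_le_0_compat; apply Rdiv_le_0_compat; nra. }
  assert (HD : forall w z, w <> a -> Cmod (w - a) < r / 2 -> z <> a -> Cmod (z - a) <= r -> Cmod (D w z) <= L).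
  { intros w z Hwa Hw Hza Hz. unfold D. destruct (Ceq_dec z w) as [->|Hzw].
    - replace ((q w - q w) / (w - w))%C with (RtoC 0) by (unfold Cdiv; ring). rewrite Cmod_0; lra.
    - rewrite Cmod_div'. pose proof (Cmod_sub_pos _ _ Hzw). apply Rle_div_l; auto. }
  assert (Hlip : forall w w', 0 < Cmod (w - a) < r / 2 -> 0 < Cmod (w' - a) < r / 2 ->
            Cmod (D w a - D w' a) <= L2 * Cmod (w - w')).
  { intros w w' Hw Hw'.
    assert (Hwa : w <> a) by (intros ->; rewrite Cmod_sub_self in Hw; lra).
    assert (Hwa' : w' <> a) by (intros ->; rewrite Cmod_sub_self in Hw'; lra).
    apply (ccont_bound_limit (fun z => D w z - D w' z)%C a (Rmin (Cmod (w - a)) (Cmod (w' - a)))).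
    { apply Rmin_pos; lra. }
    { assert (Hc : forall x, x <> a -> ccont (D x) a).
      { intros x Hx. unfold D.
        assert (a - x <> 0)%C by (apply Csub_neq_0; auto).
        apply ccont_mult.
        - apply ccont_plus; [assumption|apply ccont_const].
        - apply (ccont_comp (fun z => z - x)%C Cinv); [|now apply ccont_inv].
          apply ccont_plus; [apply ccont_id|apply ccont_const]. }
      apply ccont_plus; [now apply Hc|].
      apply (ccont_comp (D w') Copp); [now apply Hc|].
      apply cdiff_cont. cdiff_auto. }
    intros z Hza Hz.
    pose proof (Rmin_l (Cmod (w - a)) (Cmod (w' - a))). pose proof (Rmin_r (Cmod (w - a)) (Cmod (w' - a))).
    (* The value at [a] is replaced by [0] because [HD] bounds the slopes only off [a], whereas
       [max_mod_except] wants a bound on the whole disc. *)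
    set (G := fun x => if Ceq_dec x a then RtoC 0 else (D w x - D w' x)%C).
    replace (D w z - D w' z)%C with (G z) by (unfold G; destruct (Ceq_dec z a); tauto).
    assert (HzE : z <> w /\ z <> w') by (split; intros ->; lra).
    apply (max_mod_except G (a :: w :: w' :: nil) a r _ (2 * L)); try lra.
    - intros e [<-|[<-|[<-|[]]]]; [rewrite Cmod_sub_self; lra|lra|lra].
    - intros x Hx. unfold G. destruct (Ceq_dec x a) as [->|Hxa].
      + rewrite Cmod_0. lra.
      + eapply Rle_trans; [apply Cmod_sub_le|].
        pose proof (HD w x Hwa ltac:(lra) Hxa Hx). pose proof (HD w' x Hwa' ltac:(lra) Hxa Hx). lra.
    - intros x Hx Hin. simpl in Hin.
      assert (Hxa : x <> a) by intuition.
      assert (cdiff q x) by (apply Hq; auto).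
      apply (cdiff_local (fun x => D w x - D w' x)%C G x (Cmod (x - a))); [now apply Cmod_sub_pos| |].
      + intros y Hy. unfold G. destruct (Ceq_dec y a) as [->|]; [|reflexivity].
        rewrite Cmod_sub_comm in Hy. lra.
      + unfold D. cdiff_auto; apply Csub_neq_0; intuition.
    - intros x Hx.
      assert (Hxa : x <> a) by (intros ->; rewrite Cmod_sub_self in Hx; lra).
      unfold G. destruct (Ceq_dec x a) as [|_]; [tauto|].
      pose proof (Cmod_sub_triangle x w a) as T1. pose proof (Cmod_sub_triangle x w' a) as T2.
      assert (Hxw : x <> w) by (intros ->; lra).
      assert (Hxw' : x <> w') by (intros ->; lra).
      replace (D w x - D w' x)%C with
        ((w - w') * ((q x - q w) / ((x - w) * (x - w'))) + (q w' - q w) / (x - w'))%C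
        by (unfold D; field; split; apply Csub_neq_0; assumption).
      eapply Rle_trans; [apply Cmod_triangle|].
      rewrite Cmod_mult, !Cmod_div', Cmod_mult.
      assert (Q1 : Cmod (q x - q w) <= 2 * K).
      { pose proof (Cmod_sub_le (q x) (q w)). pose proof (HB x ltac:(lra)). pose proof (HB w ltac:(lra)). lra. }
      assert (Q2 : Cmod (q w' - q w) <= L * Cmod (w - w')).
      { rewrite (Cmod_sub_comm w w'). apply HL; auto; lra. }
      set (u := Cmod (x - w)) in *. set (v := Cmod (x - w')) in *.
      pose proof (Cmod_ge_0 (w - w')) as P. set (m := Cmod (w - w')) in *.
      assert (Hu : r / 2 <= u) by lra. assert (Hv : r / 2 <= v) by lra.
      assert (I1 : Cmod (q x - q w) / (u * v) <= 8 * K / (r * r)).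
      { apply Rle_div_l; [nra|]. eapply Rle_trans; [exact Q1|].
        replace (2 * K) with (8 * K / (r * r) * (r / 2 * (r / 2))) by (field; lra).
        apply Rmult_le_compat_l; [apply Rdiv_le_0_compat; nra|]. apply Rmult_le_compat; lra. }
      assert (I2 : Cmod (q w' - q w) / v <= 2 * L / r * m).
      { apply Rle_div_l; [lra|]. eapply Rle_trans; [exact Q2|].
        replace (L * m) with (2 * L / r * m * (r / 2)) by (field; lra).
        apply Rmult_le_compat_l; [|lra]. apply Rmult_le_pos; [apply Rdiv_le_0_compat; lra|lra]. }
      unfold L2. apply Rmult_le_compat_l with (r := m) in I1; lra.
    - simpl. intuition. }
  destruct (lipschitz_limit (fun w => D w a) a (r / 2) L2 ltac:(lra) HL2 Hlip) as [T HT].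
  exists T. intros eps He.
  exists (Rmin (r / 2) (eps / (2 * L2 + 1))).
  split; [apply Rmin_pos; [lra|apply Rdiv_lt_0_compat; lra]|].
  intros w Hw.
  pose proof (Rmin_l (r / 2) (eps / (2 * L2 + 1))). pose proof (Rmin_r (r / 2) (eps / (2 * L2 + 1))).
  destruct (Ceq_dec w a) as [->|Hwa].
  { rewrite Cmod_sub_self. replace (q a - q a - T * (a - a))%C with (RtoC 0) by ring. rewrite Cmod_0. lra. }
  pose proof (Cmod_sub_pos _ _ Hwa) as Hp. specialize (HT w ltac:(lra)).
  replace (q w - q a - T * (w - a))%C with ((D w a - T) * (w - a))%C.
  2:{ unfold D. field. apply Csub_neq_0. auto. }
  rewrite Cmod_mult. apply Rmult_le_compat_r; [lra|].
  eapply Rle_trans; [exact HT|].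
  apply Rle_trans with ((2 * L2 + 1) * (eps / (2 * L2 + 1))); [apply Rmult_le_compat; lra|].
  right. field. lra.
Qed.

(** Caratheodory's function [phi] supplies the value of the quotient at the root and its continuity
    there; the singularity is then removable. *)
Lemma divide_root (f : C -> C) (a c : C) R0 :
  (forall z, Cmod (z - c) < R0 -> cdiff f z) -> Cmod (a - c) < R0 -> f a = 0 ->
  exists h, (forall z, f z = ((z - a) * h z)%C) /\ forall z, Cmod (z - c) < R0 -> cdiff h z.
Proof.
  intros Hf Ha H0.
  destruct (proj1 (cdiff_cara f a) (Hf a Ha)) as (phi & d & Hd & Hphi & E).
  set (h := fun z => if Ceq_dec z a then phi a else (f z / (z - a))%C).
  assert (Hh : forall z, f z = ((z - a) * h z)%C).
  { intros z. unfold h. destruct (Ceq_dec z a) as [->|Hn]; [rewrite H0; ring|].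
    field. now apply Csub_neq_0. }
  assert (Hoff : forall z, Cmod (z - c) < R0 -> z <> a -> cdiff h z).
  { intros z Hz Hza.
    apply (cdiff_local (fun z => f z / (z - a))%C h z (Cmod (z - a))); [now apply Cmod_sub_pos| |].
    - intros w Hw. unfold h. destruct (Ceq_dec w a) as [->|]; [|reflexivity].
      rewrite Cmod_sub_comm in Hw. lra.
    - pose proof (Hf z Hz). cdiff_auto. now apply Csub_neq_0. }
  exists h. split; [assumption|]. intros z Hz.
  destruct (Ceq_dec z a) as [->|Hza]; [|now apply Hoff].
  assert (Hloc : forall w, Cmod (w - a) < d -> h w = phi w).
  { intros w Hw. unfold h. destruct (Ceq_dec w a) as [->|Hn]; [reflexivity|].
    specialize (E w Hw). rewrite H0 in E. replace (f w) with (f w - 0)%C by ring.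
    rewrite E. field. now apply Csub_neq_0. }
  assert (Hch : ccont h a).
  { intros eps He. destruct (Hphi eps He) as [d' [Hd' Hp]].
    exists (Rmin d d'). split; [now apply Rmin_pos|]. intros w Hw.
    rewrite !Hloc; [|rewrite Cmod_sub_self; assumption|eapply Rlt_le_trans; [exact Hw|apply Rmin_l]].
    apply Hp. eapply Rlt_le_trans; [exact Hw|apply Rmin_r]. }
  destruct (Hch 1 Rlt_0_1) as [d1 [Hd1 Hc1]].
  set (r := Rmin (d1 / 2) ((R0 - Cmod (a - c)) / 2)).
  assert (Hr1 : r <= d1 / 2) by apply Rmin_l.
  assert (Hr2 : r <= (R0 - Cmod (a - c)) / 2) by apply Rmin_r.
  pose proof (Cmod_ge_0 (h a)).
  assert (Hr : 0 < r) by (apply Rmin_pos; lra).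
  apply (removable_singularity h a r (Cmod (h a) + 1)); auto; [lra| |].
  - intros w Hw. specialize (Hc1 w ltac:(lra)).
    pose proof (Cmod_sub_ge (h w) (h a)). lra.
  - intros w Hw. apply Hoff. pose proof (Cmod_sub_triangle w a c). lra.
Qed.

(** * Zeros of holomorphic functions *)

Definition holo (f : C -> C) : Prop := forall z, Cmod z < 1 -> cdiff f z.

Definition root_prod (A : list C) (z : C) : C := cprod (map (fun a => z - a)%C A).

Lemma cdiff_root_prod (A : list C) (z : C) : cdiff (root_prod A) z.
Proof. apply (cdiff_cprod (fun a z => (z - a)%C)). intros. cdiff_auto. Qed.

Lemma cprod_scale {A} (c : C) (F : A -> C) (l : list A) :
  cprod (map (fun x => c * F x)%C l) = (c ^ length l * cprod (map F l))%C.
Proof. induction l as [|x l IH]; simpl; [ring|]. rewrite IH. ring. Qed.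

(** By [bden_identity] the squared moduli differ by at least [(r * r - m * m)^2], and
    [Cmod (bden r a z) <= 2] turns this into a relative gap, uniform in [a] and [z]. *)
Lemma bden_contraction (r m : R) (a z : C) :
  0 <= m < r -> r <= 1 -> Cmod a <= m -> Cmod z <= m ->
  Cmod (r * (z - a)) ^ 2 <= (1 - (r * r - m * m) ^ 2 / 4) * Cmod (bden r a z) ^ 2.
Proof.
  intros Hm Hr Ha Hz. pose proof (bden_identity r a z) as I.
  pose proof (Cmod_ge_0 a). pose proof (Cmod_ge_0 z).
  rewrite Cmod_mult, Cmod_R, Rabs_pos_eq by lra.
  set (b := Cmod (bden r a z)) in *.
  assert (Hb0 : 0 <= b) by apply Cmod_ge_0.
  assert (Hb : b <= 2).
  { unfold b, bden. eapply Rle_trans; [apply Cmod_sub_le|].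
    rewrite Cmod_mult, Cmod_conj, Cmod_R, Rabs_pos_eq by nra. nra. }
  set (s := r * r - m * m).
  assert (Hs : 0 <= s) by (unfold s; nra).
  assert (J : s * s <= (r * r - Cmod a * Cmod a) * (r * r - Cmod z * Cmod z)).
  { apply Rmult_le_compat; unfold s; nra. }
  assert (b * b <= 4) by nra.
  assert (s * s * (b * b) <= s * s * 4) by (apply Rmult_le_compat_l; nra).
  simpl. rewrite !Rmult_1_r. nra.
Qed.

(** A weak form of Jensen's inequality. Trading each factor [z - a] for [bden r a z / r] keeps the
    modulus on the circle, but at [z0] it gains a factor bounded away from one. Hence
    [|f z0|^2 <= Q^n * M^2] for [n] zeros. *)
Lemma zero_count_bound (f : C -> C) (z0 : C) rho :
  holo f -> Cmod z0 < 1 -> f z0 <> 0 -> rho < 1 ->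
  exists N, forall A h, (forall a, In a A -> Cmod a <= rho) -> holo h ->
    (forall z, f z = (root_prod A z * h z)%C) -> (length A <= N)%nat.
Proof.
  intros Hf Hz0 Hnz Hrho.
  set (m := Rmax rho (Cmod z0)).
  assert (Hm1 : rho <= m) by apply Rmax_l. assert (Hm2 : Cmod z0 <= m) by apply Rmax_r.
  assert (Hm : m < 1) by (apply Rmax_lub_lt; assumption).
  pose proof (Cmod_ge_0 z0) as P0.
  set (r := (1 + m) / 2).
  assert (Hr : 0 < r /\ m < r /\ r < 1) by (unfold r; lra).
  destruct (circle_bound f 0 r ltac:(lra)) as [M [HM0 HM]].
  { intros z Hz. apply cdiff_cont, Hf. replace (z - 0)%C with z in Hz by ring. lra. }
  set (Q := 1 - (r * r - m * m) ^ 2 / 4).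
  assert (HQ : 0 <= Q < 1).
  { unfold Q. assert (0 < r * r - m * m <= 1) by nra. simpl. nra. }
  pose proof (proj1 (Cmod_gt_0 _) Hnz) as Hfp.
  assert (Hfp2 : 0 < Cmod (f z0) * Cmod (f z0)) by nra.
  (* The threshold is essentially [|f z0|^2 / M^2]; the [+ 1] keeps the denominator positive. *)
  destruct (pow_lt_1_zero Q ltac:(rewrite Rabs_pos_eq; lra) (Cmod (f z0) * Cmod (f z0) / (M * M + 1))) as [N HN].
  { apply Rdiv_lt_0_compat; nra. }
  exists N. intros A h HA Hh E.
  destruct (Nat.le_gt_cases (length A) N) as [|Hlt]; [assumption|exfalso].
  specialize (HN (length A) ltac:(lia)).
  set (n := length A) in *.
  rewrite Rabs_pos_eq in HN by (apply pow_le; lra).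
  pose proof (pow_lt r n ltac:(lra)) as Hrn.
  assert (B1 : Cmod (h z0 * cprod (map (fun a => bden r a z0) A)) <= M * r ^ n).
  { apply (max_mod (fun z => h z * cprod (map (fun a => bden r a z) A))%C 0 r); [lra| | |].
    - intros z Hz. replace (z - 0)%C with z in Hz by ring.
      assert (cdiff h z) by (apply Hh; lra). apply cdiff_mult; [assumption|].
      apply (cdiff_cprod (fun a z => bden r a z)). intros. unfold bden. cdiff_auto.
    - intros z Hz. pose proof (HM z Hz) as B. replace (z - 0)%C with z in Hz by ring.
      rewrite Cmod_mult.
      rewrite (Cmod_cprod_eq (fun a => bden r a z) (fun a => RtoC r * (z - a))%C).
      2:{ intros a _. rewrite bden_circle by lra. rewrite Cmod_mult, Cmod_R, Rabs_pos_eq; lra. }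
      rewrite cprod_scale, Cmod_mult, Cmod_pow, Cmod_R, Rabs_pos_eq by lra. fold n.
      rewrite E, Cmod_mult in B. unfold root_prod in B.
      set (p := Cmod (cprod _)) in *. nra.
    - replace (z0 - 0)%C with z0 by ring. lra. }
  assert (B2 : forall l, (forall a, In a l -> Cmod a <= rho) ->
     Cmod (cprod (map (fun a => RtoC r * (z0 - a))%C l)) ^ 2 <=
     Q ^ length l * Cmod (cprod (map (fun a => bden r a z0) l)) ^ 2).
  { induction l as [|a l IH]; intros Hl.
    - simpl. rewrite Cmod_1. lra.
    - change (Cmod ((RtoC r * (z0 - a)) * cprod (map (fun a => RtoC r * (z0 - a))%C l)) ^ 2 <=
        Q * Q ^ length l * Cmod (bden r a z0 * cprod (map (fun a => bden r a z0) l)) ^ 2).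
      rewrite (Cmod_mult (RtoC r * (z0 - a))), (Cmod_mult (bden r a z0)).
      set (u := Cmod (RtoC r * (z0 - a))). set (v := Cmod (cprod _)) at 1.
      set (y := Cmod (bden r a z0)). set (t := Cmod (cprod _)).
      replace ((u * v) ^ 2) with (u ^ 2 * v ^ 2) by ring.
      replace (Q * Q ^ length l * (y * t) ^ 2) with ((Q * y ^ 2) * (Q ^ length l * t ^ 2)) by ring.
      apply Rmult_le_compat.
      + apply pow2_ge_0.
      + apply pow2_ge_0.
      + apply bden_contraction; try lra.
        eapply Rle_trans; [apply Hl; now left|assumption].
      + apply IH. intros x Hx. apply Hl. now right. }
  specialize (B2 A HA). fold n in B2.
  rewrite cprod_scale, Cmod_mult, Cmod_pow, Cmod_R, Rabs_pos_eq in B2 by lra. fold n in B2.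
  specialize (E z0). unfold root_prod in E.
  rewrite E, Cmod_mult in HN, Hfp, Hfp2. rewrite Cmod_mult in B1.
  set (p := Cmod (cprod (map (fun a : C => (z0 - a)%C) A))) in *.
  set (x := Cmod (h z0)) in *.
  set (bb := Cmod (cprod (map (fun a : C => bden r a z0) A))) in *.
  assert (Hx : 0 <= x) by apply Cmod_ge_0. assert (Hbb : 0 <= bb) by apply Cmod_ge_0.
  assert (Hp : 0 <= p) by apply Cmod_ge_0.
  assert (C1 : (x * bb) ^ 2 <= (M * r ^ n) ^ 2) by (apply pow_incr; split; [apply Rmult_le_pos; lra|assumption]).
  assert (C2 : (r ^ n * p) ^ 2 * x ^ 2 <= Q ^ n * bb ^ 2 * x ^ 2)
    by (apply Rmult_le_compat_r; [apply pow2_ge_0|assumption]).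
  assert (HQn : 0 <= Q ^ n) by (apply pow_le; lra).
  assert (C3 : Q ^ n * (x * bb) ^ 2 <= Q ^ n * (M * r ^ n) ^ 2) by (apply Rmult_le_compat_l; assumption).
  assert (C4 : (r ^ n) ^ 2 * (p * x * (p * x)) <= (r ^ n) ^ 2 * (Q ^ n * (M * M))) by nra.
  apply Rmult_le_reg_l in C4; [|apply pow_lt; assumption].
  apply Rlt_div_r in HN; [|nra]. nra.
Qed.

Lemma maximal_list {A : Type} (P : list A -> Prop) N :
  P nil -> (forall l, P l -> (length l <= N)%nat) -> exists l, P l /\ forall x, ~ P (x :: l).
Proof.
  intros H0 HN. apply NNPP. intros Hno.
  assert (H : forall k, exists l, P l /\ length l = k).
  { induction k as [|k [l [Hl Hk]]]; [now exists nil|].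
    apply NNPP. intros Hk'. apply Hno. exists l. split; [assumption|].
    intros x Hx. apply Hk'. exists (x :: l). split; [assumption|]. simpl. now rewrite Hk. }
  destruct (H (S N)) as [l [Hl Hk]]. specialize (HN l Hl). lia.
Qed.

Lemma divide_root_holo (f : C -> C) (a : C) :
  holo f -> Cmod a < 1 -> f a = 0 -> exists h, (forall z, f z = ((z - a) * h z)%C) /\ holo h.
Proof.
  intros Hf Ha H0.
  assert (E : forall z : C, (z - 0)%C = z) by (intros; ring).
  destruct (divide_root f a 0 1) as [h [Hh1 Hh2]]; [intros z; rewrite E; apply Hf|now rewrite E|assumption|].
  exists h. split; [assumption|]. intros z Hz. apply Hh2. now rewrite E.
Qed.

(** Lists of zeros that divide [f] have bounded length, so one of them cannot be extended. A zero of
    its cofactor in [X] could be divided out and would extend it. *)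
Lemma factor_zeros (f : C -> C) (X : C -> Prop) (z0 : C) rho :
  holo f -> Cmod z0 < 1 -> f z0 <> 0 -> rho < 1 -> (forall z, X z -> Cmod z <= rho) ->
  exists A h, (forall a, In a A -> X a) /\ holo h /\
    (forall z, f z = (root_prod A z * h z)%C) /\ forall z, X z -> h z <> 0.
Proof.
  intros Hf Hz0 Hnz Hrho HX.
  destruct (zero_count_bound f z0 rho Hf Hz0 Hnz Hrho) as [N HN].
  destruct (maximal_list (fun A => (forall a, In a A -> X a) /\
      exists h, holo h /\ forall z, f z = (root_prod A z * h z)%C) N) as [A [[HA (h & Hh & E)] Hmax]].
  - split; [intros a []|]. exists f. split; [assumption|]. intros z. unfold root_prod; simpl. ring.
  - intros A [HA (h & Hh & E)]. apply (HN A h); auto.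
  - exists A, h. repeat split; auto. intros z Hz H0. apply (Hmax z). split.
    + intros a [<-|Ha]; auto.
    + destruct (divide_root_holo h z Hh) as [k [Ek Hk]]; [specialize (HX z Hz); lra|assumption|].
      exists k. split; [assumption|]. intros w. rewrite E, Ek. unfold root_prod; simpl. ring.
Qed.

Lemma remove_common_zeros (f g : C -> C) (X : C -> Prop) (z0 : C) rho :
  holo f -> holo g -> Cmod z0 < 1 -> f z0 <> 0 -> rho < 1 -> (forall z, X z -> Cmod z <= rho) ->
  exists S f1 g1, holo f1 /\ holo g1 /\
    (forall z, f z = (root_prod S z * f1 z)%C) /\ (forall z, g z = (root_prod S z * g1 z)%C) /\
    forall z, X z -> f1 z = 0 -> g1 z <> 0.
Proof.
  intros Hf Hg Hz0 Hnz Hrho HX.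
  destruct (zero_count_bound f z0 rho Hf Hz0 Hnz Hrho) as [N HN].
  destruct (maximal_list (fun A => (forall a, In a A -> X a) /\
      exists f1 g1, holo f1 /\ holo g1 /\ (forall z, f z = (root_prod A z * f1 z)%C) /\
        (forall z, g z = (root_prod A z * g1 z)%C)) N) as [A [[HA (f1 & g1 & Hf1 & Hg1 & Ef & Eg)] Hmax]].
  - split; [intros a []|]. exists f, g. repeat split; auto; intros z; unfold root_prod; simpl; ring.
  - intros A [HA (f1 & g1 & Hf1 & _ & E & _)]. apply (HN A f1); auto.
  - exists A, f1, g1. repeat split; auto. intros z Hz F0 G0. apply (Hmax z).
    specialize (HX z Hz). split.
    + intros a [<-|Ha]; auto.
    + destruct (divide_root_holo f1 z Hf1) as [f2 [Ef2 Hf2]]; [lra|assumption|].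
      destruct (divide_root_holo g1 z Hg1) as [g2 [Eg2 Hg2]]; [lra|assumption|].
      exists f2, g2. repeat split; auto; intros w; [rewrite Ef, Ef2|rewrite Eg, Eg2];
        unfold root_prod; simpl; ring.
Qed.

Lemma circle_perfect (a z : C) r d :
  0 < r -> circle a r z -> 0 < d -> exists w, circle a r w /\ w <> z /\ Cmod (w - z) < d.
Proof.
  unfold circle. intros Hr Hz Hd.
  (* The point is turned by [u / v = (1 + i t) / (1 - i t)], which avoids trigonometry and moves it
     by at most [2 * t * r = d / 2]. *)
  set (t := d / (4 * r)). assert (Ht : 0 < t) by (apply Rdiv_lt_0_compat; lra).
  pose (u := (1, t) : C). pose (v := (1, - t) : C). pose (y := (0, 2 * t) : C).
  assert (Hm : Cmod u = Cmod v) by (apply Cmod_sqr_eq; simpl; ring).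
  assert (Hm1 : 1 <= Cmod v).
  { pose proof (Rmax_Cmod v) as T. unfold v in T at 1 2; simpl in T. rewrite Rabs_R1 in T.
    pose proof (Rmax_l 1 (Rabs (- t))). lra. }
  assert (Hn : v <> 0) by (apply Cmod_gt_0; lra).
  set (w := (a + (z - a) * (u / v))%C).
  assert (E : (w - z)%C = ((z - a) * (y / v))%C).
  { unfold w. replace y with (u - v)%C
      by (unfold u, v, y; apply injective_projections; simpl; ring). field. assumption. }
  assert (M2 : Cmod y = 2 * t) by (apply Cmod_eq_sqr; simpl; [lra|ring]).
  exists w. repeat split.
  - unfold w. replace (a + (z - a) * (u / v) - a)%C with ((z - a) * (u / v))%C by ring.
    rewrite Cmod_mult, Cmod_div', Hm, Hz. field. lra.
  - intros Hwz. assert (H0 : Cmod (w - z) = 0) by (rewrite Hwz; apply Cmod_sub_self).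
    rewrite E, Cmod_mult, Cmod_div', Hz, M2 in H0.
    assert (0 < 2 * t / Cmod v) by (apply Rdiv_lt_0_compat; lra). nra.
  - rewrite E, Cmod_mult, Cmod_div', Hz, M2.
    assert (2 * t / Cmod v <= 2 * t) by (apply Rle_div_l; nra).
    assert (r * (2 * t) = d / 2) by (unfold t; field; lra). nra.
Qed.

(** Off [e] the factor cancels at once. If [e] is on the circle, equality there follows by
    continuity, [e] being a limit of other points of the circle. *)
Lemma Cmod_eq_divide_root (F G : C -> C) (e a : C) r :
  0 < r -> (forall z, circle a r z -> ccont F z /\ ccont G z) ->
  (forall z, circle a r z -> Cmod ((z - e) * F z) = Cmod ((z - e) * G z)) ->
  forall z, circle a r z -> Cmod (F z) = Cmod (G z).
Proof.
  intros Hr Hc H.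
  assert (H' : forall z, circle a r z -> z <> e -> Cmod (F z) = Cmod (G z)).
  { intros z Hz Hze. specialize (H z Hz). rewrite !Cmod_mult in H.
    pose proof (Cmod_sub_pos _ _ Hze). apply Rmult_eq_reg_l in H; lra. }
  intros z Hz. destruct (Ceq_dec z e) as [->|Hze]; [|now apply H'].
  destruct (Req_dec (Cmod (F e)) (Cmod (G e))) as [|Hn]; [assumption|exfalso].
  destruct (Hc e Hz) as [HF HG].
  set (eps := Rabs (Cmod (F e) - Cmod (G e)) / 2).
  assert (Heps : 0 < eps).
  { unfold eps. assert (0 < Rabs (Cmod (F e) - Cmod (G e))) by (apply Rabs_pos_lt; lra). lra. }
  destruct (HF eps Heps) as [d1 [Hd1 F1]]. destruct (HG eps Heps) as [d2 [Hd2 G1]].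
  destruct (circle_perfect a e r (Rmin d1 d2) Hr Hz) as (w & Hw & Hwe & Hwd); [now apply Rmin_pos|].
  specialize (H' w Hw Hwe).
  specialize (F1 w ltac:(eapply Rlt_le_trans; [exact Hwd|apply Rmin_l])).
  specialize (G1 w ltac:(eapply Rlt_le_trans; [exact Hwd|apply Rmin_r])).
  pose proof (Cmod_sub_ge (F w) (F e)). pose proof (Cmod_sub_ge (F e) (F w)) as T1.
  rewrite Cmod_sub_comm in T1.
  pose proof (Cmod_sub_ge (G w) (G e)). pose proof (Cmod_sub_ge (G e) (G w)) as T2.
  rewrite Cmod_sub_comm in T2.
  assert (Rabs (Cmod (F e) - Cmod (G e)) < 2 * eps) by (apply Rabs_lt_between; lra).
  unfold eps in *. lra.
Qed.

Lemma Cmod_eq_divide_root_prod (S : list C) (F G : C -> C) (a : C) r :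
  0 < r -> (forall z, circle a r z -> cdiff F z /\ cdiff G z) ->
  (forall z, circle a r z -> Cmod (root_prod S z * F z) = Cmod (root_prod S z * G z)) ->
  forall z, circle a r z -> Cmod (F z) = Cmod (G z).
Proof.
  intros Hr Hc. induction S as [|e S IH]; intros H.
  - intros z Hz. specialize (H z Hz). unfold root_prod in H. simpl in H. now rewrite !Cmult_1_l in H.
  - apply IH.
    apply (Cmod_eq_divide_root (fun z => root_prod S z * F z)%C (fun z => root_prod S z * G z)%C e); auto.
    + intros z Hz. destruct (Hc z Hz). split; apply cdiff_cont, cdiff_mult; auto using cdiff_root_prod.
    + intros z Hz. specialize (H z Hz). unfold root_prod in *; simpl in H.
      now rewrite <- !Cmult_assoc in H.
Qed.

(** * Blaschke quotients *)

(** For nonzero [l], a small step in the direction [H z / l] would increase the modulus: the first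
    order gain is [s], the error at most [s / 2]. *)
Lemma cderiv_0_of_const_Cmod (H : C -> C) (z l : C) d :
  0 < d -> (forall w, Cmod (w - z) < d -> Cmod (H w) = 1) -> cderiv H z l -> l = 0.
Proof.
  intros Hd H1 Hl. destruct (Ceq_dec l 0) as [E|Hn]; [exact E|exfalso].
  pose proof (proj1 (Cmod_gt_0 _) Hn) as Hp.
  destruct (Hl (Cmod l / 2)) as [d' [Hd' Hl']]; [lra|].
  set (m := Rmin d d'). assert (Hm : 0 < m) by now apply Rmin_pos.
  assert (Hz : Cmod (H z) = 1) by (apply H1; rewrite Cmod_sub_self; assumption).
  set (s := Cmod l * (m / 2)). assert (Hs : 0 < s) by (apply Rmult_lt_0_compat; lra).
  set (w := (z + RtoC s * H z / l)%C).
  assert (Ew : (w - z)%C = (RtoC s * H z / l)%C) by (unfold w; ring).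
  assert (Mw : Cmod (w - z) = m / 2).
  { rewrite Ew, Cmod_div', Cmod_mult, Hz, Cmod_R, Rabs_pos_eq by lra. unfold s. field. lra. }
  pose proof (Rmin_l d d'). pose proof (Rmin_r d d'). fold m in H0, H2.
  specialize (Hl' w ltac:(lra)). specialize (H1 w ltac:(lra)).
  rewrite Mw in Hl'.
  pose proof (Cmod_sub_triangle (RtoC (1 + s) * H z) (H w) 0) as T.
  replace (RtoC (1 + s) * H z - 0)%C with (RtoC (1 + s) * H z)%C in T by ring.
  replace (H w - 0)%C with (H w) in T by ring.
  rewrite Cmod_mult, Hz, H1, Cmod_R, Rabs_pos_eq, Cmod_sub_comm in T by lra.
  replace (H w - RtoC (1 + s) * H z)%C with (H w - H z - l * (w - z))%C in T.
  2:{ rewrite Ew, RtoC_plus. field. assumption. }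
  unfold s in T. nra.
Qed.

Lemma const_of_cderiv_0 (H : C -> C) (a z : C) r :
  (forall w, Cmod (w - a) < r -> cderiv H w 0) -> Cmod (z - a) < r -> H z = H a.
Proof.
  intros Hd Hz.
  set (p := fun t : R => (a + RtoC t * (z - a))%C).
  assert (Hp : forall s t, Cmod (p s - p t) = Rabs (s - t) * Cmod (z - a)).
  { intros s t. unfold p. replace (a + s * (z - a) - (a + t * (z - a)))%C with ((s - t)%R * (z - a))%C
      by (rewrite RtoC_minus; ring). now rewrite Cmod_mult, Cmod_R. }
  pose proof (Cmod_ge_0 (z - a)) as P.
  assert (D : forall t eps, 0 <= t <= 1 -> 0 < eps -> exists d, 0 < d /\ forall h, Rabs h < d ->
     Cmod (H (p (t + h)) - H (p t)) <= eps * Rabs h).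
  { intros t eps Ht He.
    destruct (Hd (p t)) with (eps := eps / (Cmod (z - a) + 1)) as [d [Hd0 Hd1]].
    - replace (p t - a)%C with (RtoC t * (z - a))%C by (unfold p; ring).
      rewrite Cmod_mult, Cmod_R, Rabs_pos_eq by lra. nra.
    - apply Rdiv_lt_0_compat; lra.
    - exists (d / (Cmod (z - a) + 1)). split; [apply Rdiv_lt_0_compat; lra|]. intros h Hh.
      specialize (Hd1 (p (t + h))). rewrite Hp in Hd1.
      replace (t + h - t) with h in Hd1 by ring.
      replace (H (p (t + h)%R) - H (p t) - 0 * (p (t + h)%R - p t))%C
        with (H (p (t + h)%R) - H (p t))%C in Hd1 by ring.
      pose proof (Rabs_pos h) as Ph.
      apply Rlt_div_r in Hh; [|lra].
      eapply Rle_trans; [apply Hd1; nra|].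
      replace (eps * Rabs h) with (eps / (Cmod (z - a) + 1) * (Rabs h * (Cmod (z - a) + 1)))
        by (field; lra).
      apply Rmult_le_compat_l; [apply Rdiv_le_0_compat; lra|]. nra. }
  assert (E0 : p 0 = a) by (unfold p; ring). assert (E1 : p 1 = z) by (unfold p; ring).
  rewrite <- E0, <- E1.
  assert (K : forall c : C -> R, (forall u v, Rabs (c u - c v) <= Cmod (u - v)) -> c (H (p 1)) = c (H (p 0))).
  { intros c Hc.
    destruct (MVT_cor2 (fun t => c (H (p t))) (fun _ => 0) 0 1 Rlt_0_1) as [x [Hx _]]; [|lra].
    intros t Ht eps He. destruct (D t (eps / 2) Ht ltac:(lra)) as [d [Hd0 Hd1]].
    exists (mkposreal d Hd0). intros h Hh0 Hh. specialize (Hd1 h Hh).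
    rewrite Rminus_0_r. unfold Rdiv. rewrite Rabs_mult, Rabs_inv.
    assert (Ph : 0 < Rabs h) by now apply Rabs_pos_lt.
    apply Rmult_lt_reg_r with (Rabs h); [assumption|].
    rewrite Rmult_assoc, Rinv_l, Rmult_1_r by lra.
    eapply Rle_lt_trans; [apply Hc|]. nra. }
  apply injective_projections.
  - apply (K fst). intros u v. apply (re_le_Cmod (u - v)).
  - apply (K snd). intros u v. apply (im_le_Cmod (u - v)).
Qed.

Lemma const_of_const_Cmod (H : C -> C) (a z : C) r :
  (forall w, Cmod (w - a) < r -> cdiff H w /\ Cmod (H w) = 1) -> Cmod (z - a) < r -> H z = H a.
Proof.
  intros HH. apply const_of_cderiv_0. intros w Hw.
  destruct (proj1 (HH w Hw)) as [l Hl].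
  replace (RtoC 0) with l; [exact Hl|].
  apply (cderiv_0_of_const_Cmod H w l (r - Cmod (w - a))); [lra| |assumption].
  intros x Hx. apply HH. pose proof (Cmod_sub_triangle x w a). lra.
Qed.

(** A vector [s = (x, y)] stands for the point [x / y] of the Riemann sphere, and [lf s z] is the linear form vanishing there. *)
Definition lf (s : C * C) (z : C) : C := (snd s * z - fst s)%C.
Definition Lprod (U : list (C * C)) (z : C) : C := cprod (map (fun s => lf s z) U).
(** For nonzero vectors this determinant vanishes exactly when they stand for the same point of the
    sphere. *)
Definition wedge (s t : C * C) : C := (fst s * snd t - snd s * fst t)%C.
Definition emb (x : C) : C * C := (x, RtoC 1).

(** Reflection in the circle of centre [d] and radius [r], normalised to be an anti-isometry for [wedge]. *)
Definition refl (d : C) (r : R) (s : C * C) : C * C :=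
  (((d * Cconj (fst s) + (RtoC r * RtoC r - d * Cconj d) * Cconj (snd s)) / RtoC r)%C,
   ((Cconj (fst s) - Cconj d * Cconj (snd s)) / RtoC r)%C).

Lemma Cconj_R (x : R) : Cconj (RtoC x) = RtoC x.
Proof. apply injective_projections; simpl; ring. Qed.

Lemma RtoC_neq_0 (r : R) : 0 < r -> RtoC r <> 0.
Proof. intros H E. apply RtoC_inj in E. lra. Qed.

Ltac conj_push :=
  repeat progress (rewrite ?Cdiv_conj by (apply RtoC_neq_0; assumption);
    rewrite ?Cplus_conj, ?Cminus_conj, ?Cmult_conj, ?Cconj_conj, ?Cconj_R).

Lemma refl_involutive (d : C) r s : 0 < r -> refl d r (refl d r s) = s.
Proof.
  intros Hr. pose proof (RtoC_neq_0 r Hr). destruct s as [x y]. unfold refl; simpl.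
  conj_push.
  apply injective_projections; simpl; field; assumption.
Qed.

Lemma wedge_refl (d : C) r s t : 0 < r -> wedge (refl d r s) (refl d r t) = (- Cconj (wedge s t))%C.
Proof.
  intros Hr. pose proof (RtoC_neq_0 r Hr). destruct s as [x y], t as [x' y'].
  unfold wedge, refl; simpl. conj_push. field. assumption.
Qed.

(** On the circle [Cconj z - Cconj d] is [r^2 / (z - d)], so the conjugate of a linear form becomes,
    after multiplication by [z - d], a linear form vanishing at the reflected point. *)
Lemma lf_refl (d : C) r s z : 0 < r -> circle d r z ->
  (Cconj (lf s z) * (z - d) = - RtoC r * lf (refl d r s) z)%C.
Proof.
  intros Hr Hz. pose proof (RtoC_neq_0 r Hr). destruct s as [x y]. unfold lf, refl; simpl.
  assert (E : ((z - d) * (Cconj z - Cconj d) = RtoC r * RtoC r)%C).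
  { rewrite <- Cminus_conj, <- Cmod2_conj, Hz. simpl. rewrite Rmult_1_r, RtoC_mult. reflexivity. }
  conj_push.
  transitivity ((Cconj y * ((z - d) * (Cconj z - Cconj d)) + (Cconj y * Cconj d - Cconj x) * (z - d))%C).
  - ring.
  - rewrite E. field. assumption.
Qed.

Lemma Cmod_lf_refl (d : C) r s z : 0 < r -> circle d r z -> Cmod (lf (refl d r s) z) = Cmod (lf s z).
Proof.
  intros Hr Hz. pose proof (f_equal Cmod (lf_refl d r s z Hr Hz)) as E.
  unfold circle in Hz. rewrite !Cmod_mult, Cmod_opp, Cmod_conj, Cmod_R, Rabs_pos_eq, Hz in E by lra.
  nra.
Qed.

Lemma lf_emb (x z : C) : lf (emb x) z = (z - x)%C.
Proof. unfold lf, emb; simpl. ring. Qed.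

(** Up to the factor [- r] this form is the Blaschke denominator: the reflection of an interior
    point lies outside the closed disc. *)
Lemma lf_refl_emb_neq_0 (d x z : C) r :
  0 < r -> Cmod (x - d) < r -> Cmod (z - d) <= r -> lf (refl d r (emb x)) z <> 0.
Proof.
  intros Hr Hx Hz E. apply (bden_neq_0 r (x - d) (z - d) Hx Hz).
  pose proof (RtoC_neq_0 r Hr).
  replace (bden r (x - d) (z - d)) with (- RtoC r * lf (refl d r (emb x)) z)%C.
  - rewrite E. ring.
  - unfold bden, lf, refl, emb; simpl. rewrite Cminus_conj, RtoC_mult, Cconj_R. field. assumption.
Qed.

Lemma cdiff_Lprod U z : cdiff (Lprod U) z.
Proof. apply (cdiff_cprod (fun s z => lf s z)). intros. unfold lf. cdiff_auto. Qed.

Lemma Lprod_app U V z : Lprod (U ++ V) z = (Lprod U z * Lprod V z)%C.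
Proof. unfold Lprod. now rewrite map_app, cprod_app. Qed.

Lemma Lprod_emb A z : Lprod (map emb A) z = root_prod A z.
Proof.
  unfold Lprod, root_prod. rewrite map_map. f_equal. apply map_ext. intros. apply lf_emb.
Qed.

Lemma Cmod_Lprod_refl (d : C) r U z : 0 < r -> circle d r z ->
  Cmod (Lprod (map (refl d r) U) z) = Cmod (Lprod U z).
Proof.
  intros Hr Hz. unfold Lprod. rewrite map_map. apply Cmod_cprod_eq.
  intros s _. now apply Cmod_lf_refl.
Qed.

(** All zeros on the sphere of the Blaschke quotient with zeros [A] and poles [B] in the disc, since
    its poles reflect to zeros. Reflecting this list gives all its poles. *)
Definition zero_pole_vectors (d : C) (r : R) (A B : list C) : list (C * C) :=
  map emb A ++ map (refl d r) (map emb B).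

Lemma map_refl_zero_pole_vectors (d : C) r A B : 0 < r ->
  map (refl d r) (zero_pole_vectors d r A B) = map (refl d r) (map emb A) ++ map emb B.
Proof.
  intros Hr. unfold zero_pole_vectors. rewrite map_app. f_equal.
  rewrite map_map. rewrite <- (map_id (map emb B)) at 2. apply map_ext.
  intros s. now apply refl_involutive.
Qed.

(** If [|f| = |g|] on a circle, then [f / g] is a quotient of Blaschke products of its disc: the remaining zero-free factor has modulus one on the circle, hence (maximum principle for it and its inverse) on the disc. *)
Lemma quotient_of_blaschke (f g h k : C -> C) (A B : list C) (a : C) r :
  0 < r -> (forall z, Cmod (z - a) <= r -> Cmod z < 1) ->
  holo f -> holo g -> holo h -> holo k ->
  (forall z, f z = (root_prod A z * h z)%C) -> (forall z, g z = (root_prod B z * k z)%C) ->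
  (forall x, In x A -> Cmod (x - a) < r) -> (forall x, In x B -> Cmod (x - a) < r) ->
  (forall z, Cmod (z - a) <= r -> h z <> 0) -> (forall z, Cmod (z - a) <= r -> k z <> 0) ->
  (forall z, circle a r z -> Cmod (f z) = Cmod (g z)) ->
  exists c, Cmod c = 1 /\ forall z, Cmod z < 1 ->
    (f z * Lprod (map (refl a r) (zero_pole_vectors a r A B)) z =
     c * g z * Lprod (zero_pole_vectors a r A B) z)%C.
Proof.
  intros Hr HD Hf Hg Hh Hk Ef Eg HA HB Hh0 Hk0 Hfg.
  set (PA := Lprod (map (refl a r) (map emb A))). set (PB := Lprod (map (refl a r) (map emb B))).
  assert (NP : forall l z, (forall x, In x l -> Cmod (x - a) < r) -> Cmod (z - a) <= r ->
            Lprod (map (refl a r) (map emb l)) z <> 0).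
  { intros l z Hl Hz. unfold Lprod. rewrite map_map. apply cprod_neq_0.
    intros s Hs. apply in_map_iff in Hs as (x & <- & Hx). apply lf_refl_emb_neq_0; auto. }
  assert (CP : forall l z, circle a r z -> Cmod (Lprod (map (refl a r) (map emb l)) z) = Cmod (root_prod l z)).
  { intros l z Hz. rewrite <- Lprod_emb. now apply Cmod_Lprod_refl. }
  assert (Q : forall (h k : C -> C) (PA PB : C -> C), holo h -> holo k ->
     (forall z, cdiff PA z) -> (forall z, cdiff PB z) ->
     (forall z, Cmod (z - a) <= r -> k z <> 0) -> (forall z, Cmod (z - a) <= r -> PB z <> 0) ->
     (forall z, circle a r z -> Cmod (h z * PA z) = Cmod (k z * PB z)) ->
     forall z, Cmod (z - a) <= r -> cdiff (fun z => h z * PA z / (k z * PB z))%C z /\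
        Cmod (h z * PA z / (k z * PB z)) <= 1).
  { clear - Hr HD. intros h k PA PB Hh Hk HPA HPB Hk0 HPB0 E.
    assert (Hcd : forall z, Cmod (z - a) <= r -> cdiff (fun z => h z * PA z / (k z * PB z))%C z).
    { intros z Hz. specialize (HD z Hz).
      apply cdiff_div; [apply cdiff_mult|apply cdiff_mult|apply Cmult_neq_0]; auto. }
    intros z Hz. split; [now apply Hcd|].
    apply (max_mod (fun z => h z * PA z / (k z * PB z))%C a r); auto.
    intros w Hw. rewrite Cmod_div', E by assumption. right. field.
    apply Rgt_not_eq, Cmod_gt_0, Cmult_neq_0; [apply Hk0|apply HPB0]; lra. }
  assert (Ecirc : forall z, circle a r z -> Cmod (h z * PA z) = Cmod (k z * PB z)).
  { intros z Hz. rewrite !Cmod_mult. unfold PA, PB. rewrite !CP by assumption.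
    specialize (Hfg z Hz). rewrite Ef, Eg, !Cmod_mult in Hfg. lra. }
  set (H := fun z => (h z * PA z / (k z * PB z))%C).
  assert (HH : forall z, Cmod (z - a) <= r -> cdiff H z /\ Cmod (H z) = 1).
  { intros z Hz.
    destruct (Q h k PA PB) with (z := z) as [H1 H2]; auto; try (intros; apply cdiff_Lprod); try (intros; apply NP; auto).
    destruct (Q k h PB PA) with (z := z) as [_ H3]; auto; try (intros; apply cdiff_Lprod); try (intros; apply NP; auto).
    { intros w Hw. symmetry. now apply Ecirc. }
    split; [exact H1|]. unfold H.
    rewrite Cmod_div' in *.
    assert (X1 : 0 < Cmod (h z * PA z)) by (apply Cmod_gt_0, Cmult_neq_0; [apply Hh0|apply NP]; auto).
    assert (X2 : 0 < Cmod (k z * PB z)) by (apply Cmod_gt_0, Cmult_neq_0; [apply Hk0|apply NP]; auto).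
    apply (Rle_div_l _ _ _ X2) in H2. apply (Rle_div_l _ _ _ X1) in H3.
    replace (Cmod (h z * PA z)) with (Cmod (k z * PB z)) by lra. field. lra. }
  exists (H a). split; [apply HH; rewrite Cmod_sub_self; lra|].
  assert (Hconst : forall z, Cmod (z - a) < r -> (h z * PA z = H a * (k z * PB z))%C).
  { intros z Hz. rewrite <- (const_of_const_Cmod H a z r); [|intros; apply HH; lra|assumption].
    unfold H. field. split; [apply NP; auto; lra|apply Hk0; lra]. }
  intros z Hz. rewrite map_refl_zero_pole_vectors by assumption.
  unfold zero_pole_vectors. rewrite !Lprod_app, !Lprod_emb. fold PA PB.
  (* Denominators are cleared, so that the equality on the disc extends to the whole unit disc by
     the identity theorem for holomorphic functions. *)
  apply Csub_0_eq.
  apply (identity_theorem (fun z => f z * (PA z * root_prod B z) - H a * g z * (root_prod A z * PB z))%C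
           0 a 1 r); [| |assumption| |].
  - intros w Hw. replace (w - 0)%C with w in Hw by ring.
    assert (cdiff f w) by auto. assert (cdiff g w) by auto.
    assert (cdiff PA w) by apply cdiff_Lprod. assert (cdiff PB w) by apply cdiff_Lprod.
    pose proof (cdiff_root_prod A w). pose proof (cdiff_root_prod B w).
    change (cdiff (root_prod A) w) in H4. cdiff_auto.
  - replace (a - 0)%C with a by ring. apply HD. rewrite Cmod_sub_self. lra.
  - intros w Hw. rewrite Ef, Eg.
    replace (root_prod A w * h w * (PA w * root_prod B w) - H a * (root_prod B w * k w) * (root_prod A w * PB w))%C
      with (root_prod A w * root_prod B w * (h w * PA w - H a * (k w * PB w)))%C by ring.
    rewrite Hconst by assumption. ring.
  - now replace (z - 0)%C with z by ring.
Qed.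

(** * Products of linear forms and reflections *)

Lemma entire_zero_of_circle (F : C -> C) (a : C) r :
  0 < r -> (forall z, cdiff F z) -> (forall z, circle a r z -> F z = 0) -> forall z, F z = 0.
Proof.
  intros Hr HF H0 z. pose proof (Cmod_ge_0 (z - a)).
  apply (identity_theorem F a a (Cmod (z - a) + 1) r); auto; [rewrite Cmod_sub_self; lra| |lra].
  intros w Hw. apply Cmod_eq_0. apply Rle_antisym; [|apply Cmod_ge_0].
  apply (max_mod F a r 0); auto; [|lra].
  intros x Hx. rewrite H0, Cmod_0; [lra|assumption].
Qed.

Lemma Lprod_wedge (X : list (C * C)) (x y : C) : y <> 0 ->
  cprod (map (fun t => wedge (x, y) t) X) = (y ^ length X * Lprod X (x / y))%C.
Proof.
  intros Hy. induction X as [|t X IH]; simpl; [unfold Lprod; simpl; ring|].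
  rewrite IH. unfold Lprod; simpl. unfold wedge, lf; simpl. field. assumption.
Qed.

(** Unique factorisation for products of linear forms in two variables; equal numbers of factors take care of the factors vanishing at infinity. *)
Lemma Lprod_eq_parallel (X Y : list (C * C)) :
  length X = length Y -> (forall z, Lprod X z = Lprod Y z) ->
  forall s, In s X -> exists t, In t Y /\ wedge s t = 0.
Proof.
  intros Hlen E.
  pose (W := fun (l : list (C * C)) s => cprod (map (fun t => wedge s t) l)).
  assert (HW : forall x y, W X (x, y) = W Y (x, y)).
  { intros x y. apply Csub_0_eq.
    (* The homogeneous polynomials agree when the second coordinate lies in the disc of radius [1]
       about [1], which avoids [0]; the identity theorem extends this to [0], the point at
       infinity. *)
    apply (identity_theorem (fun v => W X (x, v) - W Y (x, v))%C 0 1 (Cmod y + 2) 1); [| |lra| |].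
    - intros v _. apply cdiff_minus; apply (cdiff_cprod (fun t v => wedge (x, v) t));
        intros; unfold wedge; simpl; cdiff_auto.
    - replace (1 - 0)%C with (RtoC 1) by ring. rewrite Cmod_1. pose proof (Cmod_ge_0 y). lra.
    - intros v Hv. assert (Hv0 : v <> 0).
      { intros ->. rewrite Cmod_sub_comm in Hv. replace (1 - 0)%C with (RtoC 1) in Hv by ring.
        rewrite Cmod_1 in Hv. lra. }
      unfold W. rewrite !Lprod_wedge, Hlen, E by assumption. ring.
    - replace (y - 0)%C with y by ring. lra. }
  intros [x y] Hs.
  assert (H0 : W Y (x, y) = 0).
  { rewrite <- HW. apply cprod_in_0. apply in_map_iff. exists (x, y). split; [|assumption].
    unfold wedge; simpl. ring. }
  apply cprod_eq_0, in_map_iff in H0 as (t & Ht & Hin). now exists t.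
Qed.

Lemma Lprod_conj (d : C) r U z : 0 < r -> circle d r z ->
  (Cconj (Lprod U z) * (z - d) ^ length U = (- RtoC r) ^ length U * Lprod (map (refl d r) U) z)%C.
Proof.
  intros Hr Hz. induction U as [|s U IH].
  - unfold Lprod; simpl. rewrite Cconj_R. reflexivity.
  - change (Lprod (s :: U) z) with (lf s z * Lprod U z)%C.
    change (Lprod (map (refl d r) (s :: U)) z) with (lf (refl d r s) z * Lprod (map (refl d r) U) z)%C.
    simpl length. rewrite Cmult_conj, !Cpow_S.
    transitivity ((Cconj (lf s z) * (z - d)) * (Cconj (Lprod U z) * (z - d) ^ length U))%C; [ring|].
    rewrite IH, (lf_refl d r s z) by assumption. ring.
Qed.

(** Multiply each product by its conjugate and replace the conjugate by the product over reflected
    vectors. The two resulting polynomials agree on the circle, hence everywhere, and unique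
    factorisation applies. *)
Lemma Lprod_refl_circle (d : C) r (U V : list (C * C)) :
  0 < r -> length U = length V ->
  (forall z, circle d r z -> Cmod (Lprod U z) = Cmod (Lprod V z)) ->
  forall s, In s U -> exists t, In t (V ++ map (refl d r) V) /\ wedge s t = 0.
Proof.
  intros Hr Hlen H s Hs.
  apply (Lprod_eq_parallel (U ++ map (refl d r) U)); [now rewrite !length_app, !length_map, Hlen| |apply in_or_app; now left].
  intros z. rewrite !Lprod_app. apply Csub_0_eq. revert z.
  apply (entire_zero_of_circle
    (fun z => Lprod U z * Lprod (map (refl d r) U) z - Lprod V z * Lprod (map (refl d r) V) z)%C d r Hr).
  - intros z.
    pose proof (cdiff_Lprod U z). pose proof (cdiff_Lprod V z).
    pose proof (cdiff_Lprod (map (refl d r) U) z). pose proof (cdiff_Lprod (map (refl d r) V) z).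
    apply cdiff_minus; apply cdiff_mult; assumption.
  - intros z Hz.
    assert (E : (Lprod U z * Cconj (Lprod U z) = Lprod V z * Cconj (Lprod V z))%C)
      by (rewrite <- !Cmod2_conj, H by assumption; reflexivity).
    pose proof (Lprod_conj d r U z Hr Hz) as EU. pose proof (Lprod_conj d r V z Hr Hz) as EV.
    rewrite <- Hlen in EV. set (n := length U) in *.
    assert (Hn : ((- RtoC r) ^ n)%C <> 0).
    { apply Cpow_nz. intros E0. apply (RtoC_neq_0 r Hr).
      replace (RtoC r) with (- - RtoC r)%C by ring. rewrite E0. ring. }
    destruct (Ceq_dec (Lprod U z * Lprod (map (refl d r) U) z - Lprod V z * Lprod (map (refl d r) V) z) 0)
      as [|Hne]; [assumption|exfalso].
    apply (Cmult_neq_0 _ _ Hn Hne).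
    transitivity ((Lprod U z * ((- RtoC r) ^ n * Lprod (map (refl d r) U) z)
                  - Lprod V z * ((- RtoC r) ^ n * Lprod (map (refl d r) V) z))%C); [ring|].
    rewrite <- EU, <- EV.
    transitivity ((Lprod U z * Cconj (Lprod U z) - Lprod V z * Cconj (Lprod V z)) * (z - d) ^ n)%C; [ring|].
    rewrite E. ring.
Qed.

(** * Periodic points of the composition of two reflections *)

Definition vzero : C * C := (RtoC 0, RtoC 0).

Lemma wedge_trans (s t u : C * C) : t <> vzero -> wedge s t = 0 -> wedge t u = 0 -> wedge s u = 0.
Proof.
  destruct s as [s1 s2], t as [t1 t2], u as [u1 u2]. unfold wedge; simpl. intros Ht H1 H2.
  assert (E1 : (t1 * (s1 * u2 - s2 * u1) = 0)%C).
  { transitivity ((s1 * (t1 * u2 - t2 * u1) + u1 * (s1 * t2 - s2 * t1))%C); [ring|].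
    rewrite H1, H2. ring. }
  assert (E2 : (t2 * (s1 * u2 - s2 * u1) = 0)%C).
  { transitivity ((s2 * (t1 * u2 - t2 * u1) + u2 * (s1 * t2 - s2 * t1))%C); [ring|].
    rewrite H1, H2. ring. }
  destruct (Ceq_dec (s1 * u2 - s2 * u1) 0) as [|Hn]; [assumption|exfalso].
  destruct (Ceq_dec t1 0) as [->|N1]; [|now apply (Cmult_neq_0 _ _ N1 Hn)].
  destruct (Ceq_dec t2 0) as [->|N2]; [|now apply (Cmult_neq_0 _ _ N2 Hn)].
  now apply Ht.
Qed.

Lemma wedge_sym (s t : C * C) : wedge s t = 0 -> wedge t s = 0.
Proof. unfold wedge. intros H. transitivity (- (fst s * snd t - snd s * fst t))%C; [ring|]. rewrite H. ring. Qed.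

Lemma wedge_self (s : C * C) : wedge s s = 0.
Proof. unfold wedge. ring. Qed.

(** Composing the two reflections gives a linear map of determinant one and trace [tau]. *)
Definition rot (a1 : C) (r1 : R) (a2 : C) (r2 : R) (s : C * C) : C * C := refl a2 r2 (refl a1 r1 s).

(** By the law of cosines, [tau / 2] is the cosine of the angle between the two radii drawn to a
    common point. *)
Definition tau (a1 : C) (r1 : R) (a2 : C) (r2 : R) : R :=
  (r1 * r1 + r2 * r2 - Cmod (a2 - a1) * Cmod (a2 - a1)) / (r1 * r2).

Definition vcomb (c : C) (s : C * C) (e : C) (t : C * C) : C * C :=
  (c * fst s + e * fst t, c * snd s + e * snd t)%C.

Lemma rot_vcomb a1 r1 a2 r2 c s e t : 0 < r1 -> 0 < r2 ->
  rot a1 r1 a2 r2 (vcomb c s e t) = vcomb c (rot a1 r1 a2 r2 s) e (rot a1 r1 a2 r2 t).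
Proof.
  intros H1 H2. pose proof (RtoC_neq_0 r1 H1). pose proof (RtoC_neq_0 r2 H2).
  unfold rot, refl, vcomb; simpl. conj_push.
  apply injective_projections; simpl; field; auto.
Qed.

(** The Cayley-Hamilton identity for determinant one and trace [tau]. *)
Lemma rot_rot a1 r1 a2 r2 s : 0 < r1 -> 0 < r2 ->
  rot a1 r1 a2 r2 (rot a1 r1 a2 r2 s) =
  vcomb (RtoC (tau a1 r1 a2 r2)) (rot a1 r1 a2 r2 s) (RtoC (-1)) s.
Proof.
  intros H1 H2. pose proof (RtoC_neq_0 r1 H1) as N1. pose proof (RtoC_neq_0 r2 H2) as N2.
  assert (E : RtoC (tau a1 r1 a2 r2) =
    ((RtoC r1 * RtoC r1 + RtoC r2 * RtoC r2 - (a2 - a1) * (Cconj a2 - Cconj a1)) / (RtoC r1 * RtoC r2))%C).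
  { unfold tau. rewrite <- Cminus_conj, <- Cmod2_conj.
    rewrite RtoC_div by nra. rewrite RtoC_minus, RtoC_plus, !RtoC_mult. simpl. rewrite Rmult_1_r, RtoC_mult. reflexivity. }
  assert (Em : RtoC (-1) = (- (1))%C) by (apply injective_projections; simpl; ring).
  unfold vcomb. rewrite E, Em. unfold rot, refl; simpl. conj_push.
  apply injective_projections; simpl; field; auto.
Qed.

Lemma wedge_rot a1 r1 a2 r2 s t : 0 < r1 -> 0 < r2 ->
  wedge (rot a1 r1 a2 r2 s) (rot a1 r1 a2 r2 t) = wedge s t.
Proof.
  intros H1 H2. unfold rot. rewrite !wedge_refl by assumption.
  rewrite Copp_conj, Cconj_conj. ring.
Qed.

Lemma refl_neq_0 (d : C) r s : 0 < r -> s <> vzero -> refl d r s <> vzero.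
Proof.
  intros Hr Hs E. apply Hs. rewrite <- (refl_involutive d r s Hr), E.
  pose proof (RtoC_neq_0 r Hr).
  unfold refl, vzero; simpl. rewrite Cconj_R.
  apply injective_projections; simpl fst; simpl snd; field; assumption.
Qed.

(** [chebyshev t n] is the value at [t / 2] of the Chebyshev polynomial of the second kind of index [n - 1]. *)
Fixpoint chebyshev_pair (t : R) (n : nat) : R * R :=
  match n with
  | O => (0, 1)
  | S n => (snd (chebyshev_pair t n), t * snd (chebyshev_pair t n) - fst (chebyshev_pair t n))
  end.
Definition chebyshev (t : R) (n : nat) : R := fst (chebyshev_pair t n).

Lemma chebyshev_SS t n : chebyshev t (S (S n)) = t * chebyshev t (S n) - chebyshev t n.
Proof. reflexivity. Qed.

Lemma iter_rot a1 r1 a2 r2 s n : 0 < r1 -> 0 < r2 ->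
  Nat.iter (S n) (rot a1 r1 a2 r2) s =
  vcomb (RtoC (chebyshev (tau a1 r1 a2 r2) (S n))) (rot a1 r1 a2 r2 s)
        (RtoC (- chebyshev (tau a1 r1 a2 r2) n)) s.
Proof.
  intros H1 H2. induction n as [|n IH].
  - unfold vcomb; simpl. apply injective_projections; simpl fst; simpl snd; unfold chebyshev; simpl;
      rewrite Ropp_0; ring.
  - change (Nat.iter (S (S n)) (rot a1 r1 a2 r2) s)
      with (rot a1 r1 a2 r2 (Nat.iter (S n) (rot a1 r1 a2 r2) s)).
    rewrite IH, rot_vcomb, rot_rot, chebyshev_SS by assumption.
    set (t := tau a1 r1 a2 r2). set (u := rot a1 r1 a2 r2 s).
    unfold vcomb. rewrite !RtoC_opp, RtoC_minus, RtoC_mult.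
    apply injective_projections; simpl fst; simpl snd; ring.
Qed.

(** Off the fixed points the last factor is nonzero, so a point returns after [n] steps exactly when
    the Chebyshev value vanishes. *)
Lemma wedge_iter_rot a1 r1 a2 r2 s n : 0 < r1 -> 0 < r2 ->
  wedge s (Nat.iter n (rot a1 r1 a2 r2) s) =
  (RtoC (chebyshev (tau a1 r1 a2 r2) n) * wedge s (rot a1 r1 a2 r2 s))%C.
Proof.
  intros H1 H2. destruct n as [|n].
  - simpl. unfold chebyshev; simpl. rewrite wedge_self. ring.
  - rewrite iter_rot by assumption. unfold wedge, vcomb; simpl fst; simpl snd. ring.
Qed.

(** Preimages in [U], up to scaling, give a backward orbit of [s]. As [U] is finite, some [sg i]
    recurs; it is periodic, hence fixed because no Chebyshev value vanishes. Being an iterate of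
    [sg i] up to scaling, [s] represents the same fixed point. *)
Lemma eigenvectors_of_finite_invariant a1 r1 a2 r2 (U : list (C * C)) :
  0 < r1 -> 0 < r2 ->
  (forall n, (0 < n)%nat -> chebyshev (tau a1 r1 a2 r2) n <> 0) ->
  (forall s, In s U -> s <> vzero) ->
  (forall s, In s U -> exists u, In u U /\ wedge s (rot a1 r1 a2 r2 u) = 0) ->
  forall s, In s U -> wedge s (rot a1 r1 a2 r2 s) = 0.
Proof.
  intros H1 H2 Hp Hnz HU s Hs.
  set (N := rot a1 r1 a2 r2) in *.
  assert (HN0 : forall t, t <> vzero -> N t <> vzero)
    by (intros t Ht; apply refl_neq_0; [assumption|now apply refl_neq_0]).
  assert (HNk0 : forall k t, t <> vzero -> Nat.iter k N t <> vzero).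
  { induction k; intros t Ht; simpl; auto. }
  destruct (dependent_choice (fun n x => In x U /\ (n = 0%nat -> x = s)) (fun _ x y => wedge x (N y) = 0) s)
    as [sg Hsg].
  { split; auto. }
  { intros n x [Hx _]. destruct (HU x Hx) as [u [Hu Hw]]. exists u. repeat split; auto. discriminate. }
  assert (Hin : forall n, In (sg n) U) by (intros n; apply (Hsg n)).
  assert (H0 : sg 0%nat = s) by (apply (Hsg 0%nat); reflexivity).
  assert (Hk : forall k n, wedge (sg n) (Nat.iter k N (sg (n + k)%nat)) = 0).
  { induction k as [|k IH]; intros n.
    - rewrite Nat.add_0_r. apply wedge_self.
    - apply (wedge_trans _ (N (sg (S n)))); [apply HN0, Hnz, Hin|apply (Hsg n)|].
      simpl Nat.iter. unfold N at 1 2. rewrite wedge_rot by assumption.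
      replace (n + S k)%nat with (S n + k)%nat by lia. apply IH. }
  assert (Hrep : exists i k, sg i = sg (i + S k)%nat).
  { apply NNPP. intros Hno.
    assert (Hinj : forall i j, sg i = sg j -> i = j).
    { intros i j E. destruct (Nat.lt_trichotomy i j) as [L|[L|L]]; [|assumption|]; exfalso; apply Hno.
      - exists i, (j - i - 1)%nat. now replace (i + S (j - i - 1))%nat with j by lia.
      - exists j, (i - j - 1)%nat. now replace (j + S (i - j - 1))%nat with i by lia. }
    assert (ND : NoDup (map sg (seq 0 (S (length U))))).
    { apply Injective_map_NoDup; [exact Hinj|apply seq_NoDup]. }
    apply NoDup_incl_length with (l' := U) in ND.
    - rewrite length_map, length_seq in ND. lia.
    - intros x Hx. apply in_map_iff in Hx as [n [<- _]]. apply Hin. }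
  destruct Hrep as [i [k E]].
  assert (Hi : wedge (sg i) (N (sg i)) = 0).
  { pose proof (Hk (S k) i) as W. rewrite <- E in W. unfold N in W.
    rewrite wedge_iter_rot in W by assumption. fold N in W.
    destruct (Ceq_dec (wedge (sg i) (N (sg i))) 0) as [|Hn]; [assumption|exfalso].
    refine (Cmult_neq_0 _ _ _ Hn W). intros Z. apply RtoC_inj in Z. apply (Hp (S k)); [lia|assumption]. }
  set (t := sg i) in *.
  assert (Ht : t <> vzero) by (apply Hnz, Hin).
  assert (Hst : wedge s t = 0).
  { pose proof (Hk i 0%nat) as W. rewrite H0 in W. simpl in W. fold t in W.
    apply (wedge_trans _ (Nat.iter i N t)); [now apply HNk0|assumption|].
    apply wedge_sym. unfold N. rewrite wedge_iter_rot by assumption. fold N. rewrite Hi. ring. }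
  apply (wedge_trans _ t); [assumption|assumption|].
  apply (wedge_trans _ (N t)); [now apply HN0|assumption|].
  unfold N. rewrite wedge_rot by assumption. now apply wedge_sym.
Qed.

Lemma refl_self_not_parallel_emb (d x x' : C) r : 0 < r -> Cmod (x - d) < r -> Cmod (x' - d) < r ->
  wedge (emb x) (refl d r (emb x')) <> 0.
Proof.
  intros Hr Hx Hx' E. apply (lf_refl_emb_neq_0 d x' x r); try assumption; [lra|].
  transitivity (wedge (emb x) (refl d r (emb x'))); [|assumption].
  unfold wedge, lf, emb; simpl. ring.
Qed.

(** No zero coincides with a pole: on the same side of the circle because [A] and [B] are disjoint,
    on opposite sides because the circle separates them. *)
Lemma zero_pole_disjoint (d : C) r (A B : list C) : 0 < r ->
  (forall x, In x A -> Cmod (x - d) < r) -> (forall x, In x B -> Cmod (x - d) < r) ->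
  (forall x, In x A -> ~ In x B) ->
  forall s t, In s (zero_pole_vectors d r A B) -> In t (map (refl d r) (zero_pole_vectors d r A B)) ->
    wedge s t <> 0.
Proof.
  intros Hr HA HB Hdis s t Hs Ht.
  assert (Emb : forall x y, wedge (emb x) (emb y) = 0 -> x = y).
  { intros x y E. apply Csub_0_eq. rewrite <- E. unfold wedge, emb; simpl. ring. }
  assert (Refl : forall s t, wedge (refl d r s) (refl d r t) = 0 -> wedge s t = 0).
  { intros u v E. rewrite wedge_refl in E by assumption.
    rewrite <- (Cconj_conj (wedge u v)). replace (Cconj (wedge u v)) with (- - Cconj (wedge u v))%C by ring.
    rewrite E. rewrite Copp_conj, Cconj_R. ring. }
  rewrite map_refl_zero_pole_vectors in Ht by assumption.
  unfold zero_pole_vectors in Hs. rewrite !map_map in *.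
  apply in_app_or in Hs as [Hs|Hs]; apply in_map_iff in Hs as (x & <- & Hx);
  apply in_app_or in Ht as [Ht|Ht]; apply in_map_iff in Ht as (y & <- & Hy); intros E.
  - revert E. apply refl_self_not_parallel_emb; auto.
  - apply Emb in E. subst. now apply (Hdis y).
  - apply Refl, Emb in E. subst. now apply (Hdis y).
  - apply wedge_sym in E. revert E. apply refl_self_not_parallel_emb; auto.
Qed.

Lemma emb_neq_0 x : emb x <> vzero.
Proof. intros E. apply (f_equal snd) in E. simpl in E. apply RtoC_inj in E. lra. Qed.

(** By the second circle a zero is parallel to a pole, which is excluded, or to a reflected pole,
    which is the image under [rot] of a zero. So the zeros [U] form a finite invariant set. The same
    holds for the poles [V], which contain the vectors of [B]. *)
Lemma zero_pole_eigenvectors (A B : list C) (a1 : C) r1 (a2 : C) r2 : 0 < r1 -> 0 < r2 ->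
  (forall n, (0 < n)%nat -> chebyshev (tau a1 r1 a2 r2) n <> 0) ->
  (forall x, In x A -> Cmod (x - a1) < r1) -> (forall x, In x B -> Cmod (x - a1) < r1) ->
  (forall x, In x A -> ~ In x B) ->
  (forall z, circle a2 r2 z ->
     Cmod (Lprod (zero_pole_vectors a1 r1 A B) z) =
     Cmod (Lprod (map (refl a1 r1) (zero_pole_vectors a1 r1 A B)) z)) ->
  forall x, In x A \/ In x B -> wedge (emb x) (rot a1 r1 a2 r2 (emb x)) = 0.
Proof.
  intros H1 H2 Hp HA HB Hdis H.
  pose proof (zero_pole_disjoint a1 r1 A B H1 HA HB Hdis) as Hpar.
  set (U := zero_pole_vectors a1 r1 A B) in *. set (V := map (refl a1 r1) U) in *.
  assert (Hlen : length U = length V) by (unfold V; now rewrite length_map).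
  assert (EV : map (refl a1 r1) V = U).
  { unfold V. rewrite map_map. rewrite <- (map_id U) at 2. apply map_ext. intros. now apply refl_involutive. }
  assert (UNZ : forall s, In s U -> s <> vzero).
  { intros s Hs. unfold U, zero_pole_vectors in Hs. rewrite map_map in Hs.
    apply in_app_or in Hs as [Hs|Hs]; apply in_map_iff in Hs as (x & <- & Hx);
      [apply emb_neq_0|apply refl_neq_0; [assumption|apply emb_neq_0]]. }
  assert (VNZ : forall s, In s V -> s <> vzero).
  { intros s Hs. apply in_map_iff in Hs as (u & <- & Hu). apply refl_neq_0; auto. }
  intros x [Hx|Hx].
  - apply (eigenvectors_of_finite_invariant a1 r1 a2 r2 U); auto.
    + intros s Hs. destruct (Lprod_refl_circle a2 r2 U V H2 Hlen H s Hs) as [t [Ht Hw]].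
      apply in_app_or in Ht as [Ht|Ht]; [now destruct (Hpar s t Hs Ht)|].
      unfold V in Ht. rewrite map_map in Ht. apply in_map_iff in Ht as (u & <- & Hu). now exists u.
    + unfold U, zero_pole_vectors. apply in_or_app. left. now apply in_map.
  - apply (eigenvectors_of_finite_invariant a1 r1 a2 r2 V); auto.
    + intros s Hs.
      destruct (Lprod_refl_circle a2 r2 V U H2 (eq_sym Hlen)) with (s := s) as [t [Ht Hw]]; auto.
      { intros z Hz. symmetry. now apply H. }
      apply in_app_or in Ht as [Ht|Ht]; [apply wedge_sym in Hw; now destruct (Hpar t s Ht Hs)|].
      rewrite <- EV, map_map in Ht. apply in_map_iff in Ht as (u & <- & Hu). now exists u.
    + unfold V, U. rewrite map_refl_zero_pole_vectors by assumption. apply in_or_app. right. now apply in_map.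
Qed.

(** Measured from [a1], fixed points are roots of [P]. For [d <> 0] two distinct roots have product
    of modulus [r1^2], too large for interior points; for [d = 0] only the linear term remains, and
    it is nonzero since the radii differ. *)
Lemma fixed_point_unique (a1 : C) r1 (a2 : C) r2 (x y : C) : 0 < r1 -> 0 < r2 ->
  (a1 = a2 -> r1 <> r2) -> Cmod (x - a1) < r1 -> Cmod (y - a1) < r1 ->
  wedge (emb x) (rot a1 r1 a2 r2 (emb x)) = 0 -> wedge (emb y) (rot a1 r1 a2 r2 (emb y)) = 0 -> x = y.
Proof.
  intros H1 H2 Hne Hx Hy Ex Ey.
  pose proof (RtoC_neq_0 r1 H1) as N1. pose proof (RtoC_neq_0 r2 H2) as N2.
  set (d := (a2 - a1)%C). set (b := (RtoC r2 * RtoC r2 - d * Cconj d - RtoC r1 * RtoC r1)%C).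
  set (P := fun u : C => (Cconj d * (u * u) + b * u + d * (RtoC r1 * RtoC r1))%C).
  assert (HP : forall u, wedge (emb u) (rot a1 r1 a2 r2 (emb u)) = 0 -> P (u - a1)%C = 0).
  { intros u Hu.
    transitivity (- RtoC r1 * RtoC r2 * wedge (emb u) (rot a1 r1 a2 r2 (emb u)))%C; [|rewrite Hu; ring].
    unfold P, b, d, wedge, rot, refl, emb; simpl. conj_push. field. auto. }
  apply HP in Ex. apply HP in Ey.
  set (u := (x - a1)%C) in *. set (v := (y - a1)%C) in *.
  destruct (Ceq_dec u v) as [E|Hn].
  { replace x with (u + a1)%C by (unfold u; ring). rewrite E. unfold v. ring. }
  exfalso.
  assert (Huv : (u - v)%C <> 0) by now apply Csub_neq_0.
  assert (S1 : (Cconj d * (u + v) + b = 0)%C).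
  { destruct (Ceq_dec (Cconj d * (u + v) + b) 0) as [|Hz]; [assumption|exfalso].
    apply (Cmult_neq_0 _ _ Huv Hz). transitivity (P u - P v)%C; [unfold P; ring|]. rewrite Ex, Ey. ring. }
  assert (S2 : (Cconj d * (u * v) = d * (RtoC r1 * RtoC r1))%C).
  { apply Csub_0_eq. transitivity (u * (Cconj d * (u + v) + b) - P u)%C; [unfold P; ring|].
    rewrite S1, Ex. ring. }
  destruct (Ceq_dec d 0) as [Hd|Hd].
  - apply Hne.
    + symmetry. apply Csub_0_eq. exact Hd.
    + unfold b in S1. rewrite Hd in S1. rewrite Cconj_R in S1.
      assert (E : (RtoC (r2 * r2 - r1 * r1) = 0)%C) by (rewrite RtoC_minus, !RtoC_mult, <- S1; ring).
      apply RtoC_inj in E. nra.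
  - apply (f_equal Cmod) in S2. rewrite !Cmod_mult, Cmod_conj, Cmod_R, Rabs_pos_eq in S2 by lra.
    apply Rmult_eq_reg_l in S2; [|now apply Rgt_not_eq, Cmod_gt_0].
    pose proof (Cmod_ge_0 u). pose proof (Cmod_ge_0 v). nra.
Qed.

(** * Rigidity and sharpness *)

(** The circle is tested at its point farthest from the origin. The bound places the closed disc in
    the unit disc as well. *)
Lemma circle_in_D_bound a r : circle_in_D a r -> Cmod a + r < 1.
Proof.
  intros [Hr H]. unfold circle, unit_disc in H.
  destruct (Ceq_dec a 0) as [->|Ha].
  - specialize (H (RtoC r)). replace (RtoC r - 0)%C with (RtoC r) in H by ring.
    rewrite Cmod_R, Rabs_pos_eq in H by lra. rewrite Cmod_0. specialize (H eq_refl). lra.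
  - pose proof (proj1 (Cmod_gt_0 _) Ha) as Hp.
    assert (E : RtoC (1 + r / Cmod a) = (1 + RtoC (r / Cmod a))%C) by apply RtoC_plus.
    assert (Hq : 0 < r / Cmod a) by now apply Rdiv_lt_0_compat.
    specialize (H (a * RtoC (1 + r / Cmod a))%C).
    replace (a * RtoC (1 + r / Cmod a) - a)%C with (a * RtoC (r / Cmod a))%C in H by (rewrite E; ring).
    rewrite !Cmod_mult, !Cmod_R, !Rabs_pos_eq in H by lra.
    replace (Cmod a * (r / Cmod a)) with r in H by (field; lra).
    replace (Cmod a * (1 + r / Cmod a)) with (Cmod a + r) in H by (field; lra). auto.
Qed.

Lemma circle_point a r : 0 < r -> circle a r (a + RtoC r)%C.
Proof.
  intros Hr. unfold circle. replace (a + r - a)%C with (RtoC r) by ring. rewrite Cmod_R, Rabs_pos_eq; lra.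
Qed.

Lemma holo_zero_of_circle (f : C -> C) a r :
  holo f -> 0 < r -> Cmod a + r < 1 -> (forall z, circle a r z -> f z = 0) ->
  forall z, Cmod z < 1 -> f z = 0.
Proof.
  intros Hf Hr Har H0 z Hz. pose proof (Cmod_ge_0 a).
  assert (Hin : forall w, Cmod (w - a) <= r -> Cmod w < 1).
  { intros w Hw. pose proof (Cmod_sub_ge w a). lra. }
  apply (identity_theorem f 0 a 1 r); [| |assumption| |].
  - intros w Hw. apply Hf. now replace (w - 0)%C with w in Hw by ring.
  - replace (a - 0)%C with a by ring. lra.
  - intros w Hw. apply Cmod_eq_0. apply Rle_antisym; [|apply Cmod_ge_0].
    apply (max_mod f a r 0); auto; [|lra]. intros x Hx. rewrite H0, Cmod_0; [lra|assumption].
  - now replace (z - 0)%C with z by ring.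
Qed.

Lemma cprod_map_const {A} (F : A -> C) (l : list A) x :
  (forall y, In y l -> y = x) -> cprod (map F l) = (F x ^ length l)%C.
Proof.
  induction l as [|y l IH]; intros H; simpl; [reflexivity|].
  rewrite (H y) by now left. rewrite IH; [reflexivity|]. intros w Hw. apply H. now right.
Qed.

Lemma pow_inj_pos (x y : R) n : 0 <= x -> 0 <= y -> x ^ S n = y ^ S n -> x = y.
Proof.
  assert (L : forall a b, 0 <= a -> a < b -> a ^ S n < b ^ S n).
  { intros a b Ha Hab. induction n as [|m IH]; [simpl; lra|].
    rewrite <- (tech_pow_Rmult a), <- (tech_pow_Rmult b).
    assert (0 <= a ^ S m) by (now apply pow_le).
    apply Rmult_le_0_lt_compat; assumption. }
  intros Hx Hy E. destruct (Rtotal_order x y) as [H|[H|H]]; [|assumption|].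
  - pose proof (L x y Hx H). lra.
  - pose proof (L y x Hy H). lra.
Qed.

(** Equality makes the right side of [bden_identity] vanish, and its first factor is positive for
    [x] inside. *)
Lemma on_circle_of_equal_forms (a : C) r x z : 0 < r -> Cmod (x - a) < r ->
  Cmod (lf (refl a r (emb x)) z) = Cmod (lf (emb x) z) -> circle a r z.
Proof.
  intros Hr Hx E. pose proof (RtoC_neq_0 r Hr).
  pose proof (bden_identity r (x - a) (z - a)) as I.
  replace (bden r (x - a) (z - a)) with (- RtoC r * lf (refl a r (emb x)) z)%C in I.
  2:{ unfold bden, lf, refl, emb; simpl. rewrite Cminus_conj, RtoC_mult, Cconj_R. field. assumption. }
  rewrite Cmod_mult, Cmod_opp, Cmod_R, Rabs_pos_eq, E, lf_emb in I by lra.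
  replace (z - a - (x - a))%C with (z - x)%C in I by ring.
  pose proof (Cmod_ge_0 (x - a)). pose proof (Cmod_ge_0 (z - a)).
  assert (0 < r * r - Cmod (x - a) * Cmod (x - a)) by nra.
  assert (r * r - Cmod (z - a) * Cmod (z - a) = 0) by nra.
  unfold circle. nra.
Qed.

Lemma circle_subset_eq a1 r1 a2 r2 : 0 < r1 -> 0 < r2 ->
  (forall z, circle a2 r2 z -> circle a1 r1 z) -> a1 = a2 /\ r1 = r2.
Proof.
  intros H1 H2 H. unfold circle in H.
  assert (Q : forall u v, u * u + v * v = r2 * r2 ->
    (fst a2 - fst a1 + u) * (fst a2 - fst a1 + u) + (snd a2 - snd a1 + v) * (snd a2 - snd a1 + v) = r1 * r1).
  { intros u v Huv. pose (w := ((u, v) : C)). specialize (H (a2 + w)%C).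
    replace (a2 + w - a2)%C with w in H by ring.
    rewrite <- H by (apply Cmod_eq_sqr; simpl; lra).
    rewrite Cmod_sqr; simpl. ring. }
  pose proof (Q r2 0 ltac:(ring)). pose proof (Q (- r2) 0 ltac:(ring)).
  pose proof (Q 0 r2 ltac:(ring)). pose proof (Q 0 (- r2) ltac:(ring)).
  assert (X : fst a2 - fst a1 = 0).
  { apply Rmult_eq_reg_r with (4 * r2); [|lra]. lra. }
  assert (Y : snd a2 - snd a1 = 0).
  { apply Rmult_eq_reg_r with (4 * r2); [|lra]. lra. }
  split; [apply injective_projections; lra|]. rewrite X, Y in *. nra.
Qed.

Lemma root_prod_in (A : list C) x : In x A -> root_prod A x = 0.
Proof.
  intros Hx. apply cprod_in_0. apply in_map_iff. exists x. split; [ring|assumption].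
Qed.

(** The relative position of the circles enters through the Chebyshev hypothesis, which excludes
    periodic points other than fixed ones; this treats all rigid cases together. *)
Lemma rigidity (f g : C -> C) a1 r1 a2 r2 :
  holo f -> holo g -> circle_in_D a1 r1 -> circle_in_D a2 r2 ->
  circle a1 r1 <> circle a2 r2 -> eq_mod_on_circles f g a1 r1 a2 r2 ->
  (forall n, (0 < n)%nat -> chebyshev (tau a1 r1 a2 r2) n <> 0) ->
  unimodular_multiple f g.
Proof.
  intros Hf Hg D1 D2 Hne Heq Hp.
  pose proof (circle_in_D_bound _ _ D1) as B1. pose proof (circle_in_D_bound _ _ D2) as B2.
  destruct D1 as [H1 _], D2 as [H2 _]. pose proof (Cmod_ge_0 a1). pose proof (Cmod_ge_0 a2).
  assert (NE : ~ (a1 = a2 /\ r1 = r2)) by (intros [-> ->]; now apply Hne).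
  destruct (classic (exists z0, Cmod z0 < 1 /\ f z0 <> 0)) as [[z0 [Hz0 Hfz0]]|Hzero].
  2:{ exists (RtoC 1). split; [apply Cmod_1|].
      assert (F0 : forall z, Cmod z < 1 -> f z = 0).
      { intros z Hz. apply NNPP. intros Hn. apply Hzero. now exists z. }
      intros z Hz. unfold unit_disc in Hz. rewrite F0 by assumption.
      rewrite (holo_zero_of_circle g a1 r1); auto; [ring|].
      intros w Hw. apply Cmod_eq_0. rewrite <- (Heq w) by now left.
      rewrite F0, Cmod_0; [reflexivity|]. unfold circle in Hw. pose proof (Cmod_sub_ge w a1). lra. }
  set (rho := Rmax (Cmod a1 + r1) (Cmod a2 + r2)).
  assert (Hr1 : Cmod a1 + r1 <= rho) by apply Rmax_l.
  assert (Hr2 : Cmod a2 + r2 <= rho) by apply Rmax_r.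
  assert (Hrho : rho < 1) by (apply Rmax_lub_lt; assumption).
  assert (C1 : forall z, Cmod (z - a1) <= r1 -> Cmod z <= rho).
  { intros z Hz. pose proof (Cmod_sub_ge z a1). lra. }
  assert (C2 : forall z, Cmod (z - a2) <= r2 -> Cmod z <= rho).
  { intros z Hz. pose proof (Cmod_sub_ge z a2). lra. }
  (* Once common zeros in both closed discs are removed, equality of moduli leaves no zero on the
     circles, and zeros of [f1] and [g1] are disjoint. *)
  destruct (remove_common_zeros f g (fun z => Cmod (z - a1) <= r1 \/ Cmod (z - a2) <= r2) z0 rho Hf Hg Hz0 Hfz0 Hrho)
    as (S & f1 & g1 & Hf1 & Hg1 & Ef & Eg & Hcom).
  { intros z [Hz|Hz]; auto. }
  assert (M1 : forall z, circle a1 r1 z -> Cmod (f1 z) = Cmod (g1 z)).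
  { apply (Cmod_eq_divide_root_prod S f1 g1 a1 r1 H1).
    - intros z Hz. assert (Cmod z < 1) by (unfold circle in Hz; specialize (C1 z); lra). auto.
    - intros z Hz. rewrite <- Ef, <- Eg. apply Heq. now left. }
  assert (M2 : forall z, circle a2 r2 z -> Cmod (f1 z) = Cmod (g1 z)).
  { apply (Cmod_eq_divide_root_prod S f1 g1 a2 r2 H2).
    - intros z Hz. assert (Cmod z < 1) by (unfold circle in Hz; specialize (C2 z); lra). auto.
    - intros z Hz. rewrite <- Ef, <- Eg. apply Heq. now right. }
  assert (NZ : forall z, circle a1 r1 z \/ circle a2 r2 z -> f1 z <> 0 /\ g1 z <> 0).
  { intros z Hz. assert (E : Cmod (f1 z) = Cmod (g1 z)) by (destruct Hz; auto).
    assert (HX : Cmod (z - a1) <= r1 \/ Cmod (z - a2) <= r2) by (unfold circle in Hz; destruct Hz; [left|right]; lra).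
    specialize (Hcom z HX).
    assert (Hf1z : f1 z <> 0).
    { intros Z. apply (Hcom Z). apply Cmod_eq_0. rewrite <- E, Z. apply Cmod_0. }
    split; [assumption|]. intros Z. apply Hf1z, Cmod_eq_0. rewrite E, Z. apply Cmod_0. }
  set (p := (a1 + RtoC r1)%C).
  assert (Hpc : circle a1 r1 p) by now apply circle_point.
  assert (HpD : Cmod p < 1) by (specialize (C1 p); unfold circle in Hpc; lra).
  destruct (NZ p ltac:(now left)) as [Np1 Np2].
  destruct (factor_zeros f1 (fun z => Cmod (z - a1) <= r1) p rho Hf1 HpD Np1 Hrho C1)
    as (A & h & HA & Hh & EA & Hh0).
  destruct (factor_zeros g1 (fun z => Cmod (z - a1) <= r1) p rho Hg1 HpD Np2 Hrho C1)
    as (B & k & HB & Hk & EB & Hk0).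
  assert (ZA : forall x, In x A -> f1 x = 0) by (intros x Hx; rewrite EA, root_prod_in; [ring|assumption]).
  assert (ZB : forall x, In x B -> g1 x = 0) by (intros x Hx; rewrite EB, root_prod_in; [ring|assumption]).
  assert (HA' : forall x, In x A -> Cmod (x - a1) < r1).
  { intros x Hx. destruct (HA x Hx) as [|E]; [assumption|]. exfalso. apply (proj1 (NZ x (or_introl E))). auto. }
  assert (HB' : forall x, In x B -> Cmod (x - a1) < r1).
  { intros x Hx. destruct (HB x Hx) as [|E]; [assumption|]. exfalso. apply (proj2 (NZ x (or_introl E))). auto. }
  assert (Hdis : forall x, In x A -> ~ In x B).
  { intros x Hx Hx'. apply (Hcom x); auto. }
  destruct (quotient_of_blaschke f1 g1 h k A B a1 r1) as [c [Hc Ec]]; auto.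
  { intros z Hz. specialize (C1 z Hz). lra. }
  assert (HL : forall z, circle a2 r2 z ->
     Cmod (Lprod (zero_pole_vectors a1 r1 A B) z) =
     Cmod (Lprod (map (refl a1 r1) (zero_pole_vectors a1 r1 A B)) z)).
  { intros z Hz. assert (Hz1 : Cmod z < 1) by (specialize (C2 z); unfold circle in Hz; lra).
    pose proof (f_equal Cmod (Ec z Hz1)) as E. rewrite !Cmod_mult, Hc, (M2 z Hz) in E.
    destruct (NZ z ltac:(now right)) as [_ N2]. apply Cmod_gt_0 in N2.
    apply Rmult_eq_reg_l with (Cmod (g1 z)); lra. }
  pose proof (zero_pole_eigenvectors A B a1 r1 a2 r2 H1 H2 Hp HA' HB' Hdis HL) as Heig.
  assert (Huniq : forall x y, In x A \/ In x B -> In y A \/ In y B -> x = y).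
  { intros x y Hx Hy. apply (fixed_point_unique a1 r1 a2 r2); auto.
    - destruct Hx; auto.
    - destruct Hy; auto. }
  assert (Hcircle : forall x l, (forall y, In y (x :: l) -> y = x) -> Cmod (x - a1) < r1 ->
     (forall z, circle a2 r2 z ->
        Cmod (Lprod (map (refl a1 r1) (map emb (x :: l))) z) = Cmod (Lprod (map emb (x :: l)) z)) -> False).
  { intros x l Hl Hx E. apply NE. apply circle_subset_eq; auto.
    intros z Hz. apply (on_circle_of_equal_forms a1 r1 x z H1 Hx). specialize (E z Hz).
    unfold Lprod in E. rewrite !map_map, !(cprod_map_const _ (x :: l) x), !Cmod_pow in E by assumption.
    apply pow_inj_pos in E; auto using Cmod_ge_0. }
  unfold zero_pole_vectors in Ec, HL.
  (* [A] and [B] cannot both be nonempty, since the unique fixed point would be a common zero; a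
     single nonempty list is refuted by [Hcircle]. *)
  destruct A as [|x A].
  - destruct B as [|x B].
    + exists c. split; [assumption|]. intros z Hz. specialize (Ec z Hz).
      unfold Lprod in Ec; simpl in Ec. rewrite !Cmult_1_r in Ec. rewrite Ef, Eg, Ec. ring.
    + exfalso. apply (Hcircle x B).
      * intros y Hy. apply Huniq; right; [assumption|now left].
      * apply HB'. now left.
      * intros z Hz. specialize (HL z Hz).
        transitivity (Cmod (Lprod (map (refl a1 r1) (map (refl a1 r1) (map emb (x :: B)))) z)); [exact HL|].
        f_equal. f_equal. rewrite map_map. rewrite <- (map_id (map emb (x :: B))) at 2.
        apply map_ext. intros s. now apply refl_involutive.
  - destruct B as [|y B].
    + exfalso. apply (Hcircle x A).
      * intros y Hy. apply Huniq; left; [assumption|now left].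
      * apply HA'. now left.
      * intros z Hz. specialize (HL z Hz).
        change (map (refl a1 r1) (map emb nil)) with (@nil (C * C)) in HL. rewrite app_nil_r in HL.
        symmetry. exact HL.
    + exfalso. assert (x = y) by (apply Huniq; [left|right]; now left). subst y.
      apply (Hdis x); now left.
Qed.

(** * Chebyshev values and the position of the circles *)

(** For [|t| >= 2] the recursion makes the absolute values nondecreasing from [0, 1] on; tangent
    circles are the borderline [|t| = 2]. *)
Lemma chebyshev_neq_0_of_large t : 2 <= Rabs t -> forall n, (0 < n)%nat -> chebyshev t n <> 0.
Proof.
  intros Ht.
  assert (H : forall n, Rabs (chebyshev t n) <= Rabs (chebyshev t (S n)) /\ 0 < Rabs (chebyshev t (S n))).
  { induction n as [|n [IH1 IH2]].
    - unfold chebyshev; simpl. rewrite Rabs_R0, Rabs_R1. lra.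
    - rewrite chebyshev_SS.
      pose proof (Rabs_triang_inv (t * chebyshev t (S n)) (chebyshev t n)) as T.
      rewrite Rabs_mult in T.
      assert (2 * Rabs (chebyshev t (S n)) <= Rabs t * Rabs (chebyshev t (S n))) by (apply Rmult_le_compat_r; lra).
      lra. }
  intros [|n] Hn; [lia|]. destruct (H n) as [_ Hp]. intros E. rewrite E, Rabs_R0 in Hp. lra.
Qed.

Lemma chebyshev_sin phi n : chebyshev (2 * cos phi) n * sin phi = sin (INR n * phi).
Proof.
  assert (H : chebyshev (2 * cos phi) n * sin phi = sin (INR n * phi) /\
              chebyshev (2 * cos phi) (S n) * sin phi = sin (INR (S n) * phi)).
  { induction n as [|n [IH1 IH2]].
    - unfold chebyshev; simpl. rewrite !Rmult_0_l, !Rmult_1_l, sin_0. lra.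
    - split; [assumption|]. rewrite chebyshev_SS, Rmult_minus_distr_r.
      replace (2 * cos phi * chebyshev (2 * cos phi) (S n) * sin phi)
        with (2 * cos phi * (chebyshev (2 * cos phi) (S n) * sin phi)) by ring.
      rewrite IH1, IH2.
      replace (INR (S (S n)) * phi) with (INR (S n) * phi + phi) by (rewrite !S_INR; ring).
      replace (INR n * phi) with (INR (S n) * phi - phi) by (rewrite !S_INR; ring).
      rewrite sin_plus, sin_minus. ring. }
  apply H.
Qed.

Lemma INR_Pos p : INR (Pos.to_nat p) = IZR (Zpos p).
Proof. rewrite INR_IZR_INZ. f_equal. apply Znat.positive_nat_Z. Qed.

Lemma rational_of_sin_0 phi n : (0 < n)%nat -> sin (INR n * phi) = 0 -> rational_multiple_of_pi phi.
Proof.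
  intros Hn H. apply sin_eq_0_0 in H as [k Hk].
  exists (Qmake k (Pos.of_nat n)). unfold Q2R; simpl.
  rewrite <- INR_Pos, Nat2Pos.id by lia.
  assert (0 < INR n) by (now apply lt_0_INR).
  apply Rmult_eq_reg_l with (INR n); [|lra]. rewrite Hk. field. lra.
Qed.

(** As only [|t|] is given, [t] is twice the cosine of [phi] or of [PI - phi]. A zero value would
    make that angle, hence [phi], a rational multiple of [PI]. *)
Lemma chebyshev_neq_0_of_irrational phi :
  0 < phi <= PI / 2 -> ~ rational_multiple_of_pi phi ->
  forall t n, Rabs t = 2 * cos phi -> (0 < n)%nat -> chebyshev t n <> 0.
Proof.
  intros Hphi Hirr t n Ht Hn E. pose proof PI_RGT_0.
  unfold Rabs in Ht. destruct (Rcase_abs t).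
  - apply Hirr.
    assert (Ht' : t = 2 * cos (PI - phi)) by (rewrite cos_minus, cos_PI, sin_PI; lra).
    rewrite Ht' in E. pose proof (chebyshev_sin (PI - phi) n) as S. rewrite E, Rmult_0_l in S.
    destruct (rational_of_sin_0 (PI - phi) n Hn (eq_sym S)) as [q Hq].
    exists (1 - q)%Q. rewrite Q2R_minus. unfold Q2R at 1; simpl. lra.
  - apply Hirr. apply (rational_of_sin_0 phi n Hn). rewrite <- chebyshev_sin, <- Ht, E. ring.
Qed.

Lemma two_intersections a1 r1 a2 r2 : 0 < r1 -> 0 < r2 -> Rabs (tau a1 r1 a2 r2) < 2 ->
  exists p q, p <> q /\ inter a1 r1 a2 r2 p /\ inter a1 r1 a2 r2 q.
Proof.
  intros H1 H2 Ht. unfold tau in Ht.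
  assert (Hr : 0 < r1 * r2) by (apply Rmult_lt_0_compat; lra).
  set (d := (a2 - a1)%C) in *. set (D := Cmod d * Cmod d) in *.
  assert (Hs : Rabs (r1 * r1 + r2 * r2 - D) < 2 * (r1 * r2)).
  { unfold Rdiv in Ht. rewrite Rabs_mult, Rabs_inv, (Rabs_pos_eq (r1 * r2)) in Ht by lra.
    apply (Rlt_div_l _ _ _ Hr) in Ht. exact Ht. }
  apply Rabs_lt_between in Hs.
  assert (HD : 0 < D) by (pose proof (Rle_0_sqr (r1 - r2)) as T; unfold Rsqr in T; lra).
  (* In units of [d] from [a1], the radical axis meets the line of centres at [t], and [e] is the
     square of half the common chord. It is positive because [4 * D^2 * e = 4 * r1^2 * r2^2 - (r1^2
     + r2^2 - D)^2]. *)
  set (t := (r1 * r1 - r2 * r2 + D) / (2 * D)).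
  assert (Et : 2 * D * t = r1 * r1 - r2 * r2 + D) by (unfold t; field; lra).
  set (e := r1 * r1 / D - t * t).
  assert (Ee : D * e = r1 * r1 - D * (t * t)) by (unfold e; field; lra).
  assert (He : 0 < e).
  { assert (0 < 4 * (D * D) * e).
    { replace (4 * (D * D) * e) with (4 * D * (r1 * r1) - (2 * D * t) * (2 * D * t)) by (rewrite <- Rmult_assoc in Ee; nra).
      rewrite Et. nra. }
    nra. }
  pose proof (sqrt_lt_R0 e He) as Hse. pose proof (sqrt_sqrt e ltac:(lra)) as Ese.
  set (s := sqrt e) in *.
  pose (w := fun u : R => ((t, u) : C)).
  assert (Hin : forall u, u * u = e -> inter a1 r1 a2 r2 (a1 + d * w u)%C).
  { intros u Hu. split; unfold circle; apply Cmod_eq_sqr; try lra.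
    - replace (a1 + d * w u - a1)%C with (d * w u)%C by ring.
      rewrite <- Cmod_sqr, Cmod_mult.
      transitivity (D * (Cmod (w u) * Cmod (w u))); [unfold D; ring|].
      rewrite Cmod_sqr. simpl. rewrite Hu. lra.
    - replace (a1 + d * w u - a2)%C with (d * (w u - 1))%C by (unfold d; ring).
      rewrite <- Cmod_sqr, Cmod_mult.
      transitivity (D * (Cmod (w u - 1) * Cmod (w u - 1))); [unfold D; ring|].
      rewrite Cmod_sqr. simpl.
      transitivity (D * (t * t) + D * (u * u) - 2 * D * t + D); [ring|].
      rewrite Hu, Et. lra. }
  exists (a1 + d * w s)%C, (a1 + d * w (- s)%R)%C.
  split; [|split; apply Hin; lra].
  intros E.
  assert (E' : (d * (w s - w (- s)%R) = 0)%C).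
  { transitivity ((a1 + d * w s) - (a1 + d * w (- s)%R))%C; [ring|]. rewrite E. ring. }
  apply (f_equal Cmod) in E'. rewrite Cmod_mult, Cmod_0 in E'.
  replace (Cmod (w s - w (- s)%R)) with (2 * s) in E'.
  - assert (Cmod d <> 0) by (intros Z; unfold D in HD; rewrite Z in HD; lra).
    pose proof (Cmod_ge_0 d). nra.
  - symmetry. apply Cmod_eq_sqr; simpl; [lra|ring].
Qed.

(** For [|tau| < 2] there are two common points, while disjoint or tangent circles have at most
    one. *)
Lemma large_tau_of_cases a1 r1 a2 r2 : 0 < r1 -> 0 < r2 -> cases1to4 a1 r1 a2 r2 ->
  2 <= Rabs (tau a1 r1 a2 r2).
Proof.
  intros H1 H2 Hc. apply Rnot_lt_le. intros Hlt.
  destruct (two_intersections a1 r1 a2 r2 H1 H2 Hlt) as (p & q & Hpq & Hp & Hq).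
  assert (HT : ~ tangent_circles a1 r1 a2 r2).
  { intros (x & _ & Hx). apply Hpq. rewrite (Hx p Hp), (Hx q Hq). reflexivity. }
  assert (HD : ~ disjoint_circles a1 r1 a2 r2) by (intros H; now apply (H p)).
  destruct Hc as [[H _]|[[H _]|[[H _]|[H _]]]]; tauto.
Qed.

(** Tangents are radii turned by [i], so their angle is that of the radii, known from the law of
    cosines. As lines are unoriented, the angle determines only [|tau|]. *)
Lemma circle_angle_at_intersection a1 r1 a2 r2 p : 0 < r1 -> 0 < r2 -> inter a1 r1 a2 r2 p ->
  circle_angle a1 a2 p = acos (Rabs (tau a1 r1 a2 r2 / 2)) /\ Rabs (tau a1 r1 a2 r2 / 2) <= 1.
Proof.
  intros H1 H2 [P1 P2]. unfold circle in P1, P2.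
  assert (Hr : 0 < r1 * r2) by (apply Rmult_lt_0_compat; lra).
  assert (M1 : Cmod (tangent_dir a1 p) = r1)
    by (unfold tangent_dir; rewrite Cmod_mult, Cmod_Ci, P1; ring).
  assert (M2 : Cmod (tangent_dir a2 p) = r2)
    by (unfold tangent_dir; rewrite Cmod_mult, Cmod_Ci, P2; ring).
  assert (E : Re (tangent_dir a1 p * Cconj (tangent_dir a2 p))%C = tau a1 r1 a2 r2 / 2 * (r1 * r2)).
  { unfold tau. transitivity ((r1 * r1 + r2 * r2 - Cmod (a2 - a1) * Cmod (a2 - a1)) / 2); [|field; lra].
    rewrite <- P1, <- P2, !Cmod_sqr. unfold tangent_dir, Re. simpl. field. }
  pose proof (re_le_Cmod (tangent_dir a1 p * Cconj (tangent_dir a2 p))) as T.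
  rewrite Cmod_mult, Cmod_conj, M1, M2 in T.
  unfold circle_angle, line_angle. rewrite M1, M2. rewrite E in *.
  rewrite Rabs_mult, (Rabs_pos_eq (r1 * r2)) in * by lra.
  split.
  - f_equal. field. lra.
  - apply Rmult_le_reg_r with (r1 * r2); lra.
Qed.

(** * The counterexample for rational angles *)

Lemma Cmod_minus_eq_plus (u v : C) : Re (u * Cconj v)%C = 0 -> Cmod (u - v) = Cmod (u + v).
Proof. intros H. apply Cmod_sqr_eq. unfold Re in H. destruct u, v; simpl in *. lra. Qed.

Lemma de_moivre t n : (((cos t, sin t) : C) ^ n)%C = (cos (INR n * t), sin (INR n * t)).
Proof.
  induction n as [|n IH].
  - simpl. rewrite Rmult_0_l, cos_0, sin_0. reflexivity.
  - rewrite Cpow_S, IH, S_INR, Rmult_plus_distr_r, Rmult_1_l, cos_plus, sin_plus.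
    apply injective_projections; simpl; ring.
Qed.

(** The two circles meet at [+- i s]; [((z - i s) / (z + i s))^n] is a real multiple of [kappa] on both of them, and [f / g] is its image under a Cayley transform. *)
Lemma sharpness theta : 0 < theta <= PI / 2 -> rational_multiple_of_pi theta ->
  exists (f g : C -> C) (a1 a2 : C) (r1 r2 : R),
    holo_on_disc f /\ holo_on_disc g /\ circle_in_D a1 r1 /\ circle_in_D a2 r2 /\
    circle a1 r1 <> circle a2 r2 /\ case5 a1 r1 a2 r2 theta /\
    eq_mod_on_circles f g a1 r1 a2 r2 /\ ~ unimodular_multiple f g.
Proof.
  intros Hth [q Hq]. pose proof PI_RGT_0 as Hpi.
  (* The centres are [c] and [- c], both radii [1 / 4]. Then [c^2 + s^2 = 1 / 16] puts the common
     points at [+- i s], and the double angle formula gives [tau / 2 = cos theta]. *)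
  set (c := sin (theta / 2) / 4). set (s := cos (theta / 2) / 4).
  assert (Hc : 0 < c) by (unfold c; pose proof (sin_gt_0 (theta / 2) ltac:(lra) ltac:(lra)); lra).
  assert (Hs : 0 < s) by (unfold s; pose proof (cos_gt_0 (theta / 2) ltac:(lra) ltac:(lra)); lra).
  assert (Hcs : c * c + s * s = 1 / 16).
  { unfold c, s. pose proof (sin2_cos2 (theta / 2)) as T. unfold Rsqr in T. lra. }
  assert (Hcos : s * s - c * c = cos theta / 16).
  { unfold c, s. replace theta with (2 * (theta / 2)) at 5 by field. rewrite cos_2a. field. }
  assert (Hsin : 2 * c * s = sin theta / 16).
  { unfold c, s. replace theta with (2 * (theta / 2)) at 3 by field. rewrite sin_2a. field. }
  assert (Hc4 : c <= 1 / 4) by nra. assert (Hs4 : s <= 1 / 4) by nra.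
  set (n := Pos.to_nat (Qden q)).
  assert (Hn : (0 < n)%nat) by apply Pos2Nat.is_pos.
  assert (Hnth : sin (INR n * theta) = 0).
  { apply sin_eq_0_1. exists (Qnum q). unfold n. rewrite INR_Pos, Hq. unfold Q2R.
    field. apply not_0_IZR. discriminate. }
  (* With [x] the real part of [z], the product [(z - is) * Cconj (z + is)] equals [2 x u] on the
     circle about [c] and [- 2 x Cconj u] on the one about [- c]. *)
  set (is := ((0, s) : C)). set (u := ((c, - s) : C)). set (kappa := (u ^ n)%C).
  assert (Hu : u <> 0) by (intros E; apply (f_equal fst) in E; simpl in E; lra).
  assert (Hk : kappa <> 0) by now apply Cpow_nz.
  assert (Eu : (u * u)%C = (RtoC (- (1 / 16)) * (cos theta, sin theta))%C).
  { apply injective_projections; simpl; lra. }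
  (* Rationality of the angle is used here: [kappa] and its conjugate are real multiples of each
     other, so one constant serves both circles. *)
  assert (Hk2 : Im (kappa * kappa)%C = 0).
  { unfold kappa. rewrite <- Cpow_mult_l, Eu, Cpow_mult_l, de_moivre, <- RtoC_pow, Hnth.
    unfold Im; simpl. ring. }
  set (f := fun z => ((z - is) ^ n - Ci * kappa * (z + is) ^ n)%C).
  set (g := fun z => ((z - is) ^ n + Ci * kappa * (z + is) ^ n)%C).
  assert (Hm : forall a z, Cmod (z - a) = 1 / 4 <->
     (fst z - fst a) * (fst z - fst a) + (snd z - snd a) * (snd z - snd a) = 1 / 16).
  { intros a z. split; intros E.
    - pose proof (Cmod_sqr (z - a)) as T. rewrite E in T. simpl in T. lra.
    - apply Cmod_eq_sqr; [lra|]. simpl. lra. }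
  assert (HinD : forall x : R, Rabs x = c -> circle_in_D (RtoC x) (1 / 4)).
  { intros x Hx. split; [lra|]. intros z Hz. unfold circle in Hz. unfold unit_disc.
    pose proof (Cmod_sub_ge z (RtoC x)) as T. rewrite Cmod_R in T. lra. }
  assert (Hinter : forall z, inter (RtoC c) (1 / 4) (RtoC (- c)) (1 / 4) z <-> z = is \/ z = (- is)%C).
  { intros z. unfold inter, circle. rewrite !Hm. destruct z as [x y]; simpl. split.
    - intros [E1 E2]. assert (x = 0) by nra. subst x.
      assert ((y - s) * (y + s) = 0) by nra.
      apply Rmult_integral in H as [H|H]; [left|right]; unfold is; apply injective_projections; simpl; lra.
    - intros [E|E]; injection E as E1 E2; subst x y; simpl; nra. }
  assert (Htau : tau (RtoC c) (1 / 4) (RtoC (- c)) (1 / 4) / 2 = cos theta).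
  { unfold tau. rewrite Cmod_sqr. simpl. lra. }
  exists f, g, (RtoC c), (RtoC (- c)), (1 / 4), (1 / 4).
  repeat match goal with |- _ /\ _ => split end.
  - intros z _. apply ex_derive_of_cdiff. unfold f. cdiff_auto.
  - intros z _. apply ex_derive_of_cdiff. unfold g. cdiff_auto.
  - apply HinD, Rabs_pos_eq. lra.
  - apply HinD. rewrite Rabs_Ropp. apply Rabs_pos_eq. lra.
  - intros E. pose proof (circle_point (RtoC c) (1 / 4) ltac:(lra)) as P.
    rewrite E in P. unfold circle in P. rewrite Hm in P. simpl in P. nra.
  - split; [|split; [lra|]].
    { exists is, (- is)%C. repeat split; try apply Hinter; auto.
      intros E. apply (f_equal snd) in E. simpl in E. lra. }
    intros p Hp. destruct (circle_angle_at_intersection (RtoC c) (1 / 4) (RtoC (- c)) (1 / 4) p) as [-> _];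
      [lra|lra|assumption|].
    rewrite Htau, Rabs_pos_eq by (apply cos_ge_0; lra). apply acos_cos. lra.
  - intros z Hz. unfold f, g. apply Cmod_minus_eq_plus.
    rewrite !Cmult_conj, Cpow_conj.
    replace ((z - is) ^ n * (Cconj Ci * Cconj kappa * Cconj (z + is) ^ n))%C
      with (((z - is) * Cconj (z + is)) ^ n * (Cconj Ci * Cconj kappa))%C by (rewrite Cpow_mult_l; ring).
    unfold circle in Hz. rewrite !Hm in Hz. destruct Hz as [Hz|Hz].
    + replace ((z - is) * Cconj (z + is))%C with (RtoC (2 * fst z) * u)%C.
      2:{ unfold is, u. destruct z as [x y]; simpl in *. apply injective_projections; simpl; nra. }
      rewrite Cpow_mult_l, <- RtoC_pow. fold kappa.
      destruct kappa as [k1 k2]. unfold Re; simpl. ring.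
    + replace ((z - is) * Cconj (z + is))%C with (RtoC (- (2 * fst z)) * Cconj u)%C.
      2:{ unfold is, u. destruct z as [x y]; simpl in *. apply injective_projections; simpl; nra. }
      rewrite Cpow_mult_l, <- RtoC_pow, <- Cpow_conj. fold kappa.
      destruct kappa as [k1 k2]. unfold Re, Im in *; simpl in *.
      set (x := (- (2 * fst z)) ^ n).
      transitivity (- x * (k1 * k2 + k2 * k1)); [ring|]. rewrite Hk2. ring.
  (* The ratio [f / g] is [-1] at [is] and [1] at [- is], so no single constant fits. *)
  - intros [e [_ He]].
    assert (Mis : Cmod is = s) by (apply Cmod_eq_sqr; simpl; [lra|unfold is; simpl; ring]).
    pose proof (He is) as E1. pose proof (He (- is)%C) as E2.
    unfold unit_disc in E1, E2. rewrite Cmod_opp in E2.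
    specialize (E1 ltac:(lra)). specialize (E2 ltac:(lra)).
    unfold f, g in E1, E2.
    replace (is - is)%C with (RtoC 0) in E1 by ring. replace (- is + is)%C with (RtoC 0) in E2 by ring.
    assert (Z : (RtoC 0 ^ n)%C = 0) by (destruct n; [lia|simpl; ring]).
    rewrite Z in E1, E2.
    assert (Nis : (is + is)%C <> 0) by (intros E; apply (f_equal snd) in E; simpl in E; lra).
    assert (Nis' : (- is - is)%C <> 0) by (intros E; apply (f_equal snd) in E; simpl in E; lra).
    assert (NCi : Ci <> 0) by (intros E; apply (f_equal snd) in E; simpl in E; lra).
    pose proof (Cmult_neq_0 _ _ (Cmult_neq_0 _ _ NCi Hk) (Cpow_nz _ n Nis)) as N1.
    pose proof (Cpow_nz _ n Nis') as N2.
    set (v := (Ci * kappa * (is + is) ^ n)%C) in *. set (w := ((- is - is) ^ n)%C) in *.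
    assert (e1 : (e + 1)%C = 0).
    { destruct (Ceq_dec (e + 1) 0) as [|Hn1]; [assumption|exfalso]. apply (Cmult_neq_0 _ _ Hn1 N1).
      transitivity (e * (0 + v) - (0 - v))%C; [ring|]. rewrite E1. ring. }
    assert (e2 : (e - 1)%C = 0).
    { destruct (Ceq_dec (e - 1) 0) as [|Hn1]; [assumption|exfalso]. apply (Cmult_neq_0 _ _ Hn1 N2).
      transitivity (e * (w + Ci * kappa * 0) - (w - Ci * kappa * 0))%C; [ring|]. rewrite E2. ring. }
    apply (f_equal fst) in e1. apply (f_equal fst) in e2. simpl in e1, e2. lra.
Qed.

Lemma holo_of_holo_on_disc f : holo_on_disc f -> holo f.
Proof. intros H z Hz. apply cdiff_of_ex_derive, H, Hz. Qed.

Theorem theorem2p16 :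
  (* cases (1)-(4), possibly after swapping C1 and C2 *)
  (forall (f g : C -> C) (a1 a2 : C) (r1 r2 : R),
     holo_on_disc f -> holo_on_disc g ->
     circle_in_D a1 r1 -> circle_in_D a2 r2 ->
     circle a1 r1 <> circle a2 r2 ->
     eq_mod_on_circles f g a1 r1 a2 r2 ->
     (cases1to4 a1 r1 a2 r2 \/ cases1to4 a2 r2 a1 r1) ->
     unimodular_multiple f g) /\
  (* case (5) with theta an irrational multiple of pi *)
  (forall (f g : C -> C) (a1 a2 : C) (r1 r2 theta : R),
     holo_on_disc f -> holo_on_disc g ->
     circle_in_D a1 r1 -> circle_in_D a2 r2 ->
     circle a1 r1 <> circle a2 r2 ->
     eq_mod_on_circles f g a1 r1 a2 r2 ->
     case5 a1 r1 a2 r2 theta ->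
     ~ rational_multiple_of_pi theta ->
     unimodular_multiple f g) /\
  (* sharpness: for rational multiples of pi the conclusion can fail *)
  (forall theta : R, 0 < theta <= PI / 2 -> rational_multiple_of_pi theta ->
     exists (f g : C -> C) (a1 a2 : C) (r1 r2 : R),
       holo_on_disc f /\ holo_on_disc g /\
       circle_in_D a1 r1 /\ circle_in_D a2 r2 /\
       circle a1 r1 <> circle a2 r2 /\
       case5 a1 r1 a2 r2 theta /\
       eq_mod_on_circles f g a1 r1 a2 r2 /\
       ~ unimodular_multiple f g).
Proof.
  repeat split.
  - intros f g a1 a2 r1 r2 Hf Hg D1 D2 Hne Heq [Hc|Hc].
    + apply (rigidity f g a1 r1 a2 r2); auto using holo_of_holo_on_disc.
      apply chebyshev_neq_0_of_large, large_tau_of_cases; [apply D1|apply D2|assumption].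
    + apply (rigidity f g a2 r2 a1 r1); auto using holo_of_holo_on_disc.
      * intros z Hz. apply Heq. tauto.
      * apply chebyshev_neq_0_of_large, large_tau_of_cases; [apply D2|apply D1|assumption].
  - intros f g a1 a2 r1 r2 theta Hf Hg D1 D2 Hne Heq (HT & Hth & Hang) Hirr.
    apply (rigidity f g a1 r1 a2 r2); auto using holo_of_holo_on_disc.
    (* The angle at one common point already gives [|tau| = 2 * cos theta]. *)
    intros n Hn. apply (chebyshev_neq_0_of_irrational theta Hth Hirr); [|assumption].
    destruct HT as (p & _ & _ & Hp & _).
    destruct (circle_angle_at_intersection a1 r1 a2 r2 p) as [E L]; [apply D1|apply D2|assumption|].
    rewrite (Hang p Hp) in E. rewrite E, cos_acos by (pose proof (Rabs_pos (tau a1 r1 a2 r2 / 2)); lra).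
    unfold Rdiv. rewrite Rabs_mult, (Rabs_pos_eq (/ 2)) by lra. field.
  - exact sharpness.
Qed.
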